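(* There exists a universal constant $c_0>0$ such that for every $q\in\mathbb{N}$ there is a constant $C=C(q)>0$ with the following property. Let $k\in\mathbb{Z}\setminus\{0\}$, $\nu>0$, $B\in\mathbb{R}$ satisfy $\frac{\nu}{|kB|}\le c_0(1+q)^{-3}$, let $T>0$, let $w_k(0)\in L^2_r$, and let $w$ be the solution of $$\partial_t w+\mathcal{T}w=0,\qquad w|_{t=0}=w_k(0),\qquad w|_{r=1,\infty}=0,$$ on $(0,T)\times(1,\infty)$. Then, with $\Phi(\mathcal{T}):=\nu^{1/3}|kB|^{2/3}$, $$\bigl\|(1+\Phi(\mathcal{T})t/r^2)^{q}\,w\bigr\|_{L^\infty_T(L^2_r)}+\Phi(\mathcal{T})^{1/2}\bigl\|(1+\Phi(\mathcal{T})t/r^2)^{q}\,r^{-1}w\bigr\|_{L^2_T(L^2_r)}\le C\|w_k(0)\|_{L^2_r}.$$ The constant $C$ is independent of $\nu,k,B,T$ and $w_k(0)$.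
   Context: $L^2_r:=L^2((1,\infty),dr)$ (complex-valued functions), and $L^p_T(L^2_r):=L^p((0,T),dt;L^2_r)$. For $k\in\mathbb{Z}$, $\nu>0$, $B\in\mathbb{R}$, $$\mathcal{T}:=-\nu\Bigl(\partial_r^2-\frac{k^2-1/4}{r^2}\Bigr)+\frac{ikB}{r^2},$$ acting on $L^2_r$ with domain $D:=H^2((1,\infty),dr)\cap H^1_0((1,\infty),dr)$. The solution is the usual one, $w(t)=e^{-t\mathcal{T}}w_k(0)$ (equivalently, the weak solution in $C([0,T];L^2_r)\cap L^2(0,T;H^1_0(1,\infty))$). *)

(* Defs.v *)
From HB Require Import structures.
From mathcomp Require Import all_boot all_order all_algebra.
From mathcomp Require Import all_classical all_reals all_analysis.
From mathcomp Require Import complex.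

Set Implicit Arguments.
Unset Strict Implicit.
Unset Printing Implicit Defensive.

Import Order.TTheory GRing.Theory Num.Theory.
Import numFieldNormedType.Exports.

Local Open Scope classical_set_scope.
Local Open Scope ring_scope.
Local Open Scope complex_scope.

Section ComplexValued.
Context {R : realType}.

Local Notation leb := (@lebesgue_measure R).

Definition cmeasurable {d : measure_display} {X : measurableType d}
    (D : set X) (f : X -> R[i]) : Prop :=
  measurable_fun D (fun x => complex.Re (f x)) /\
  measurable_fun D (fun x => complex.Im (f x)).

Definition cintegral (D : set R) (f : R -> R[i]) : R[i] :=
  (\int[leb]_(x in D) complex.Re (f x))%R +i* (\int[leb]_(x in D) complex.Im (f x))%R.

Definition cderive (f : R -> R[i]) (x : R) : R[i] :=
  derive1 (fun y => complex.Re (f y)) x +i* derive1 (fun y => complex.Im (f y)) x.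

Definition csmooth (f : R -> R[i]) : Prop :=
  forall (n : nat) (x : R),
    derivable (derive1n n (fun y => complex.Re (f y))) x 1 /\
    derivable (derive1n n (fun y => complex.Im (f y))) x 1.

(* Functions of r are total on R, but only their values on (1, oo) matter. *)
Definition halfline : set R := `]1, +oo[.

Definition L2norm (f : R -> R[i]) : \bar R :=
  Lnorm leb 2%:E ((fun r => (ComplexField.Normc.normc (f r))%:E) \_ halfline).

Definition L2 (f : R -> R[i]) : Prop :=
  cmeasurable halfline f /\ (L2norm f < +oo)%E.

Definition L2inner (f g : R -> R[i]) : R[i] :=
  cintegral halfline (fun r => f r * conjc (g r)).

(* The norm of L^p((0,T), dt; L^2_r), for p an extended real. *)
Definition LpL2norm (T : R) (p : \bar R) (F : R -> R -> R[i]) : \bar R :=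
  Lnorm leb p ((fun t : R => L2norm (F t)) \_ `]0, T[).

(* C_c^oo((1,oo)) *)
Definition test_function (phi : R -> R[i]) : Prop :=
  csmooth phi /\
  exists a b : R, 1 < a /\ forall r, ~~ (a <= r <= b) -> phi r = 0.

(* [H10 u v]: u belongs to H^1_0((1,oo)), the closure of C_c^oo((1,oo)) for the
   H^1 norm, and v is its weak derivative. The convergence of phi_n to u and of
   phi_n' to v in L^2 forces v to be the distributional derivative of u. *)
Definition H10 (u v : R -> R[i]) : Prop :=
  [/\ L2 u, L2 v &
    exists phi : nat -> R -> R[i],
      [/\ forall n, test_function (phi n),
          (fun n => L2norm (fun r => phi n r - u r)) @ \oo --> 0%E &
          (fun n => L2norm (fun r => cderive (phi n) r - v r)) @ \oo --> 0%E]].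

(* The zeroth-order coefficient nu (k^2 - 1/4) / r^2 + i k B / r^2 of the operator
   T = - nu (d_r^2 - (k^2 - 1/4) / r^2) + i k B / r^2. *)
Definition Tpotential (k : int) (nu B r : R) : R[i] :=
  (nu * (k%:~R ^+ 2 - 4^-1) / r ^+ 2) +i* (k%:~R * B / r ^+ 2).

(* The sesquilinear form of T on H^1_0: for u in H^2 /\ H^1_0 and g in H^1_0, with
   derivatives du and dg, one integration by parts gives
   <T u, g> = nu <du, dg> + <Tpotential u, g>. *)
Definition Tform (k : int) (nu B : R) (u du g dg : R -> R[i]) : R[i] :=
  nu%:C * L2inner du dg + L2inner (fun r => Tpotential k nu B r * u r) g.

(* w is the weak solution in C([0,T]; L^2_r) /\ L^2(0,T; H^1_0(1,oo)) of
   d_t w + T w = 0 with w(0) = w0; here dw stands for d_r w. The equation tested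
   against g in H^1_0, d/dt <w(t), g> + Tform(w(t), g) = 0, is integrated in time. *)
Definition weak_solution (k : int) (nu B T : R) (w0 : R -> R[i])
    (w : R -> R -> R[i]) : Prop :=
  [/\ cmeasurable (`]0, T[ `*` halfline) (fun z : R * R => w z.1 z.2),
      forall t : R, 0 <= t <= T -> L2 (w t),
      forall t : R, 0 <= t <= T ->
        (fun s => L2norm (fun r => w s r - w t r)) @ within `[0, T] (nbhs t) --> 0%E,
      L2norm (fun r => w 0 r - w0 r) = 0%E &
      exists dw : R -> R -> R[i],
        [/\ cmeasurable (`]0, T[ `*` halfline) (fun z : R * R => dw z.1 z.2),
            {ae leb, forall t : R, 0 < t < T -> H10 (w t) (dw t)},
            (LpL2norm T 2%:E dw < +oo)%E &
            forall g dg, H10 g dg -> forall t : R, 0 <= t <= T ->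
              L2inner (w t) g - L2inner (w 0) g
              + cintegral `]0, t[ (fun s => Tform k nu B (w s) (dw s) g dg) = 0]].

(* Phi(T) = nu^(1/3) |k B|^(2/3) *)
Definition PhiT (k : int) (nu B : R) : R :=
  nu `^ (3^-1) * `|k%:~R * B| `^ (2 / 3).

End ComplexValued.

(* Main.v *)
(** Put K = k B, e = (nu / |K|)^(1/3) and Phi = nu^(1/3) |K|^(2/3), so that nu = e^2 Phi and
    |K| = Phi / e. Let tau = Phi t / r^2, s = 1 / (1 + tau), th = 1 - s and
    m = (1 + kq tau)^(2 q) with kq of order 1 / (1 + q). For w = w1 + i w2 consider
      E(t) = int m (1 + s) |w|^2 + d e^2 th r^2 m |d_r w|^2
                 - sign(K) d e r th^2 m (w1 d_r w2 - w2 d_r w1) dr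
    with d a small absolute constant. In dE/dt the shear K / r^2 acts on the cross term and
    yields - 2 d Phi int th^2 m |w|^2 / r^2, the decay of s in time yields
    - Phi int s^2 m |w|^2 / r^2, and s^2 + th^2 >= 1/2. All other terms are absorbed by the
    viscous dissipation, as e (1 + q) is small. Hence
      dE/dt <= - (d/4) Phi int m |w|^2 / r^2,
    while E >= (1/2) int m |w|^2 and E(0) = 2 ||w(0)||^2. Since 1 + tau <= (1 + kq tau) / kq,
    integration in time gives both norms.

    E involves d_r w pointwise in time, so it is computed for the averages of w against a C^1
    kernel supported in [t, t + h]: they solve the equation, and together with their time
    derivatives they lie in H^1_0. The estimate passes to the limit h -> 0, with Fatou's lemma
    for the time integral. *)

(* The length [e r] is the one at which diffusion and shear balance: [nu / (e r)^2] and the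
   variation of [K / r^2] over a width [e r] are both of size [Phi / r^2]. The cross term is the
   hypocoercive one: the commutator of [d_r] with [i K / r^2] is a multiple of [i K / r^3], and it
   turns the skew shear into decay of [|w|^2]. The initial datum is only in L^2, so the weights of
   all terms with [d_r w] have to vanish at [t = 0]; this is what [th] does, while [s] supplies the
   decay as long as [th] is small. Moreover [r^2 th = Phi t s], so these weights stay bounded in
   [r]. The smallness of [e (1 + q)] is the hypothesis on [nu / |k B|], because [e^3 = nu / |K|].
   The obstacle is regularity: the weak solution comes with one radial derivative only. Hence
   [d_r^2 w] is read off the equation, and integrations by parts are performed by adding pairings of
   H^1_0 functions that are known to vanish; the estimate then reduces to a pointwise inequality
   between quadratic forms in [w], [d_r w] and [d_r^2 w]. *)
Require Import Defs.
From HB Require Import structures.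
From mathcomp Require Import all_boot all_order all_algebra.
From mathcomp Require Import all_classical all_reals all_analysis.
From mathcomp Require Import complex.
From mathcomp Require Import ring lra measurable_realfun lebesgue_integral_under ess_sup_inf.

Set Implicit Arguments.
Unset Strict Implicit.
Unset Printing Implicit Defensive.

Import Order.TTheory GRing.Theory Num.Theory.
Import numFieldNormedType.Exports.

Local Open Scope classical_set_scope.
Local Open Scope ring_scope.
Local Open Scope complex_scope.

(** * Square integrable functions on the half line *)

Section SquareIntegrable.
Context {R : realType}.
Notation mu := (@lebesgue_measure R).
Implicit Types (f g h : R -> R).

Definition intR f := mu.-integrable setT (EFin \o f).

Lemma intR_meas f : intR f -> measurable_fun setT f.
Proof. by move=> /integrableP[/measurable_EFinP]. Qed.

Lemma intRD f g : intR f -> intR g -> intR (fun r => f r + g r).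
Proof. exact: (integrableD measurableT). Qed.

Lemma intRB f g : intR f -> intR g -> intR (fun r => f r - g r).
Proof. exact: (integrableB measurableT). Qed.

Lemma intRZ c f : intR f -> intR (fun r => c * f r).
Proof. exact: (integrableZl measurableT). Qed.

Lemma le_intR f g : measurable_fun setT f -> (forall r, `|f r| <= g r) ->
  intR g -> intR f.
Proof.
move=> mf fg; apply: le_integrable => //; first exact/measurable_EFinP.
by move=> r _ /=; rewrite lee_fin (le_trans (fg r)) ?ler_norm.
Qed.

Lemma eq_intR f g : f =1 g -> intR f -> intR g.
Proof. by move=> /funext ->. Qed.

Lemma intR0 : intR (fun=> 0). Proof. exact: integrable0. Qed.

(* A function on (1, oo) is represented by its extension by 0 to the line. *)
Definition l2 f := [/\ measurable_fun setT f, (forall r, r <= 1 -> f r = 0) &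
  intR (fun r => f r ^+ 2)].

Definition ip f g := \int[mu]_r (f r * g r).

Lemma l2_meas f : l2 f -> measurable_fun setT f. Proof. by case. Qed.

Lemma l2_int f g : l2 f -> l2 g -> intR (fun r => f r * g r).
Proof.
move=> [mf f0 If] [mg g0 Ig].
apply: (@le_intR _ (fun r => f r ^+ 2 + g r ^+ 2)).
- exact: measurable_funM.
- move=> r; have := sqr_ge0 (`|f r| - `|g r|).
  rewrite sqrrB !real_normK ?num_real// normrM.
  have := mulr_ge0 (normr_ge0 (f r)) (normr_ge0 (g r)).
  lra.
- exact: intRD.
Qed.

Lemma l2_0 : l2 (fun=> 0).
Proof.
by split=> //; apply: eq_intR intR0 => r; rewrite expr0n.
Qed.

Lemma l2D f g : l2 f -> l2 g -> l2 (fun r => f r + g r).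
Proof.
move=> lf lg; have [[mf f0 If] [mg g0 Ig]] := (lf, lg); split.
- exact: measurable_funD.
- by move=> r r1; rewrite f0// g0// addr0.
- have /(@eq_intR _ _ _) := intRD (intRD If Ig) (intRZ 2 (l2_int lf lg)).
  by apply=> r; ring.
Qed.

Lemma l2Z c f : l2 f -> l2 (fun r => c * f r).
Proof.
move=> [mf f0 If]; split.
- exact: measurable_funM.
- by move=> r r1; rewrite f0// mulr0.
- by apply: eq_intR (intRZ (c ^+ 2) If) => r; rewrite exprMn.
Qed.

Lemma l2N f : l2 f -> l2 (fun r => - f r).
Proof. by move=> /(l2Z (-1)); under eq_fun do rewrite mulN1r. Qed.

Lemma l2B f g : l2 f -> l2 g -> l2 (fun r => f r - g r).
Proof. by move=> lf lg; apply: l2D => //; exact: l2N. Qed.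

Lemma measurable_supp (rho f : R -> R) :
  measurable_fun (@halfline R) rho -> measurable_fun setT f ->
  (forall r, r <= 1 -> f r = 0) -> measurable_fun setT (fun r => rho r * f r).
Proof.
move=> mrho mf f0.
rewrite (_ : (fun _ => _) = (rho \_ (@halfline R)) \* f); last first.
  apply/funext => r /=; rewrite patchE; case: ifPn => //.
  rewrite notin_setE /halfline /= in_itv/= andbT => /negP; rewrite -leNgt => r1.
  by rewrite f0// !mulr0.
apply: measurable_funM => //; apply/(measurable_restrictT _ _).1 => //.
exact: measurable_itv.
Qed.

(** Bounds are asked for [r > 1] only: the weights contain powers of [1 / r], and elements of [l2]
    vanish on the rest of the line. *)
Definition bdmul (rho : R -> R) := measurable_fun (@halfline R) rho /\
  exists C, forall r, 1 < r -> `|rho r| <= C.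

Lemma l2M rho f : bdmul rho -> l2 f -> l2 (fun r => rho r * f r).
Proof.
move=> [mrho [C rhoC]] [mf f0 If].
have mM := measurable_supp mrho mf f0.
split=> //; first by move=> r r1; rewrite f0// mulr0.
apply: (@le_intR _ (fun r => C ^+ 2 * f r ^+ 2)).
- exact: measurable_funX.
- move=> r; rewrite normrX normrM exprMn (real_normK (num_real (f r))).
  have [r1|r1] := leP r 1; first by rewrite f0// expr0n/= !mulr0.
  apply: ler_wpM2r; first exact: sqr_ge0.
  by rewrite lerXn2r ?nnegrE// ?rhoC// (le_trans _ (rhoC r r1)).
- exact: intRZ.
Qed.

Lemma bdmulM rho eta : bdmul rho -> bdmul eta -> bdmul (fun r => rho r * eta r).
Proof.
move=> [mr [C hC]] [me [D hD]]; split; first exact: measurable_funM.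
exists (C * D) => r r1; rewrite normrM ler_pM//; [exact: hC|exact: hD].
Qed.

Lemma bdmulD rho eta : bdmul rho -> bdmul eta -> bdmul (fun r => rho r + eta r).
Proof.
move=> [mr [C hC]] [me [D hD]]; split; first exact: measurable_funD.
exists (C + D) => r r1; rewrite (le_trans (ler_normD _ _))// lerD//; [exact: hC|exact: hD].
Qed.

Lemma bdmul_cst c : bdmul (fun=> c).
Proof. by split=> //; exists `|c| => r _. Qed.

Lemma ipC f g : ip f g = ip g f.
Proof. by apply: eq_Rintegral => r _; rewrite mulrC. Qed.

Lemma ipDl f g h : l2 f -> l2 g -> l2 h ->
  ip (fun r => f r + g r) h = ip f h + ip g h.
Proof.
move=> lf lg lh; rewrite -RintegralD//; [|exact: l2_int|exact: l2_int].
by apply: eq_Rintegral => r _; rewrite mulrDl.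
Qed.

Lemma ipDr f g h : l2 f -> l2 g -> l2 h ->
  ip f (fun r => g r + h r) = ip f g + ip f h.
Proof. by move=> lf lg lh; rewrite ipC ipDl// ![ip _ f]ipC. Qed.

Lemma ipZl c f g : l2 f -> l2 g -> ip (fun r => c * f r) g = c * ip f g.
Proof.
move=> lf lg; rewrite -RintegralZl//; last exact: l2_int.
by apply: eq_Rintegral => r _; rewrite mulrA.
Qed.

Lemma ipZr c f g : l2 f -> l2 g -> ip f (fun r => c * g r) = c * ip f g.
Proof. by move=> lf lg; rewrite ipC ipZl// ipC. Qed.

Lemma ipNl f g : l2 f -> l2 g -> ip (fun r => - f r) g = - ip f g.
Proof.
move=> lf lg; rewrite -mulN1r -ipZl//.
by apply: eq_Rintegral => r _; rewrite mulN1r.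
Qed.

Lemma ipBl f g h : l2 f -> l2 g -> l2 h ->
  ip (fun r => f r - g r) h = ip f h - ip g h.
Proof. by move=> lf lg lh; rewrite ipDl ?ipNl//; exact: l2N. Qed.

Lemma ipBr f g h : l2 f -> l2 g -> l2 h ->
  ip f (fun r => g r - h r) = ip f g - ip f h.
Proof. by move=> lf lg lh; rewrite ipC ipBl// ![ip _ f]ipC. Qed.

Lemma ip_ge0 f : 0 <= ip f f.
Proof. by apply: Rintegral_ge0 => r _; rewrite -expr2 sqr_ge0. Qed.

Lemma ip0l f : ip (fun=> 0) f = 0.
Proof.
rewrite /ip (_ : (fun _ => _) = cst 0); last by apply/funext => r; rewrite mul0r.
by rewrite Rintegral_cst// mul0r.
Qed.

Lemma eq_ip f f' g g' : f =1 f' -> g =1 g' -> ip f g = ip f' g'.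
Proof. by move=> ff gg; apply: eq_Rintegral => r _; rewrite ff gg. Qed.

Lemma ipMl rho f g : ip (fun r => rho r * f r) g = ip f (fun r => rho r * g r).
Proof. by apply: eq_Rintegral => r _; rewrite mulrCA mulrA. Qed.

(** The quadratic is evaluated at its minimiser [l = - d / p]. If [p = 0] it is affine in [l], and a
    nonzero slope would let it reach [- 1]. *)
Lemma discr_le (p q d : R) : 0 <= p -> 0 <= q ->
  (forall l : R, 0 <= q + 2 * l * d + l ^+ 2 * p) -> d ^+ 2 <= p * q.
Proof.
move=> p0 q0 H; have [p_eq0|pn0] := eqVneq p 0.
  move: H; rewrite p_eq0 mul0r => H.
  have [->|dn0] := eqVneq d 0; first by rewrite expr0n/=.
  have := H (- (q + 1) / (2 * d)); rewrite mulr0 addr0.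
  have -> : q + 2 * (- (q + 1) / (2 * d)) * d = - 1 by field.
  by rewrite oppr_ge0 ler10.
have pp : 0 < p by rewrite lt_neqAle eq_sym pn0.
have := H (- d / p).
have -> : q + 2 * (- d / p) * d + (- d / p) ^+ 2 * p = (p * q - d ^+ 2) / p by field.
by rewrite pmulr_lge0 ?invr_gt0// subr_ge0.
Qed.

Lemma ip_expand f g (l : R) : l2 f -> l2 g ->
  ip (fun r => f r + l * g r) (fun r => f r + l * g r)
  = ip f f + 2 * l * ip f g + l ^+ 2 * ip g g.
Proof.
move=> lf lg; have lZ := l2Z l lg; have lD := l2D lf lZ.
rewrite ipDl// ipDr// ipDr// !ipZl// !ipZr// [ip g f]ipC; ring.
Qed.

Lemma ip_cauchy f g : l2 f -> l2 g -> ip f g ^+ 2 <= ip f f * ip g g.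
Proof.
move=> lf lg; rewrite [leRHS]mulrC; apply: discr_le; [exact: ip_ge0..|] => l.
by rewrite -ip_expand// ip_ge0.
Qed.

Lemma ip_le f g h k : l2 f -> l2 g -> l2 h -> l2 k ->
  (forall r, 1 < r -> f r * g r <= h r * k r) -> ip f g <= ip h k.
Proof.
move=> lf lg lh lk H; apply: le_Rintegral => //; [exact: l2_int..|] => r _.
have [r1|] := leP r 1; last exact: H.
by case: lf => _ -> // _; case: lh => _ -> //; rewrite !mul0r.
Qed.

Lemma ip_normD_le f g : l2 f -> l2 g ->
  ip (fun r => f r + g r) (fun r => f r + g r) <= 2 * ip f f + 2 * ip g g.
Proof.
move=> lf lg; have := ip_ge0 (fun r => f r + (-1) * g r).
have := ip_expand 1 lf lg; under eq_ip do [rewrite mul1r|rewrite mul1r].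
move=> ->; rewrite ip_expand//; lra.
Qed.

(* Finite combinations of inner products, as lists of (coefficient, f, g). *)
Definition wsum (l : seq (R * (R -> R) * (R -> R))) :=
  \sum_(p <- l) p.1.1 * ip p.1.2 p.2.

Fixpoint l2s (l : seq (R * (R -> R) * (R -> R))) : Prop :=
  if l is p :: l' then [/\ l2 p.1.2, l2 p.2 & l2s l'] else True.

Lemma wsum_int l : l2s l ->
  intR (fun r => \sum_(p <- l) p.1.1 * (p.1.2 r * p.2 r)) /\
  wsum l = \int[mu]_r (\sum_(p <- l) p.1.1 * (p.1.2 r * p.2 r)).
Proof.
rewrite /wsum; elim: l => [_|p l IH /= [l1 l2' /IH[I E]]].
  under eq_fun do rewrite big_nil; rewrite big_nil; split; first exact: intR0.
  by rewrite Rintegral_cst// mul0r.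
have Ip := l2_int l1 l2'; have IZ := intRZ p.1.1 Ip; split.
  by apply: eq_intR (intRD IZ I) => r; rewrite big_cons.
under eq_Rintegral do rewrite big_cons.
by rewrite big_cons E RintegralD// RintegralZl.
Qed.

(** Transfers a pointwise inequality that mixes many products to inner products in one stroke; where
    [r <= 1] all products vanish, so only [r > 1] has to be checked. *)
Lemma wsum_le0 l : l2s l ->
  (forall r, 1 < r -> \sum_(p <- l) p.1.1 * (p.1.2 r * p.2 r) <= 0) -> wsum l <= 0.
Proof.
move=> /[dup] ls /wsum_int[I E] H; rewrite E.
have z0 : \int[mu]_r 0 = 0 :> R by rewrite Rintegral_cst// mul0r.
suff : \int[mu]_r (\sum_(p <- l) p.1.1 * (p.1.2 r * p.2 r)) <= \int[mu]_r 0 by rewrite z0.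
apply: le_Rintegral => //; first exact: intR0.
move=> r _; have [r1|] := leP r 1; last exact: H.
rewrite le_eqVlt; apply/orP; left; apply/eqP.
elim: l {I E H} ls => [|p l IH /= [[_ p0 _] _ /IH]]; rewrite ?big_nil// big_cons.
by move=> ->; rewrite p0// mul0r mulr0 addr0.
Qed.

End SquareIntegrable.

(** * Test functions and the space H^1_0 *)

Section SobolevSpace.
Context {R : realType}.
Notation mu := (@lebesgue_measure R).
Implicit Types (f g h u v phi rho : R -> R).

Definition smooth f := forall (n : nat) (x : R), derivable (derive1n n f) x 1.

Definition test phi := smooth phi /\
  exists a b : R, 1 < a /\ forall r, ~~ (a <= r <= b) -> phi r = 0.

Lemma smooth_derive f : smooth f -> smooth (derive1 f).
Proof.
by move=> sf n x; move: (sf n.+1 x); rewrite /derive1n iterSr.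
Qed.

(** Smoothness by an invariant: a property that yields differentiability and passes to the
    derivative. No description of the n-th derivative is then called for. *)
Lemma smooth_ind (P : (R -> R) -> Prop) :
  (forall f, P f -> (forall x, derivable f x 1) /\ P (derive1 f)) ->
  forall f, P f -> smooth f.
Proof.
move=> HP f Pf n; suff : P (derive1n n f) by move=> /HP[].
by elim: n => [//|n IH]; rewrite derive1nS; exact: (HP _ IH).2.
Qed.

Lemma derivable_cont f x : derivable f x 1 -> {for x, continuous f}.
Proof. by move=> /derivable1_diffP/differentiable_continuous. Qed.

Lemma smooth_cont f : smooth f -> continuous f.
Proof. by move=> sf x; apply: derivable_cont; exact: (sf 0%N). Qed.

(* The multipliers for which [testM] holds. Only r > 1 matters; the margin 1/2 makes
   [rsm_smooth_supp] a statement about smooth functions on the whole line. *)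
Inductive rsm : (R -> R) -> Prop :=
| rsm_cst c : rsm (fun=> c)
| rsm_id : rsm (fun r => r)
| rsm_smooth f : smooth f -> rsm f
| rsm_add f g : rsm f -> rsm g -> rsm (fun r => f r + g r)
| rsm_mul f g : rsm f -> rsm g -> rsm (fun r => f r * g r)
| rsm_inv f : rsm f -> (forall r : R, 2^-1 < r -> f r != 0) -> rsm (fun r => (f r)^-1).

Lemma rsm_exp f n : rsm f -> rsm (fun r => f r ^+ n).
Proof.
move=> rf; elim: n => [|n IH]; first exact: rsm_cst.
under eq_fun do rewrite exprS; exact: rsm_mul.
Qed.

(** The class is closed under differentiation, which makes it an invariant for [smooth_ind]. The
    derivative is an element [g] of the class instead of [derive1 f], as the two are only claimed to
    agree for [r > 1 / 2]. *)
Lemma rsm_derive f : rsm f ->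
  exists2 g, rsm g & forall r : R, 2^-1 < r -> is_derive r 1 f (g r).
Proof.
elim=> {f} [c||f sf|f g _ [f' rf' Df] _ [g' rg' Dg]
  |f g rf [f' rf' Df] rg [g' rg' Dg]|f rf [f' rf' Df] f0].
- by exists (fun=> 0); [exact: rsm_cst|move=> r _; exact: is_derive_cst].
- by exists (fun=> 1); [exact: rsm_cst|move=> r _; exact: is_derive_id].
- exists (derive1 f); first exact/rsm_smooth/smooth_derive.
  by move=> r _; rewrite derive1E; apply: DeriveDef => //; exact: (sf 0%N).
- exists (fun r => f' r + g' r); first exact: rsm_add.
  by move=> r r0; apply: is_deriveD; [exact: Df|exact: Dg].
- exists (fun r => f r * g' r + g r * f' r).
    by apply: rsm_add; exact: rsm_mul.
  by move=> r r0; apply: is_deriveM; [exact: Df|exact: Dg].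
- exists (fun r => (-1) * ((f r)^-1 * (f r)^-1) * f' r).
    apply: rsm_mul => //; apply: rsm_mul; first exact: rsm_cst.
    by apply: rsm_mul; exact: rsm_inv.
  move=> r r0; apply: is_derive_eq; first by apply: is_deriveV; [exact: f0|exact: Df].
  by rewrite mulN1r -invfM -expr2.
Qed.

Lemma near_gt (a x : R) : a < x -> \forall y \near x, a < y.
Proof. by move=> ax; apply: lt_nbhsr. Qed.

Lemma near_lt (a x : R) : x < a -> \forall y \near x, y < a.
Proof. by move=> ax; apply: lt_nbhsl. Qed.

(** The open half lines [r > 1 / 2] and [r < a] cover the line because [a > 1]. On the first [f]
    agrees with a function of class [rsm], on the second with 0, and both descriptions pass to the
    derivative. *)
Lemma rsm_smooth_supp f a : 1 < a -> rsm f -> (forall r, r < a -> f r = 0) -> smooth f.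
Proof.
move=> a1 rf f0.
pose P f := (exists2 g, rsm g & forall r : R, 2^-1 < r -> f r = g r) /\
  (forall r, r < a -> f r = 0).
apply: (@smooth_ind P) => [{}f {rf f0}[[g rg fg] f0]|]; last by split=> //; exists f.
have [g' rg' Dg] := rsm_derive rg.
have D1 (x : R) : 2^-1 < x -> is_derive x 1 f (g' x).
  move=> x0; apply: near_eq_is_derive (Dg _ x0).
  by near=> y; rewrite fg//; near: y; exact: near_gt.
have D2 (x : R) : x < a -> is_derive x 1 f 0.
  move=> xa; apply: (@near_eq_is_derive _ _ _ (cst 0)).
  by near=> y; rewrite f0//; near: y; exact: near_lt.
split; first by move=> x; have [x0|x0] := ltP 2^-1 x; [case: (D1 _ x0)|have /D2[] : x < a by lra].
split.
  by exists g' => // r r0; rewrite derive1E; case: (D1 _ r0).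
by move=> r ra; rewrite derive1E; case: (D2 _ ra).
Unshelve. all: by end_near. Qed.

Lemma test_derive phi : test phi -> test (derive1 phi).
Proof.
move=> [sp [a [b [a1 p0]]]]; split; first exact: smooth_derive.
exists a, b; split=> // r rab; rewrite derive1E.
suff : is_derive r 1 phi 0 by case.
apply: (@near_eq_is_derive _ _ _ (cst 0)).
rewrite negb_and -!ltNge in rab.
by case/orP: rab => rab; near=> y; rewrite p0// negb_and -!ltNge; apply/orP;
  [left; near: y; exact: near_lt|right; near: y; exact: near_gt].
Unshelve. all: by end_near. Qed.

Lemma testM rho phi : rsm rho -> test phi -> test (fun r => rho r * phi r).
Proof.
move=> rr [sp [a [b [a1 p0]]]]; split.
  apply: (@rsm_smooth_supp _ a) => //.
    by apply: rsm_mul => //; exact: rsm_smooth.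
  by move=> r ra; rewrite p0 ?mulr0// negb_and -!ltNge ra.
by exists a, b; split=> // r rab; rewrite p0// mulr0.
Qed.

Lemma testD phi psi : test phi -> test psi -> test (fun r => phi r + psi r).
Proof.
move=> [sp [a [b [a1 p0]]]] [sq [c [d [c1 q0]]]].
have z r : ~~ (Num.min a c <= r <= Num.max b d) -> phi r = 0 /\ psi r = 0.
  rewrite negb_and -!ltNge lt_min gt_max => H; split; [apply: p0|apply: q0];
  by rewrite negb_and -!ltNge; case/orP: H => /andP[h1 h2]; rewrite ?h1 ?h2 ?orbT.
have m1 : 1 < Num.min a c by rewrite lt_min a1.
split.
  apply: (@rsm_smooth_supp _ (Num.min a c)) => //.
    by apply: rsm_add; exact: rsm_smooth.
  move=> r ra; have [|-> ->] := z r; last by rewrite addr0.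
  by rewrite negb_and -!ltNge ra.
exists (Num.min a c), (Num.max b d); split=> // r /z[-> ->]; exact: addr0.
Qed.

Lemma test_derivable phi x : test phi -> derivable phi x 1.
Proof. by case=> sp _; exact: (sp 0%N). Qed.

Lemma intR_itv f (a b : R) : (forall r, ~~ (a <= r <= b) -> f r = 0) ->
  mu.-integrable `[a, b] (EFin \o f) -> intR f.
Proof.
move=> f0 If; have mI : measurable (`[a, b]%classic : set R) by exact: measurable_itv.
have := (@integrable_mkcond _ _ _ mu _ (EFin \o f) mI).1 If.
apply: eq_integrable => // r _.
rewrite patchE; case: ifPn => //; rewrite notin_setE /= in_itv/= => /negP H.
by rewrite f0.
Qed.

Lemma Rintegral_itv f (a b : R) : (forall r, ~~ (a <= r <= b) -> f r = 0) ->
  \int[mu]_r f r = \int[mu]_(r in `[a, b]) f r.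
Proof.
move=> f0; rewrite [RHS]Rintegral_mkcond; apply: eq_Rintegral => r _.
rewrite patchE; case: ifPn => //; rewrite notin_setE /= in_itv/= => /negP H.
by rewrite f0.
Qed.

Lemma test_l2 phi : test phi -> l2 phi.
Proof.
move=> [sp [a [b [a1 p0]]]]; have cp := smooth_cont sp; split.
- exact: continuous_measurable_fun.
- by move=> r r1; rewrite p0// negb_and -!ltNge (le_lt_trans r1 a1).
- apply: (@intR_itv _ a b); first by move=> r rab; rewrite p0// expr0n.
  apply: continuous_compact_integrable; first exact: segment_compact.
  by apply: continuous_subspaceT => x; apply: cvgM; exact: cp.
Qed.

Lemma test_ibp phi psi : test phi -> test psi ->
  ip (derive1 phi) psi + ip phi (derive1 psi) = 0.
Proof.
move=> tp tq; have tp' := test_derive tp; have tq' := test_derive tq.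
have [a [b [ab [z1 z2]]]] : exists a b : R, a < b /\
    (forall r, ~~ (a < r < b) -> phi r = 0) /\ (forall r, ~~ (a < r < b) -> psi r = 0).
  move: tp tq => [sp [a [b [a1 p0]]]] [sq [c [d [c1 q0]]]].
  have b0 : 0 < 1 + `|b| + `|d| by rewrite -addrA ltr_pwDl// addr_ge0.
  (* Both supports lie to the right of 1, hence strictly to the right of 0, and strictly to the left
     of [1 + |b| + |d|]; all boundary terms vanish. *)
  exists 0, (1 + `|b| + `|d|); split=> //; split=> r rab; [apply: p0|apply: q0];
    apply: contra rab => /andP[h1 h2]; rewrite (lt_le_trans _ h1) ?(lt_trans ltr01)//=;
    apply: (le_lt_trans h2); apply: (le_lt_trans (ler_norm _));
    have := normr_ge0 b; have := normr_ge0 d; lra.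
have d1 x : derivable phi x 1 by exact: test_derivable.
have d2 x : derivable psi x 1 by exact: test_derivable.
have c1 : continuous (derive1 phi) by case: tp' => /smooth_cont.
have c2 : continuous (derive1 psi) by case: tq' => /smooth_cont.
have bz1 r : ~~ (a <= r <= b) -> phi r = 0.
  by move=> H; apply: z1; apply: contra H => /andP[/ltW -> /ltW ->].
have bz2 r : ~~ (a <= r <= b) -> psi r = 0.
  by move=> H; apply: z2; apply: contra H => /andP[/ltW -> /ltW ->].
have := @Rintegration_by_parts R phi psi (derive1 phi) (derive1 psi) a b ab.
have LR f : continuous f -> (forall x, derivable f x 1) ->
    derivable_oo_LRcontinuous f a b.
  move=> cf df; split=> [x _|//|]; first exact: df.
  - by apply: cvg_at_right_filter; exact: cf.
  - by apply: cvg_at_left_filter; exact: cf.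
have cd f : (forall x, derivable f x 1) -> continuous f.
  by move=> df x; apply: derivable_cont.
rewrite !z1 ?ltxx ?andbF//= !mul0r subr0 sub0r => H.
rewrite /ip (@Rintegral_itv _ a b); last by move=> r H'; rewrite bz2// mulr0.
rewrite [X in _ + X](@Rintegral_itv _ a b); last by move=> r H'; rewrite bz1// mul0r.
have wc f : continuous f -> {within `[a, b], continuous f}.
  by move=> cf; apply: continuous_subspaceT.
rewrite (H (wc _ c1) (LR _ (cd _ d1) d1) _ (wc _ c2) (LR _ (cd _ d2) d2) _) => [||].
- by rewrite addrN.
- by [].
- by [].
Qed.

(** Adapted to [N2D]: squared norms obey the triangle inequality up to a factor 2, so each of two
    errors may reach [e / 4]. *)
Lemma lt_quarters (x y z e : R) : z <= 2 * x + 2 * y -> x < e / 4 -> y < e / 4 -> z < e.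
Proof. lra. Qed.

Definition N2 u v := ip u u + ip v v.

(** H^1_0 as a closure, with one approximant for each tolerance rather than a sequence; the weak
    derivative [v] is carried along explicitly. *)
Definition h10 u v := [/\ l2 u, l2 v & forall e : R, 0 < e ->
  exists2 phi, test phi &
    N2 (fun r => u r - phi r) (fun r => v r - derive1 phi r) < e].

Lemma eq_N2 u v u' v' : u =1 u' -> v =1 v' -> N2 u v = N2 u' v'.
Proof. by move=> h1 h2; congr (_ + _); exact: eq_ip. Qed.

Lemma N2_ge0 u v : 0 <= N2 u v.
Proof. by rewrite addr_ge0 ?ip_ge0. Qed.

Lemma N2D u v u' v' : l2 u -> l2 v -> l2 u' -> l2 v' ->
  N2 (fun r => u r + u' r) (fun r => v r + v' r) <= 2 * N2 u v + 2 * N2 u' v'.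
Proof.
move=> lu lv lu' lv'; have := ip_normD_le lu lu'; have := ip_normD_le lv lv'.
rewrite /N2; lra.
Qed.

Lemma N2Z c u v : l2 u -> l2 v ->
  N2 (fun r => c * u r) (fun r => c * v r) = c ^+ 2 * N2 u v.
Proof.
move=> lu lv; have lcu := l2Z c lu; have lcv := l2Z c lv.
by rewrite /N2 !ipZl// !ipZr//; ring.
Qed.

Lemma test_h10 phi : test phi -> h10 phi (derive1 phi).
Proof.
move=> tp; split; [exact: test_l2|exact/test_l2/test_derive|move=> e e0].
exists phi => //; rewrite /N2 (@eq_ip _ _ (fun=> 0) _ (fun=> 0)); [|by move=> r; rewrite subrr..].
by rewrite [X in _ + X](@eq_ip _ _ (fun=> 0) _ (fun=> 0)) ?ip0l ?addr0//; move=> r; rewrite subrr.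
Qed.

Lemma h10_closed u v : l2 u -> l2 v ->
  (forall e : R, 0 < e -> exists u' v', h10 u' v' /\
    N2 (fun r => u r - u' r) (fun r => v r - v' r) < e) -> h10 u v.
Proof.
move=> lu lv H; split=> // e e0.
have e4 : 0 < e / 4 by lra.
have [u' [v' [[lu' lv' /(_ _ e4)[phi tp h1]] h2]]] := H _ e4.
exists phi => //.
have lp := test_l2 tp; have lp' := test_l2 (test_derive tp).
have := N2D (l2B lu lu') (l2B lv lv') (l2B lu' lp) (l2B lv' lp').
rewrite (_ : (fun r => u r - u' r + (u' r - phi r)) = (fun r => u r - phi r)); last first.
  by apply/funext => r; ring.
rewrite (_ : (fun r => v r - v' r + (v' r - derive1 phi r)) = (fun r => v r - derive1 phi r)); last first.
  by apply/funext => r; ring.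
by move=> H3; exact: (lt_quarters H3 h2 h1).
Qed.

Lemma derive1D phi psi : test phi -> test psi ->
  derive1 (fun r => phi r + psi r) = (fun r => derive1 phi r + derive1 psi r).
Proof.
move=> tp tq; apply/funext => r; rewrite !derive1E deriveD//; exact: test_derivable.
Qed.

Lemma h10D u v u' v' : h10 u v -> h10 u' v' ->
  h10 (fun r => u r + u' r) (fun r => v r + v' r).
Proof.
move=> [lu lv Huv] [lu' lv' Huv']; split; [exact: l2D..|move=> e e0].
have e4 : 0 < e / 4 by lra.
have [phi tp h1] := Huv _ e4; have [psi tq h2] := Huv' _ e4.
exists (fun r => phi r + psi r); first exact: testD.
have lp := test_l2 tp; have lp' := test_l2 (test_derive tp).
have lq := test_l2 tq; have lq' := test_l2 (test_derive tq).
have := N2D (l2B lu lp) (l2B lv lp') (l2B lu' lq) (l2B lv' lq').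
rewrite derive1D//.
rewrite (_ : (fun r => u r - phi r + (u' r - psi r)) = (fun r => u r + u' r - (phi r + psi r))); last first.
  by apply/funext => r; ring.
rewrite (_ : (fun r => v r - derive1 phi r + (v' r - derive1 psi r))
  = (fun r => v r + v' r - (derive1 phi r + derive1 psi r))); last first.
  by apply/funext => r; ring.
by move=> H3; exact: (lt_quarters H3 h1 h2).
Qed.

Lemma l2_derivM rho rho' u v : bdmul rho -> bdmul rho' -> l2 u -> l2 v ->
  l2 (fun r => rho' r * u r + rho r * v r).
Proof. by move=> br br' lu lv; apply: l2D; exact: l2M. Qed.

Lemma ipM_le rho : bdmul rho -> exists2 C, 0 < C & forall f, l2 f ->
  ip (fun r => rho r * f r) (fun r => rho r * f r) <= C * ip f f.
Proof.
move=> brho; have [_ [C HC]] := brho; exists (C ^+ 2 + 1).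
  by rewrite ltr_wpDl ?sqr_ge0.
move=> f lf; rewrite -ipZl//; apply: ip_le => //; [exact: l2M..|exact: l2Z|] => r r1.
rewrite mulrACA -!expr2 [leRHS](_ : _ = (C ^+ 2 + 1) * f r ^+ 2); last by ring.
apply: ler_wpM2r; rewrite ?sqr_ge0//.
apply: ler_wpDr => //.
by rewrite -[leLHS]real_normK ?num_real// lerXn2r ?nnegrE// ?HC// (le_trans _ (HC r r1)).
Qed.

Lemma h10M rho rho' u v : rsm rho -> bdmul rho -> bdmul rho' ->
  (forall r : R, 1 < r -> is_derive r 1 rho (rho' r)) -> h10 u v ->
  h10 (fun r => rho r * u r) (fun r => rho' r * u r + rho r * v r).
Proof.
move=> rr br br' Dr [lu lv Huv].
have [C C0 HC] := ipM_le br; have [C' C'0 HC'] := ipM_le br'.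
apply: h10_closed; [exact: l2M|exact: l2_derivM|move=> e e0].
have K0 : 0 < 2 * C + 2 * C' by lra.
have [phi tp Hphi] := Huv _ (divr_gt0 e0 K0).
have lp := test_l2 tp; have lp' := test_l2 (test_derive tp).
have tM := testM rr tp.
exists (fun r => rho r * phi r), (derive1 (fun r => rho r * phi r)); split.
  exact: test_h10.
(* Where [r <= 1] nothing is known about [rho'], but both sides vanish there, the product being a
   test function supported in [r > 1]. *)
have E r : derive1 (fun r => rho r * phi r) r = rho' r * phi r + rho r * derive1 phi r.
  have [r1|r1] := leP r 1; last first.
    rewrite derive1E.
    have Dp : is_derive r 1 phi (derive1 phi r).
      by rewrite derive1E; apply: DeriveDef => //; exact: test_derivable.
    have [_ ->] := is_deriveM (Dr r r1) Dp.
    by rewrite addrC [X in _ = X + _]mulrC.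
  have [_ -> //] := test_l2 (test_derive tM).
  have [_ -> //] := lp; have [_ -> //] := lp'.
  by rewrite !mulr0 addr0.
rewrite (eq_N2 (u' := fun r => rho r * (u r - phi r)) (v' := fun r =>
  rho' r * (u r - phi r) + rho r * (v r - derive1 phi r))); last 2 first.
- by move=> r; ring.
- by move=> r; rewrite E; ring.
have d1 := l2B lu lp; have d2 := l2B lv lp'.
have := ip_normD_le (l2M br' d1) (l2M br d2).
have := HC _ d1; have := HC _ d2; have := HC' _ d1.
have := ip_ge0 (fun r => u r - phi r); have := ip_ge0 (fun r => v r - derive1 phi r).
move: Hphi; rewrite ltr_pdivlMr// /N2.
set a := ip _ _; set b := ip _ _ ; set c := ip _ _; set d := ip _ _; set k := ip _ _.
move=> H b0 a0 h1 h2 h3 h4; apply: le_lt_trans H.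
nra.
Qed.

Lemma h10_ibp u v g dg : h10 u v -> h10 g dg -> ip v g + ip u dg = 0.
Proof.
move=> [lu lv Huv] [lg ldg Hg].
(* One argument is approximated at a time. By Cauchy-Schwarz the square of the defect [x] is at most
   [2 * ip c c + 2 * ip d d] times the squared H^1 error, which can be made smaller than what a
   nonzero [x] allows. *)
have step a b : l2 a -> l2 b ->
    (forall e : R, 0 < e -> exists2 phi, test phi &
      N2 (fun r => a r - phi r) (fun r => b r - derive1 phi r) < e) ->
    forall c d, l2 c -> l2 d ->
    (forall phi, test phi -> ip (derive1 phi) c + ip phi d = 0) ->
    ip b c + ip a d = 0.
  move=> la lb Hab c d lc ld H; apply/eqP/negPn/negP => nz.
  set x := ip b c + ip a d in nz.
  have x2 : 0 < x ^+ 2 by rewrite lt_neqAle sqr_ge0 eq_sym sqrf_eq0 nz.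
  have K0 : 0 < 2 * ip c c + 2 * ip d d + 1.
    by have := ip_ge0 c; have := ip_ge0 d; lra.
  have [phi tp] := Hab _ (divr_gt0 x2 K0); rewrite ltr_pdivlMr// /N2.
  have lp := test_l2 tp; have lp' := test_l2 (test_derive tp).
  have d1 := l2B la lp; have d2 := l2B lb lp'.
  have E : x = ip (fun r => b r - derive1 phi r) c + ip (fun r => a r - phi r) d.
    by rewrite !ipBl//; have := H _ tp; rewrite /x; lra.
  have := ip_cauchy d1 ld; have := ip_cauchy d2 lc; rewrite E.
  have := ip_ge0 c; have := ip_ge0 d; have := ip_ge0 (fun r => a r - phi r).
  have := ip_ge0 (fun r => b r - derive1 phi r).
  set p := ip _ _; set q := ip _ _; set s := ip _ _; set t := ip _ _; set y := ip _ _.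
  set z := ip _ _; move=> p0 q0 s0 t0 h1 h2; apply/negP; rewrite -leNgt.
  have := sqr_ge0 (y - z); nra.
apply: (step) => // phi tp.
rewrite addrC ![ip _ dg]ipC ![ip _ g]ipC.
apply: (step) => //; [exact: test_l2|exact/test_l2/test_derive|] => psi tq.
by rewrite ![ip _ phi]ipC addrC ![ip _ (derive1 phi)]ipC test_ibp.
Qed.

End SobolevSpace.

(** * Averages in time *)

Section TimeAverages.
Context {R : realType}.
Notation mu := (@lebesgue_measure R).
Implicit Types (f g h F : R -> R -> R) (kap : R -> R).

Definition jmeas F := measurable_fun [set: R * R] (fun z => F z.1 z.2).

Definition jint F := (mu \x mu)%E.-integrable [set: R * R] (fun z => (F z.1 z.2)%:E).

Lemma jint_meas F : jint F -> jmeas F.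
Proof. by move=> /integrableP[/measurable_EFinP]. Qed.

Lemma le_jint F G : jmeas F -> (forall s r, `|F s r| <= G s r) -> jint G -> jint F.
Proof.
move=> mF FG; apply: le_integrable => //; first exact/measurable_EFinP.
by move=> [s r] _ /=; rewrite lee_fin (le_trans (FG s r)) ?ler_norm.
Qed.

Lemma jintD F G : jint F -> jint G -> jint (fun s r => F s r + G s r).
Proof. by move=> jF jG; exact: (integrableD measurableT jF jG). Qed.

Lemma jintZ c F : jint F -> jint (fun s r => c * F s r).
Proof. by move=> jF; exact: (integrableZl measurableT c jF). Qed.

Lemma aeS (P Q : R -> Prop) : (forall x, P x -> Q x) ->
  {ae mu, forall x, P x} -> {ae mu, forall x, Q x}.
Proof. by move=> PQ; exact: (@filterS _ _ (ae_filter_ringOfSetsType mu)). Qed.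

Lemma aeI (P Q : R -> Prop) : {ae mu, forall x, P x} -> {ae mu, forall x, Q x} ->
  {ae mu, forall x, P x /\ Q x}.
Proof. exact: (@filterI _ _ (ae_filter_ringOfSetsType mu)). Qed.

Lemma ae_intR (F G : R -> R) : measurable_fun setT G -> {ae mu, forall x, F x = G x} ->
  intR F -> intR G /\ \int[mu]_x F x = \int[mu]_x G x.
Proof.
move=> mG FG IF; have mF := intR_meas IF.
have mF' : measurable_fun setT (EFin \o F) by exact/measurable_EFinP.
have mG' : measurable_fun setT (EFin \o G) by exact/measurable_EFinP.
split; last first.
  rewrite /Rintegral; congr fine; apply: ae_eq_integral => //.
  by apply: aeS FG => x -> _.
apply/integrableP; split=> //; case/integrableP : IF => _; apply: le_lt_trans.
rewrite le_eqVlt; apply/orP; left; apply/eqP; apply: ae_eq_integral => //.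
- exact: measurableT_comp.
- exact: measurableT_comp.
- by apply: aeS FG => x /= -> _.
Qed.

Lemma intR_Rint (g : R -> R) : intR g -> (\int[mu]_x (g x)%:E = (\int[mu]_x g x)%:E)%E.
Proof. by move=> Ig; rewrite /Rintegral fineK// integrable_fin_num. Qed.

Lemma intR_fine (G : R -> \bar R) : mu.-integrable setT G ->
  intR (fun x => fine (G x)) /\ (\int[mu]_x (fine (G x))%:E = \int[mu]_x G x)%E.
Proof.
move=> iG; have mG : measurable_fun setT G by case/integrableP : iG.
have mf : measurable_fun setT (fun x => fine (G x)).
  by apply: measurableT_comp => //; exact: fine_measurable.
split.
  apply: le_integrable iG => //; first exact/measurable_EFinP.
  by move=> x _ /=; case: (G x) => [y| |] //=; rewrite ?normr0 ?leey.
apply: ae_eq_integral => //; first exact/measurable_EFinP.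
have := integrable_ae measurableT iG; apply: aeS => x /(_ I) fx _.
by rewrite fineK.
Qed.

Lemma jint_swap F : jint F -> jint (fun r s => F s r).
Proof.
move=> jF; have mF := jint_meas jF.
have mF1 : measurable_fun [set: R * R] (fun z => (F z.1 z.2)%:E).
  exact/measurable_EFinP.
have mF2 : measurable_fun [set: R * R] (fun z => (F z.2 z.1)%:E).
  by apply/measurable_EFinP; exact: (measurableT_comp mF (@measurable_swap _ _ R R)).
exact: ((@integrable12ltyP _ _ _ _ _ mu mu _ mF2).2 ((@integrable21ltyP _ _ _ _ _ mu mu _ mF1).1 jF)).
Qed.

Lemma fubiniR F : jint F ->
  [/\ intR (fun s => \int[mu]_r F s r), intR (fun r => \int[mu]_s F s r) &
    \int[mu]_s \int[mu]_r F s r = \int[mu]_r \int[mu]_s F s r].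
Proof.
move=> jF.
have [i1 e1] := intR_fine (integrable_fubini_F jF).
have [i2 e2] := intR_fine (integrable_fubini_F (jint_swap jF)).
split; [exact: i1|exact: i2|].
by rewrite /Rintegral e1 e2 /fubini_F; congr fine; have := Fubini jF.
Qed.

Lemma jmeas_sec F r : jmeas F -> measurable_fun setT (F ^~ r).
Proof. by move=> mF; exact: (measurableT_comp mF (pair2_measurable r)). Qed.

Lemma jmeas_sec1 F s : jmeas F -> measurable_fun setT (F s).
Proof. by move=> mF; exact: (measurableT_comp mF (pair1_measurable s)). Qed.

(** Tonelli is applied to the positive and the negative part separately, so measurability covers
    also the [r] at which the section is not integrable. *)
Lemma jmeas_int F : jmeas F -> measurable_fun setT (fun r => \int[mu]_s F s r).
Proof.
move=> mF.
have mF' : measurable_fun [set: R * R] (fun z => (F z.1 z.2)%:E).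
  exact/measurable_EFinP.
suff mG : measurable_fun setT (fun r => (\int[mu]_s (F s r)%:E)%E).
  exact: (measurableT_comp (fine_measurable measurableT) mG).
rewrite (_ : (fun r => _) = (fun r => (\int[mu]_s (fun z => (F z.1 z.2)%:E)^\+ (s, r))
   - (\int[mu]_s (fun z => (F z.1 z.2)%:E)^\- (s, r)))%E); last first.
  apply/funext => r; rewrite integralE.
  by congr (_ - _)%E; apply: eq_integral => s _; rewrite ?funeposE ?funenegE.
apply: emeasurable_funB.
  have mfp : measurable_fun [set: R * R] ((fun z => (F z.1 z.2)%:E)^\+)%E by exact: measurable_funepos.
  have H := @measurable_fun_fubini_tonelli_G _ _ _ _ R mu _ mfp (funepos_ge0 _).
  exact: H.
have mfp : measurable_fun [set: R * R] ((fun z => (F z.1 z.2)%:E)^\-)%E by exact: measurable_funeneg.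
  have H := @measurable_fun_fubini_tonelli_G _ _ _ _ R mu _ mfp (funeneg_ge0 _).
  exact: H.
Qed.

Lemma jint_ae F : jint F -> {ae mu, forall r, intR (fun s => F s r)}.
Proof. exact: ae_integrable2. Qed.

Lemma jint_ae1 F : jint F -> {ae mu, forall s, intR (F s)}.
Proof. exact: ae_integrable1. Qed.

Definition jl2 (T : R) f := [/\ jmeas f, (forall s r, ~~ (0 < s < T) -> f s r = 0),
  (forall s r, r <= 1 -> f s r = 0) & jint (fun s r => f s r ^+ 2)].

Definition bker kap := measurable_fun setT kap /\ exists M, forall s, `|kap s| <= M.

(** The average in time is computed at each [r] separately; [Av_ip] shows, by Fubini, that it acts
    on L^2 as the integral of an L^2-valued function. *)
Definition Av kap f (r : R) := \int[mu]_s (kap s * f s r).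

(** A majorant in [r] for all averages with kernels bounded by 1, whatever the kernel; it serves as
    the dominating function when averages are differentiated in time. *)
Definition Nf f := Av (fun=> 1) (fun s r => `|f s r|).

Variable T : R.
Hypothesis T0 : 0 < T.

Definition chiT : R -> R := \1_(`]0, T[%classic).

Lemma chiT_int : intR chiT.
Proof. exact: integrable_indic_itv. Qed.

Lemma chiTE s : chiT s = (0 < s < T)%R%:R.
Proof. by rewrite /chiT indicE mem_setE in_itv. Qed.

Lemma chiT01 s : chiT s = 0 \/ chiT s = 1.
Proof. by rewrite chiTE; case: (_ < _ < _); [right|left]. Qed.

Lemma chiT_ge0 s : 0 <= chiT s.
Proof. by rewrite chiTE. Qed.

Lemma chiT2 s : chiT s ^+ 2 = chiT s.
Proof. by have [->|->] := chiT01 s; rewrite ?expr0n ?expr1n. Qed.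

Lemma chiT_mul f s r : jl2 T f -> chiT s * f s r = f s r.
Proof.
move=> [_ f0 _ _]; rewrite chiTE; case: (boolP (0 < s < T)) => [_|/f0 ->].
  by rewrite mul1r.
by rewrite mulr0.
Qed.

Lemma Rint_chiT : \int[mu]_s chiT s = T.
Proof.
rewrite /Rintegral /chiT integral_indic//= setIT.
by rewrite lebesgue_measure_itv/= lte_fin T0 sube0.
Qed.

Lemma jl2_norm f : jl2 T f -> jl2 T (fun s r => `|f s r|).
Proof.
move=> [mf f0 f1 If]; split.
- exact: measurableT_comp.
- by move=> s r H; rewrite f0// normr0.
- by move=> s r H; rewrite f1// normr0.
- rewrite (_ : (fun _ _ => _) = (fun s r => f s r ^+ 2))//.
  by apply/funext => s; apply/funext => r; rewrite real_normK// num_real.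
Qed.

(** On the bounded interval (0, T) one has [|f| <= f^2 + 1], and [chiT] is this integrable 1. *)
Lemma jl2_int_sec kap f r : jl2 T f -> bker kap -> intR (fun s => f s r ^+ 2) ->
  intR (fun s => kap s * f s r).
Proof.
move=> jf [mk [M kM]] If; have [mf _ _ _] := jf.
apply: (@le_intR _ _ (fun s => M * (f s r ^+ 2 + chiT s))).
- by apply: measurable_funM => //; exact: jmeas_sec.
- move=> s; rewrite normrM ler_pM// -(chiT_mul s r jf) normrM exprMn chiT2.
  rewrite [`|chiT s|]ger0_norm ?chiT_ge0//.
  have [->|->] := chiT01 s; first by rewrite !mul0r addr0.
  rewrite !mul1r -(real_normK (num_real (f s r))).
  have := sqr_ge0 (`|f s r| - 1); have := normr_ge0 (f s r); nra.
- by apply: intRZ; apply: intRD => //; exact: chiT_int.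
Qed.

Lemma bker1 : bker (fun=> 1).
Proof. by split=> //; exists 1 => s; rewrite normr1. Qed.

(** Cauchy-Schwarz in time between [|f|] and [chiT]: the nonnegative quadratic given to [discr_le]
    is the integral of [(|f| + l chiT)^2]. *)
Lemma Nf_sq f r : jl2 T f -> intR (fun s => f s r ^+ 2) ->
  Nf f r ^+ 2 <= T * \int[mu]_s (f s r ^+ 2).
Proof.
move=> jf If; have jn := jl2_norm jf.
have If' : intR (fun s => `|f s r| ^+ 2).
  by apply: eq_intR If => s; rewrite real_normK// num_real.
have IN := jl2_int_sec jn bker1 If'.
apply: discr_le; [exact: ltW|by apply: Rintegral_ge0 => s _; exact: sqr_ge0|] => l.
suff -> : \int[mu]_s (f s r ^+ 2) + 2 * l * Nf f r + l ^+ 2 * T =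
   \int[mu]_s (f s r ^+ 2 + 2 * l * (1 * `|f s r|) + l ^+ 2 * chiT s).
  apply: Rintegral_ge0 => s _; rewrite -(chiT_mul s r jf) normrM.
  rewrite [`|chiT s|]ger0_norm ?chiT_ge0//.
  have [->|->] := chiT01 s; first by rewrite !mul0r !mulr0 expr0n !addr0.
  rewrite !mul1r mulr1 -(real_normK (num_real (f s r))).
  by have := sqr_ge0 (`|f s r| + l); nra.
have I2 := intRZ (2 * l) IN; have I3 := intRZ (l ^+ 2) chiT_int.
rewrite RintegralD//; last exact: intRD.
rewrite RintegralD// RintegralZl// RintegralZl//; last exact: chiT_int.
by rewrite Rint_chiT.
Qed.

Lemma Av_le_Nf kap M f r : jl2 T f -> measurable_fun setT kap ->
  (forall s, `|kap s| <= M) -> intR (fun s => f s r ^+ 2) ->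
  `|Av kap f r| <= M * Nf f r.
Proof.
move=> jf mk kM If; have bk : bker kap by split=> //; exists M.
have jn := jl2_norm jf.
have If' : intR (fun s => `|f s r| ^+ 2).
  by apply: eq_intR If => s; rewrite real_normK// num_real.
have IN := jl2_int_sec jn bker1 If'.
have IA := jl2_int_sec jf bk If.
apply: le_trans (le_normr_Rintegral measurableT IA) _.
rewrite /Nf /Av -RintegralZl//; apply: le_Rintegral => //.
- exact: integrable_norm.
- exact: intRZ.
- by move=> s _; rewrite normrM mul1r ler_wpM2r.
Qed.

Lemma Av_meas kap f : jl2 T f -> bker kap -> measurable_fun setT (Av kap f).
Proof.
move=> [mf _ _ _] [mk _]; apply: (@jmeas_int (fun s r => kap s * f s r)).
by apply: measurable_funM => //; exact: measurableT_comp.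
Qed.

Lemma Av_l2 kap f : jl2 T f -> bker kap -> l2 (Av kap f).
Proof.
move=> jf bk; have [mf f0 f1 If] := jf; have [mk [M kM]] := bk.
split; first exact: Av_meas.
  move=> r r1; rewrite /Av (_ : (fun _ => _) = cst 0) ?Rintegral_cst ?mul0r//.
  by apply/funext => s; rewrite f1// mulr0.
have [_ I2 _] := fubiniR If.
have I3 := intRZ (M ^+ 2 * T) I2.
apply/integrableP; split.
  by apply/measurable_EFinP; apply: measurable_funX; exact: Av_meas.
case/integrableP : I3 => mI3; apply: le_lt_trans.
apply: ae_ge0_le_integral => //.
- apply: measurableT_comp => //.
  by apply/measurable_EFinP; apply: measurable_funX; exact: Av_meas.
- exact: measurableT_comp.
have := jint_ae If; apply: aeS => r Ir _ /=.
rewrite lee_fin normrX (le_trans _ (ler_norm _))//.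
have := Av_le_Nf jf mk kM Ir; have := Nf_sq jf Ir.
set a := `|_|; set n := Nf f r; set c := \int[mu]_s _ => h1 h2.
have a0 : 0 <= a by exact: normr_ge0.
rewrite -mulrA; apply: le_trans (ler_wpM2l (sqr_ge0 M) h1).
by rewrite -exprMn lerXn2r ?nnegrE// (le_trans a0).
Qed.

Lemma Nf_l2 f : jl2 T f -> l2 (Nf f).
Proof. by move=> jf; apply: Av_l2; [exact: jl2_norm|exact: bker1]. Qed.

Lemma jint_mul kap f (g : R -> R) : jl2 T f -> bker kap -> l2 g ->
  jint (fun s r => kap s * f s r * g r).
Proof.
move=> jf [mk [M kM]] [mg g0 Ig]; have [mf f0 f1 If] := jf.
have Ic : jint (fun s r => chiT s * g r ^+ 2).
  have mc : measurable_fun [set: R * R] (fun z => (chiT z.1 * g z.2 ^+ 2)%:E).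
    apply/measurable_EFinP; apply: measurable_funM.
      by apply: measurableT_comp => //; exact: intR_meas chiT_int.
    by apply: measurable_funX; exact: measurableT_comp.
  apply: (@integrable12ltyP _ _ _ _ _ mu mu _ mc).2 => /=.
  under eq_integral => s _.
    under eq_integral => r _.
      rewrite ger0_norm; last by rewrite mulr_ge0 ?chiT_ge0 ?sqr_ge0.
      over.
    rewrite (intR_Rint (intRZ (chiT s) Ig)) RintegralZl// mulrC.
    over.
  exact/integrable_lty/(intRZ _ chiT_int).
apply: (@le_jint _ (fun s r => M * (f s r ^+ 2 + chiT s * g r ^+ 2))).
- apply: measurable_funM; last exact: measurableT_comp.
  by apply: measurable_funM => //; exact: measurableT_comp.
- move=> s r; rewrite -mulrA normrM ler_pM// -(chiT_mul s r jf) -mulrA normrM exprMn chiT2.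
  rewrite [`|chiT s|]ger0_norm ?chiT_ge0//.
  have [->|->] := chiT01 s; first by rewrite !mul0r addr0.
  rewrite !mul1r normrM -(real_normK (num_real (f s r))) -(real_normK (num_real (g r))).
  have := sqr_ge0 (`|f s r| - `|g r|); have := normr_ge0 (f s r); have := normr_ge0 (g r).
  nra.
- by apply: jintZ; exact: jintD.
Qed.

Lemma Av_ip kap f (g : R -> R) : jl2 T f -> bker kap -> l2 g ->
  intR (fun s => kap s * ip (f s) g) /\
  ip (Av kap f) g = \int[mu]_s (kap s * ip (f s) g).
Proof.
move=> jf bk lg; have J := jint_mul jf bk lg; have J1 := jint_mul jf bker1 lg.
have [mf f0 f1 If] := jf; have [mk [M kM]] := bk.
have [I1 I2 E] := fubiniR J; have [I1' _ _] := fubiniR J1.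
have mip : measurable_fun setT (fun s => ip (f s) g).
  apply: eq_measurable_fun (intR_meas I1') => s _.
  by apply: eq_Rintegral => r _; rewrite mul1r.
have mkip : measurable_fun setT (fun s => kap s * ip (f s) g) by exact: measurable_funM.
have mAg : measurable_fun setT (fun r => Av kap f r * g r).
  by apply: measurable_funM; [exact: Av_meas|exact: l2_meas].
have [] := ae_intR mkip _ I1.
  have := jint_ae1 J1; apply: aeS => s Is.
  rewrite /ip -RintegralZl//; last first.
    by apply: eq_intR Is => r; rewrite mul1r.
  by apply: eq_Rintegral => r _; rewrite mulrA.
move=> Ik Ek; split=> //; rewrite -Ek E.
have [|_ E2] := ae_intR mAg _ I2; last by rewrite /ip E2.
have := jint_ae If; apply: aeS => r Ir.
by rewrite /Av -RintegralZr//; exact: jl2_int_sec.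
Qed.

End TimeAverages.

(** * H^1_0 is stable under averages in time *)

Section AverageInSobolev.
Context {R : realType}.
Notation mu := (@lebesgue_measure R).
Variable T : R.
Hypothesis T0 : 0 < T.

Definition Q2 (u v a b : R -> R) := ip u a + ip v b.

Lemma h10_0 : h10 (fun=> 0 : R) (fun=> 0 : R).
Proof.
split; [exact: l2_0..|move=> e e0].
have t0 : test (fun=> 0 : R).
  split; last by exists 2, 2; split=> //; lra.
  apply: (@rsm_smooth_supp _ _ 2) => //; [lra|exact: rsm_cst].
exists (fun=> 0) => //; rewrite (eq_N2 (u' := fun=> 0) (v' := fun=> 0)).
- by rewrite /N2 ip0l addr0.
- by move=> r; rewrite subr0.
- by move=> r; rewrite derive1E derive_cst subr0.
Qed.

Lemma h10Z c (u v : R -> R) : h10 u v -> h10 (fun r => c * u r) (fun r => c * v r).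
Proof.
move=> huv; rewrite (_ : (fun r => c * v r) = (fun r => 0 * u r + c * v r)).
  apply: (@h10M _ (fun=> c) (fun=> 0)) => //.
  - exact: rsm_cst.
  - exact: bdmul_cst.
  - exact: bdmul_cst.
by apply/funext => r; rewrite mul0r add0r.
Qed.

Lemma l2_h10 (u v : R -> R) : h10 u v -> l2 u /\ l2 v. Proof. by case. Qed.

Lemma N2_expand (u v a b : R -> R) l : l2 u -> l2 v -> l2 a -> l2 b ->
  N2 (fun r => u r + l * a r) (fun r => v r + l * b r) =
  N2 u v + 2 * l * Q2 u v a b + l ^+ 2 * N2 a b.
Proof. by move=> lu lv la lb; rewrite /N2 /Q2 !ip_expand//; ring. Qed.

(** A near minimiser is compared with its perturbations by [eta] in both directions. The tolerance
    [eta^2] matches the step [eta], so the first variation [Q] is of order [eta]. *)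
Lemma near_min_bound (n d Q N eta : R) : 0 < eta -> n < d + eta ^+ 2 ->
  d <= n + 2 * eta * Q + eta ^+ 2 * N -> d <= n + 2 * (- eta) * Q + (- eta) ^+ 2 * N ->
  `|Q| <= eta * (1 + N).
Proof. by move=> e0 h1 h2 h3; rewrite ler_norml; apply/andP; split; nra. Qed.

Lemma min_le0 (d K : R) : 0 < K -> (forall eta : R, 0 < eta -> eta <= 1 -> d <= eta * K) ->
  d <= 0.
Proof.
move=> K0 H; rewrite leNgt; apply/negP => d0.
have h : 0 < Num.min 1 (d / (2 * K)) by rewrite lt_min ltr01 divr_gt0// mulr_gt0.
have := H _ h; rewrite ge_min lexx => /(_ isT).
have : Num.min 1 (d / (2 * K)) <= d / (2 * K) by rewrite ge_min lexx orbT.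
move=> /(ler_wpM2r (ltW K0)); have -> : d / (2 * K) * K = d / 2 by field; lra.
lra.
Qed.

(* Almost projection of the average on the closed subspace h10: a near minimiser of
   the distance has an error almost orthogonal to h10, hence to the average. *)
Lemma h10_Av kap (f df : R -> R -> R) : jl2 T f -> jl2 T df -> bker kap ->
  {ae mu, forall s, h10 (f s) (df s)} -> h10 (Av kap f) (Av kap df).
Proof.
move=> jf jdf bk Hae; have [mk [M kM]] := bk.
have lu := Av_l2 T0 jf bk; have lv := Av_l2 T0 jdf bk.
set u := Av kap f in lu *; set v := Av kap df in lv *.
pose S := [set x | exists g dg, h10 g dg /\
  x = N2 (fun r => u r - g r) (fun r => v r - dg r)].
have S0 : S (N2 u v).
  exists (fun=> 0), (fun=> 0); split; first exact: h10_0.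
  by apply: eq_N2 => r; rewrite subr0.
have lbS : lbound S 0 by move=> _ [g [dg [_ ->]]]; exact: N2_ge0.
have hS : has_inf S by split; [exists (N2 u v)|exists 0].
set d := inf S.
have dS x : S x -> d <= x by move=> Sx; apply: ge_inf => //; exists 0.
have [_ f0 _ /fubiniR[I1 _ _]] := jf; have [_ df0 _ /fubiniR[I2 _ _]] := jdf.
have IN : intR (fun s => chiT T s + N2 (f s) (df s)).
  apply: intRD; first exact: chiT_int.
  apply: eq_intR (intRD I1 I2) => s.
  by congr (_ + _); apply: eq_Rintegral => r _; rewrite expr2.
have M0 : 0 <= M by exact: le_trans (kM 0).
(* The second part bounds [1 + N2 g dg] for the near minimiser [(g, dg)] chosen below: its error has
   [N2] less than [d + 1], and [d <= N2 u v], so [N2 g dg <= 4 * N2 u v + 2]. *)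
pose K := M * \int[mu]_s (chiT T s + N2 (f s) (df s)) + (3 + 4 * N2 u v).
have K0 : 0 < K.
  rewrite ltr_wpDl//.
    apply: mulr_ge0 => //; apply: Rintegral_ge0 => s _.
    by apply: addr_ge0; [exact: chiT_ge0|exact: N2_ge0].
  by have := N2_ge0 u v; lra.
suff dle : d <= 0.
  apply: h10_closed => // e e0.
  have [x [g [dg [hg ->]]] xe] := inf_adherent e0 hS.
  by exists g, dg; split=> //; apply: (lt_le_trans xe); rewrite -/d gerDr.
apply: min_le0 K0 _ => eta eta0 eta1.
have [_ [g [dg [hg ->]]] xe] := inf_adherent (exprn_gt0 2 eta0) hS.
rewrite -/d in xe; have [lg ldg] := l2_h10 hg.
set e := fun r => u r - g r in xe; set de := fun r => v r - dg r in xe.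
have le : l2 e by exact: l2B.
have lde : l2 de by exact: l2B.
(* Since h10 is a linear space, moving the near minimiser along [(a, b)] stays in it and cannot
   bring the distance below [d]. *)
have Qb a b : h10 a b -> `|Q2 e de a b| <= eta * (1 + N2 a b).
  move=> hab; have [la lb] := l2_h10 hab.
  have key l : d <= N2 e de + 2 * l * Q2 e de a b + l ^+ 2 * N2 a b.
    rewrite -N2_expand//; apply: dS.
    exists (fun r => g r + (- l) * a r), (fun r => dg r + (- l) * b r); split.
      by apply: h10D => //; exact: h10Z.
    by apply: eq_N2 => r; rewrite /e /de; ring.
  exact: near_min_bound xe (key _) (key _).
(* The error paired with the average is the average of its pairings with the slices, and almost
   every slice lies in h10. *)
have Quv : `|Q2 e de u v| <= eta * (M * \int[mu]_s (chiT T s + N2 (f s) (df s))).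
  have [J1 E1] := Av_ip jf bk le; have [J2 E2] := Av_ip jdf bk lde.
  rewrite /Q2 ipC [ip de v]ipC E1 E2 -RintegralD//.
  apply: le_trans (le_normr_Rintegral measurableT (intRD J1 J2)) _.
  rewrite mulrA -RintegralZl//.
  rewrite /Rintegral; apply: fine_le.
  - by rewrite integrable_fin_num//; exact/integrable_norm/intRD.
  - by rewrite integrable_fin_num//; exact: intRZ.
  apply: ae_ge0_le_integral => //.
  - by apply/measurable_EFinP; apply: measurableT_comp => //; exact: intR_meas (intRD J1 J2).
  - move=> s _; rewrite lee_fin !mulr_ge0 ?(ltW eta0)//.
    by apply: addr_ge0; [exact: chiT_ge0|exact: N2_ge0].
  - by apply/measurable_EFinP; exact: intR_meas (intRZ _ IN).
  apply: aeS Hae => s hs _; rewrite lee_fin -mulrDr normrM [eta * M]mulrC -mulrA.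
  apply: ler_pM => //.
  rewrite ![ip _ e]ipC ![ip _ de]ipC.
  (* The term 1 in the bound [Qb] is replaced by [chiT T s] to remain integrable over all times;
     outside (0, T) the slices vanish and the pairing is 0. *)
  have [sT|sT] := boolP (0 < s < T); first by rewrite chiTE sT; exact: Qb.
  rewrite chiTE (negbTE sT) add0r.
  have z1 : f s = (fun=> 0) by apply/funext => r; rewrite f0.
  have z2 : df s = (fun=> 0) by apply/funext => r; rewrite df0.
  rewrite z1 z2 ![ip _ (fun=> 0)]ipC !ip0l addr0 normr0.
  by rewrite mulr_ge0 ?(ltW eta0) ?N2_ge0.
have Qg := Qb _ _ hg.
have NE : N2 e de = Q2 e de u v - Q2 e de g dg.
  have x1 : ip e e = ip e u - ip e g by exact: ipBr.
  have x2 : ip de de = ip de v - ip de dg by exact: ipBr.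
  by rewrite /Q2 /N2 x1 x2; ring.
have Ng : N2 g dg <= 2 * N2 u v + 2 * N2 e de.
  have le' := l2N le; have lde' := l2N lde.
  have := N2D lu lv le' lde'.
  rewrite (eq_N2 (u' := g) (v' := dg)); last 2 first.
  - by move=> r; rewrite /e; ring.
  - by move=> r; rewrite /de; ring.
  congr (_ <= _ + 2 * _).
  rewrite (eq_N2 (u' := fun r => (-1) * e r) (v' := fun r => (-1) * de r)).
  - by rewrite N2Z// sqrrN expr1n mul1r.
  - by move=> r; rewrite mulN1r.
  - by move=> r; rewrite mulN1r.
have dN := dS _ S0; have dE : d <= N2 e de by apply: dS; exists g, dg.
move: Quv Qg; rewrite !ler_norml => /andP[_ q1] /andP[q2 _].
rewrite /K; move: NE q1 q2 Ng dN dE xe.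
set x1 := M * _; set x2 := N2 u v; set x3 := Q2 e de u v; set x4 := Q2 e de g dg.
set x5 := N2 e de; set x6 := N2 g dg.
move=> NE q1 q2 Ng dN dE xe.
have eta2 : eta ^+ 2 <= 1 by rewrite expr_le1// ltW.
nra.
Qed.

End AverageInSobolev.

(** * Time derivatives of weighted inner products *)

Section TimeDerivatives.
Context {R : realType}.
Notation mu := (@lebesgue_measure R).

(** Differentiation under the integral asks for its hypotheses at every point of the domain. The
    exceptional null set and [r <= 1] are therefore removed from the domain, which leaves the
    integrals of the functions concerned unchanged. *)
Lemma ae_good (P : R -> Prop) : {ae mu, forall r, P r} ->
  exists B : set R, [/\ measurable B, forall r, B r -> 1 < r /\ P r &
    forall F : R -> R, measurable_fun setT F -> (forall r, r <= 1 -> F r = 0) ->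
      mu.-integrable B (EFin \o F) -> intR F /\ \int[mu]_r F r = \int[mu]_(r in B) F r].
Proof.
move=> [N [mN N0 PN]]; exists (@halfline R `\` N); split.
- by apply: measurableD => //; exact: measurable_itv.
- move=> r [Hr Nr]; split; first by move: Hr; rewrite /halfline /= in_itv/= andbT.
  by apply: contrapT => nP; apply: Nr; exact: PN.
move=> F mF F0 iF; have mH : measurable (@halfline R) by exact: measurable_itv.
have mB : measurable (@halfline R `\` N) by exact: measurableD.
have iF' : intR (F \_ (@halfline R `\` N)).
  have := (@integrable_mkcond _ _ _ mu _ (EFin \o F) mB).1 iF.
  by rewrite restrict_EFin.
have [] := @ae_intR R _ F mF _ iF'; last first.
  by move=> I <-; split=> //; rewrite -Rintegral_mkcond.
exists N; split=> // r /= H; apply: contrapT => Nr; apply: H.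
rewrite patchE; case: ifPn => // /negP nB; rewrite F0// leNgt; apply/negP => r1.
apply: nB; rewrite inE; split=> //.
by rewrite /halfline /= in_itv/= andbT.
Qed.

Lemma is_derive_under (B : set R) (F F' : R -> R -> R) (G : R -> R) (a b t : R) :
  measurable B -> a < t < b ->
  (forall x, a < x < b -> mu.-integrable B (EFin \o F x)) ->
  (forall x y, a < x < b -> B y -> is_derive x 1 (F ^~ y) (F' x y)) ->
  (forall y, 0 <= G y) ->
  mu.-integrable B (EFin \o G) ->
  (forall x y, a < x < b -> B y -> `|F' x y| <= G y) ->
  is_derive t 1 (fun x => \int[mu]_(y in B) F x y) (\int[mu]_(y in B) F' t y).
Proof.
move=> mB tab iF dF G0 iG FG.
have It : `]a, b[%classic t by rewrite /= in_itv.
have h1 x : `]a, b[%classic x -> mu.-integrable B (EFin \o F x).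
  by rewrite /= in_itv => ?; exact: iF.
have h2 x y : `]a, b[%classic x -> B y -> derivable (F ^~ y) x 1.
  by rewrite /= in_itv => xab By; case: (dF _ _ xab By).
have d1 x y : `]a, b[%classic x -> B y -> partial1of2 F x y = F' x y.
  by rewrite /= in_itv => xab By; rewrite partial1of2E; case: (dF _ _ xab By).
have h3 x y : `]a, b[%classic x -> B y -> `|partial1of2 F x y| <= G y.
  by move=> xab By; rewrite d1//; apply: FG => //; move: xab; rewrite /= in_itv.
apply: DeriveDef.
  exact: (@derivable_under_integral R _ _ mu F B mB t a b It h1 h2 G G0 iG h3).
rewrite -derive1E (@differentiation_under_integral R _ _ mu F B mB t a b It h1 h2 G G0 iG h3).
by apply: eq_Rintegral => y; rewrite inE => By; exact: d1.
Qed.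

Lemma is_derive_ip (a b : R) (rho rho' f f' g g' : R -> R -> R) (Fb Gb : R -> R) (C t : R) :
  a < t < b ->
  (forall x, a < x < b -> [/\ l2 (f x), l2 (f' x), l2 (g x) & l2 (g' x)]) ->
  (forall x, a < x < b -> bdmul (rho x) /\ bdmul (rho' x)) ->
  (forall x r, a < x < b -> 1 < r -> `|rho x r| <= C /\ `|rho' x r| <= C) ->
  (forall x r, a < x < b -> 1 < r -> is_derive x 1 (rho ^~ r) (rho' x r)) ->
  l2 Fb -> l2 Gb ->
  {ae mu, forall r, forall x, a < x < b -> (`|f x r| <= Fb r /\ `|f' x r| <= Fb r) /\
     (`|g x r| <= Gb r /\ `|g' x r| <= Gb r)} ->
  {ae mu, forall r, forall x, a < x < b -> is_derive x 1 (f ^~ r) (f' x r) /\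
     is_derive x 1 (g ^~ r) (g' x r)} ->
  is_derive t 1 (fun x => ip (fun r => rho x r * f x r) (g x))
    (ip (fun r => rho' t r * f t r) (g t) + ip (fun r => rho t r * f' t r) (g t)
     + ip (fun r => rho t r * f t r) (g' t)).
Proof.
move=> tab lfg brho rC drho lF lG ae1 ae2.
have [B [mB HB iB]] := ae_good (aeI ae1 ae2).
pose F x r := rho x r * f x r * g x r.
pose F' x r := rho' x r * f x r * g x r + rho x r * f' x r * g x r + rho x r * f x r * g' x r.
have iF x : a < x < b -> intR (F x).
  move=> xab; have [lf _ lg _] := lfg _ xab; have [br _] := brho _ xab.
  by apply: l2_int => //; exact: l2M.
have iF' x : a < x < b -> intR (F' x).
  move=> xab; have [lf lf' lg lg'] := lfg _ xab; have [br br'] := brho _ xab.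
  by apply: intRD; [apply: intRD|]; apply: l2_int => //; exact: l2M.
have EF x : a < x < b -> ip (fun r => rho x r * f x r) (g x) = \int[mu]_(r in B) F x r.
  move=> xab; have [_ _ [_ z _] _] := lfg _ xab.
  have [] // := iB (F x) (intR_meas (iF _ xab)).
    by move=> r r1; rewrite /F z// mulr0.
  by apply: integrableS (iF _ xab).
have EF' : ip (fun r => rho' t r * f t r) (g t) + ip (fun r => rho t r * f' t r) (g t)
     + ip (fun r => rho t r * f t r) (g' t) = \int[mu]_(r in B) F' t r.
  have [lf lf' lg lg'] := lfg _ tab; have [br br'] := brho _ tab.
  rewrite -RintegralD//; [|by apply: l2_int => //; exact: l2M..].
  rewrite -RintegralD//; [|by apply: intRD; apply: l2_int => //; exact: l2M|by apply: l2_int => //; exact: l2M].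
  have [] // := iB (F' t) (intR_meas (iF' _ tab)).
    have [_ zg _] := lg; have [_ zg' _] := lg'.
    by move=> r r1; rewrite /F' zg// zg'// !mulr0 !addr0.
  by apply: integrableS (iF' _ tab).
rewrite EF'.
have C0 : 0 <= C by have [+ _] := rC t 2 tab (ltr1n _ 2); exact: le_trans.
apply: (@near_eq_is_derive _ _ _ (fun x => \int[mu]_(y in B) F x y)).
  have tI : t \in `]a, b[ by rewrite in_itv.
  have := near_in_itvoo tI; apply: filterS => x; rewrite in_itv => xab.
  by rewrite EF.
(* The product rule has three terms, each at most [C |Fb Gb|]. *)
apply: (@is_derive_under _ _ _ (fun r => 3 * C * `|Fb r * Gb r|) a b) => //.
- by move=> x xab; apply: integrableS (iF _ xab).
- move=> x y xab By; have [y1 [_ /(_ _ xab)[df dg]]] := HB _ By.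
  have dr := drho _ _ xab y1.
  have D1 := is_deriveM dr df; have D2 := is_deriveM D1 dg.
  apply: (is_derive_eq D2); rewrite /F' ?fctE /GRing.scale /=.
  ring.
- by move=> y; rewrite !mulr_ge0.
- have I1 : intR (fun r => 3 * C * `|Fb r * Gb r|).
    by apply: intRZ; apply: integrable_norm; exact: l2_int.
  by apply: integrableS I1.
- move=> x y xab By; have [y1 [/(_ _ xab)[[hf hf'] [hg hg']] _]] := HB _ By.
  have [r1 r2] := rC _ _ xab y1.
  have three c u v : `|c| <= C -> `|u| <= Fb y -> `|v| <= Gb y ->
      `|c * u * v| <= C * `|Fb y * Gb y|.
    move=> hc hu hv; rewrite -mulrA normrM ler_pM// !normrM ler_pM//.
      exact: le_trans hu (ler_norm _).
    exact: le_trans hv (ler_norm _).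
  have := three _ _ _ r2 hf hg; have := three _ _ _ r1 hf' hg; have := three _ _ _ r1 hf hg'.
  rewrite /F'; set p := rho' x y * _ * _; set q := rho x y * _ * g x y; set s := _ * g' x y.
  set c := C * _ => h1 h2 h3; rewrite -mulrA -/c.
  have := ler_normD (p + q) s; have := ler_normD p q; lra.
Qed.

Variables (T : R) (f : R -> R -> R).
Hypotheses (T0 : 0 < T) (jf : jl2 T f).
Variables (k k' : R -> R) (M : R).
Hypotheses (dk : forall x : R, is_derive x 1 k (k' x)) (mk' : measurable_fun setT k')
  (kM : forall x, `|k x| <= M) (kM' : forall x, `|k' x| <= M).

Lemma shift_kernel : measurable_fun setT k.
Proof.
by apply: continuous_measurable_fun => x; apply: derivable_cont; case: (dk x).
Qed.

Lemma bker_shift t : bker (fun s => k (s - t)).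
Proof.
split; last by exists M.
by apply: (measurableT_comp shift_kernel); exact: measurable_funB.
Qed.

Lemma bker_shift' t : bker (fun s => - k' (s - t)).
Proof.
split; last by exists M => s; rewrite normrN.
apply: measurable_funN; apply: (measurableT_comp mk'); exact: measurable_funB.
Qed.

(** The order of quantifiers matters: the exceptional set of radii comes from the sections of [f]
    alone and is the same for all [t], as needed to differentiate in [t] at a fixed [r]. *)
Lemma Av_shift_bound :
  {ae mu, forall r, forall t, `|Av (fun s => k (s - t)) f r| <= M * Nf f r /\
    `|Av (fun s => - k' (s - t)) f r| <= M * Nf f r}.
Proof.
have [_ _ _ /jint_ae] := jf; apply: aeS => r Ir t; split.
  by apply: (Av_le_Nf jf) => //; have [] := bker_shift t.
by apply: (Av_le_Nf jf) => //; [have [] := bker_shift' t|move=> s; rewrite normrN].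
Qed.

(** Differentiation in [t] falls on the kernel alone, so no regularity of [f] in time enters; the
    sign is that of the derivative of [s - t]. *)
Lemma Av_shift_derive :
  {ae mu, forall r, forall t : R, is_derive t 1 (fun t => Av (fun s => k (s - t)) f r)
    (Av (fun s => - k' (s - t)) f r)}.
Proof.
have [_ _ _ /jint_ae] := jf; apply: aeS => r Ir t.
have M0 : 0 <= M by apply: le_trans (kM 0).
apply: (@is_derive_under setT (fun t s => k (s - t) * f s r)
  (fun t s => - k' (s - t) * f s r) (fun s => M * `|1 * f s r|) (t - 1) (t + 1)) => //.
- by rewrite ltrBlDr ltrDl ltr01.
- by move=> x _; apply: (jl2_int_sec jf) => //; exact: bker_shift.
- move=> x s _ _.
  have d1 : is_derive x 1 (fun x : R => s - x) (-1).
    have D := is_deriveB (is_derive_cst s x (1 : R)) (is_derive_id x (1 : R)).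
    by apply: (is_derive_eq D); rewrite sub0r.
  have d2 : is_derive x 1 (k \o (fun x : R => s - x)) (k' (s - x) * -1).
    by apply: is_derive1_comp.
  have d3 : is_derive x 1 (fun=> f s r) 0 by exact: is_derive_cst.
  have D := is_deriveM d2 d3.
  by apply: (is_derive_eq D); rewrite ?fctE /GRing.scale /=; ring.
- by move=> s; rewrite mulr_ge0.
- apply: intRZ; apply: integrable_norm; apply: (jl2_int_sec jf) => //; exact: bker1.
- by move=> x s _ _; rewrite mul1r normrM normrN ler_wpM2r.
Qed.

End TimeDerivatives.

(** * Real and imaginary parts *)

Section RealForm.
Context {R : realType}.
Notation mu := (@lebesgue_measure R).
Notation H := (@halfline R).
Notation Re := complex.Re.
Notation Im := complex.Im.

Lemma halflineP (r : R) : H r <-> 1 < r.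
Proof. by rewrite /halfline /= in_itv/= andbT. Qed.

Lemma mH : measurable H. Proof. exact: measurable_itv. Qed.

Lemma restrE (f : R -> R) r : (f \_ H) r = if 1 < r then f r else 0.
Proof.
rewrite patchE; have [r1|r1] := boolP (1 < r).
  by rewrite mem_set//; exact/halflineP.
by rewrite memNset// => /halflineP; exact/negP.
Qed.

Definition ra (f : R -> R[i]) : R -> R := (fun r => Re (f r)) \_ H.
Definition ia (f : R -> R[i]) : R -> R := (fun r => Im (f r)) \_ H.

(** The square of [L2norm], kept in the extended reals so that it can be handled before finiteness
    is known. *)
Definition sqint (f : R -> R[i]) := (\int[mu]_r (ra f r ^+ 2 + ia f r ^+ 2)%:E)%E.

Lemma sqint_ge0 f : (0 <= sqint f)%E.
Proof. by apply: integral_ge0 => r _; rewrite lee_fin addr_ge0 ?sqr_ge0. Qed.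

Lemma normc_sq (z : R[i]) : ComplexField.Normc.normc z ^+ 2 = Re z ^+ 2 + Im z ^+ 2.
Proof. by case: z => a b; rewrite /= sqr_sqrtr// addr_ge0 ?sqr_ge0. Qed.

Lemma abse_poweR2 (x : R) : (`|x%:E| `^ 2 = (x ^+ 2)%:E)%E.
Proof. by rewrite /= powR_mulrn// real_normK ?num_real. Qed.

Lemma L2norm_sqint f : L2norm f = (sqint f `^ 2^-1)%E.
Proof.
rewrite /L2norm unlock; congr (_ `^ _)%E; apply: eq_integral => r _.
rewrite /ra /ia !restrE patchE; have [r1|r1] := boolP (1 < r).
  rewrite mem_set; last exact/halflineP.
  by rewrite abse_poweR2 normc_sq.
rewrite memNset; last by move=> /halflineP; exact/negP.
by rewrite (abse_poweR2 0) !expr0n addr0.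
Qed.

Lemma L2norm_sq f : (L2norm f `^ 2 = sqint f)%E.
Proof. by rewrite L2norm_sqint -poweRrM mulVf// poweRe1// sqint_ge0. Qed.

Lemma cmeas_ra f : cmeasurable H f -> measurable_fun setT (ra f) /\ measurable_fun setT (ia f).
Proof.
by move=> [m1 m2]; split; (apply/(measurable_restrictT _ _).1 => //; exact: mH).
Qed.

Lemma ra0 f r : r <= 1 -> ra f r = 0.
Proof. by move=> r1; rewrite /ra restrE ltNge r1. Qed.
Lemma ia0 f r : r <= 1 -> ia f r = 0.
Proof. by move=> r1; rewrite /ia restrE ltNge r1. Qed.

Lemma sqint_l2 f : cmeasurable H f -> (sqint f < +oo)%E -> l2 (ra f) /\ l2 (ia f).
Proof.
move=> /cmeas_ra[m1 m2] fin.
have I0 : intR (fun r => ra f r ^+ 2 + ia f r ^+ 2).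
  apply/integrableP; split.
    by apply/measurable_EFinP; apply: measurable_funD; exact: measurable_funX.
  move: fin; rewrite /sqint; congr (_ < _)%E; apply: eq_integral => r _ /=.
  by rewrite ger0_norm// addr_ge0 ?sqr_ge0.
split; split=> //; try by move=> r; [exact: ra0|exact: ia0].
- by move=> r; exact: ra0.
- apply: le_intR I0; first exact: measurable_funX.
  by move=> r; rewrite ger0_norm ?sqr_ge0// lerDl sqr_ge0.
- by move=> r; exact: ia0.
- apply: le_intR I0; first exact: measurable_funX.
  by move=> r; rewrite ger0_norm ?sqr_ge0// lerDr sqr_ge0.
Qed.

Lemma L2_l2 f : L2 f -> l2 (ra f) /\ l2 (ia f).
Proof.
by move=> [mf fin]; apply: sqint_l2 => //; rewrite -L2norm_sq; exact: poweR_lty.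
Qed.

Lemma sqint_N2 f : l2 (ra f) -> l2 (ia f) -> sqint f = (N2 (ra f) (ia f))%:E.
Proof.
move=> l1 l2'; have I1 := l2_int l1 l1; have I2 := l2_int l2' l2'.
rewrite /N2 /ip -RintegralD// -intR_Rint; last exact: intRD.
by apply: eq_integral => r _; rewrite -!expr2.
Qed.

Lemma raB f g : ra (fun r => f r - g r) =1 (fun r => ra f r - ra g r).
Proof.
move=> r; rewrite /ra !restrE; case: ifP => _; last by rewrite subr0.
by case: (f r) => ? ?; case: (g r).
Qed.
Lemma iaB f g : ia (fun r => f r - g r) =1 (fun r => ia f r - ia g r).
Proof.
move=> r; rewrite /ia !restrE; case: ifP => _; last by rewrite subr0.
by case: (f r) => ? ?; case: (g r).
Qed.

Lemma L2norm_lt f (d : R) : 0 < d -> (L2norm f < d%:E)%E -> (sqint f < (d ^+ 2)%:E)%E.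
Proof.
move=> d0; rewrite -L2norm_sq; have := Lnorm_ge0 mu 2%:E
  ((fun r => (ComplexField.Normc.normc (f r))%:E) \_ H); rewrite -/(L2norm f).
case: (L2norm f) => [x| |] //=; rewrite lee_fin !lte_fin => x0 xd.
by rewrite powR_mulrn// ltrXn2r// ?nnegrE ltW.
Qed.

Lemma cvge0_lt {I : Type} (F : set_system I) {FF : Filter F} (f : I -> \bar R) (d : R) :
  0 < d -> f @ F --> 0%E -> \forall x \near F, (f x < d%:E)%E.
Proof.
move=> d0 f0; have : nbhs (0%E : \bar R) [set y | (y < d%:E)%E].
  by apply: open_nbhs_nbhs; split; [exact: open_ereal_lt_ereal|rewrite /= lte_fin].
by move=> /f0.
Qed.

Lemma lt_halves4 (a b c d e : R) : a + b < e / 2 -> c + d < e / 2 ->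
  a + c + (b + d) < e.
Proof. lra. Qed.

Lemma H10_h10 u v : H10 u v -> h10 (ra u) (ra v) /\ h10 (ia u) (ia v).
Proof.
move=> [/[dup] L2u /L2_l2[l1 l2'] /[dup] L2v /L2_l2[l3 l4] [phi [tphi cu cv]]].
have tra n : test (fun r => Re (phi n r)) /\ test (fun r => Im (phi n r)).
  have [sm [a [b [a1 z]]]] := tphi n; split; split.
  - by move=> m x; exact: (sm m x).1.
  - by exists a, b; split=> // r /z ->.
  - by move=> m x; exact: (sm m x).2.
  - by exists a, b; split=> // r /z ->.
have key (e : R) : 0 < e -> exists n,
    N2 (fun r => ra u r - Re (phi n r)) (fun r => ra v r - derive1 (fun r => Re (phi n r)) r) +
    N2 (fun r => ia u r - Im (phi n r)) (fun r => ia v r - derive1 (fun r => Im (phi n r)) r) < e.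
  (* Both L^2 errors are made smaller than [d], so their squares add up to less than [e]. One index
     [n] serves the real and the imaginary part together. *)
  move=> e0; pose d := Num.sqrt (e / 2).
  have d0 : 0 < d by rewrite sqrtr_gt0 divr_gt0.
  have d2 : d ^+ 2 = e / 2 by rewrite sqr_sqrtr// ltW// divr_gt0.
  have ev1 : \forall n \near \oo, (L2norm (fun r => (phi n r - u r)%R) < d%:E)%E.
    exact: cvge0_lt cu.
  have ev2 : \forall n \near \oo, (L2norm (fun r => (cderive (phi n) r - v r)%R) < d%:E)%E.
    exact: cvge0_lt cv.
  near \oo => n; exists n.
  have h1 : (sqint (fun r => (phi n r - u r)%R) < (d ^+ 2)%:E)%E.
    by apply: L2norm_lt => //; near: n.
  have h2 : (sqint (fun r => (cderive (phi n) r - v r)%R) < (d ^+ 2)%:E)%E.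
    by apply: L2norm_lt => //; near: n.
  have [tr ti] := tra n.
  have lr := test_l2 tr; have lr' := test_l2 (test_derive tr).
  have li := test_l2 ti; have li' := test_l2 (test_derive ti).
  have rE (g : R -> R) : l2 g -> g \_ H =1 g.
    by move=> [_ g0 _] r; rewrite restrE; case: ltP => // /g0.
  have e1 : ra (fun r => phi n r - u r) = (fun r => Re (phi n r) - ra u r).
    by apply/funext => r; rewrite raB /ra rE.
  have e2 : ia (fun r => phi n r - u r) = (fun r => Im (phi n r) - ia u r).
    by apply/funext => r; rewrite iaB /ia rE.
  have e3 : ra (fun r => cderive (phi n) r - v r) =
     (fun r => derive1 (fun r => Re (phi n r)) r - ra v r).
    by apply/funext => r; rewrite raB {1}/ra rE.
  have e4 : ia (fun r => cderive (phi n) r - v r) =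
     (fun r => derive1 (fun r => Im (phi n r)) r - ia v r).
    by apply/funext => r; rewrite iaB {1}/ia rE.
  move: h1 h2; rewrite !sqint_N2 ?e1 ?e2 ?e3 ?e4; try exact: l2B.
  rewrite !lte_fin /N2 d2.
  have sw (p q : R -> R) : ip (fun r => p r - q r) (fun r => p r - q r) =
     ip (fun r => q r - p r) (fun r => q r - p r).
    by apply: eq_Rintegral => r _; ring.
  rewrite ![ip (fun r => _ - ra _ r) _]sw ![ip (fun r => _ - ia _ r) _]sw.
  exact: lt_halves4.
split; split=> // e e0; have [n hn] := key _ e0; have [tr ti] := tra n.
- exists (fun r => Re (phi n r)) => //; apply: le_lt_trans hn; rewrite lerDl; exact: N2_ge0.
- exists (fun r => Im (phi n r)) => //; apply: le_lt_trans hn; rewrite lerDr; exact: N2_ge0.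
Unshelve. all: by end_near. Qed.

Lemma ra_real (g : R -> R) : l2 g -> ra (fun r => (g r)%:C) = g.
Proof.
by move=> [_ g0 _]; apply/funext => r; rewrite /ra restrE; case: ltP => // /g0.
Qed.

Lemma ia_real (g : R -> R) : ia (fun r => (g r)%:C) = fun=> 0.
Proof. by apply/funext => r; rewrite /ia restrE /=; case: ifP. Qed.

Lemma L2_real (g : R -> R) : l2 g -> L2 (fun r => (g r)%:C).
Proof.
move=> lg; split.
  split=> /=; last exact: measurable_cst.
  by apply: measurable_funTS; exact: l2_meas.
rewrite L2norm_sqint; apply: poweR_lty; rewrite sqint_N2 ?ltry// ?ra_real// ia_real; exact: l2_0.
Qed.

Lemma derive1n_0 n : derive1n n (fun=> 0 : R) = (fun=> 0).
Proof.
by elim: n => // n IH; rewrite derive1nS IH; apply/funext => x; rewrite derive1E derive_cst.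
Qed.

(** Makes real functions admissible in the weak formulation, where they split the complex equation
    into its real and imaginary parts. The approximants have squared error below [(n + 1)^-2], so
    that the norms are dominated by the harmonic sequence. *)
Lemma h10_H10 (g dg : R -> R) : h10 g dg -> H10 (fun r => (g r)%:C) (fun r => (dg r)%:C).
Proof.
move=> [lg ldg Hg]; split; [exact: L2_real..|].
have Hn n : exists phi, test phi /\
    N2 (fun r => g r - phi r) (fun r => dg r - derive1 phi r) < n.+1%:R^-1 ^+ 2.
  have n0 : 0 < n.+1%:R^-1 ^+ 2 :> R by rewrite exprn_gt0// invr_gt0.
  by have [phi tp h] := Hg _ n0; exists phi.
have [phi Hphi] := choice Hn.
exists (fun n r => (phi n r)%:C).
have sq0 : (fun n => (n.+1%:R^-1 : R)%:E) @ \oo --> 0%E.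
  by apply: cvg_EFin; [exact: nearW|exact: cvg_harmonic].
have cv (f : nat -> R -> R[i]) (a : nat -> R -> R) : (forall n, f n = (fun r => (a n r)%:C)) ->
    (forall n, l2 (a n)) -> (forall n, ip (a n) (a n) < n.+1%:R^-1 ^+ 2) ->
    (fun n => L2norm (f n)) @ \oo --> 0%E.
  move=> fE la h; apply: (squeeze_cvge _ (cvg_cst _) sq0); apply: nearW => n.
  rewrite Lnorm_ge0/= fE L2norm_sqint sqint_N2 ?ra_real ?ia_real//; last exact: l2_0.
  rewrite poweR_EFin lee_fin powR12_sqrt ?N2_ge0//.
  rewrite -[leRHS]ger0_norm ?invr_ge0// -sqrtr_sqr ler_wsqrtr//.
  by rewrite /N2 ip0l addr0 ltW.
have sw (p p' : R -> R) : ip (fun r => p r - p' r) (fun r => p r - p' r) =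
    ip (fun r => p' r - p r) (fun r => p' r - p r).
  by apply: eq_Rintegral => r _; ring.
split.
- move=> n; have [[sm [a [b [a1 z]]]] _] := Hphi n; split.
    move=> m x; split=> /=; first exact: sm.
    by rewrite derive1n_0; exact: derivable_cst.
  by exists a, b; split=> // r /z ->.
- apply: (cv _ (fun n r => phi n r - g r)) => n; have [tp hn] := Hphi n.
  + by apply/funext => r; rewrite rmorphB.
  + exact: l2B (test_l2 tp) lg.
  + by rewrite sw (le_lt_trans _ hn)// lerDl ip_ge0.
- apply: (cv _ (fun n r => derive1 (phi n) r - dg r)) => n; have [tp hn] := Hphi n.
  + apply/funext => r; rewrite /cderive rmorphB; congr (_ - _).
    by rewrite [X in _ +i* X](_ : _ = 0)// derive1E derive_cst.
  + exact: l2B (test_l2 (test_derive tp)) ldg.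
  + by rewrite sw (le_lt_trans _ hn)// lerDr ip_ge0.
Qed.

End RealForm.

(** * The equation as a real system *)

Section RealSolution.
Context {R : realType}.
Notation mu := (@lebesgue_measure R).
Notation H := (@halfline R).
Notation Re := (@complex.Re R).
Notation Im := (@complex.Im R).

Definition Xp (r : R) := (r ^+ 2)^-1.

Lemma bdmul_Xp : bdmul Xp.
Proof.
split; last first.
  exists 1 => r r1; rewrite /Xp ger0_norm ?invr_ge0 ?sqr_ge0//.
  by rewrite invf_le1 ?exprn_ege1 ?exprn_gt0 ?(lt_trans ltr01 r1)// ltW.
apply: open_continuous_measurable_fun; first exact: interval_open.
move=> x /set_mem /halflineP x1; apply: cvgV; last exact: exprn_continuous.
by rewrite expf_neq0// gt_eqF// (lt_trans ltr01 x1).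
Qed.

(* w = a1 + i a2 as a real system; F_i and dF_i are a_i and its radial derivative on
   (0, T), extended by 0 to all times. *)
Record rsol (nu c K T : R) (a1 a2 F1 F2 dF1 dF2 : R -> R -> R) : Prop := RSol {
  rs_l2 : forall t, 0 <= t <= T -> l2 (a1 t) /\ l2 (a2 t);
  rs_cont : forall t, 0 <= t <= T -> forall e : R, 0 < e -> exists2 h, 0 < h &
    forall s, 0 <= s <= T -> `|s - t| < h ->
      N2 (fun r => a1 s r - a1 t r) (fun r => a2 s r - a2 t r) < e;
  rs_eq : forall s, 0 < s < T -> F1 s = a1 s /\ F2 s = a2 s;
  rs_jF : jl2 T F1 /\ jl2 T F2;
  rs_jdF : jl2 T dF1 /\ jl2 T dF2;
  rs_h10 : {ae mu, forall s, h10 (F1 s) (dF1 s) /\ h10 (F2 s) (dF2 s)};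
  rs_weak : forall g dg, h10 g dg -> forall t, 0 <= t <= T ->
    (ip (a1 t) g - ip (a1 0) g + \int[mu]_(s in `]0, t[)
      (nu * ip (dF1 s) dg + c * ip (fun r => Xp r * F1 s r) g
       - K * ip (fun r => Xp r * F2 s r) g) = 0) /\
    (ip (a2 t) g - ip (a2 0) g + \int[mu]_(s in `]0, t[)
      (nu * ip (dF2 s) dg + c * ip (fun r => Xp r * F2 s r) g
       + K * ip (fun r => Xp r * F1 s r) g) = 0) }.

Lemma young_sign (n q m eta : R) : 0 < eta ->
  0 <= n + 2 * eta^-1 * q + eta^-1 ^+ 2 * m -> - (2 * q) <= eta * n + eta^-1 * m.
Proof.
move=> e0 /(mulr_ge0 (ltW e0)).
have -> : eta * (n + 2 * eta^-1 * q + eta^-1 ^+ 2 * m) = eta * n + 2 * q + eta^-1 * m.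
  by field; rewrite gt_eqF.
lra.
Qed.

(** Continuity in L^2 makes the squared norm a continuous function on the compact interval [0, T],
    which attains its maximum. The bound turns information at each time into joint square
    integrability. *)
Lemma N2_bounded (T : R) (a1 a2 : R -> R -> R) : 0 < T ->
  (forall t, 0 <= t <= T -> l2 (a1 t) /\ l2 (a2 t)) ->
  (forall t, 0 <= t <= T -> forall e : R, 0 < e -> exists2 h, 0 < h &
    forall s, 0 <= s <= T -> `|s - t| < h ->
      N2 (fun r => a1 s r - a1 t r) (fun r => a2 s r - a2 t r) < e) ->
  exists M, forall t, 0 <= t <= T -> N2 (a1 t) (a2 t) <= M.
Proof.
move=> T0 la ca; pose n s := N2 (a1 s) (a2 s).
have cn : {within `[0, T], continuous n}.
  apply/subspace_continuousP => t; rewrite /= in_itv /= => tT.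
  apply/cvgrPdist_lt => e e0; have [l1 l2'] := la _ tT.
  (* With [m] the squared norm of the increment, [n s = n t + 2 q + m], and Young's inequality gives
     [|2 q| <= eta * n t + eta^-1 * m]. The choice of [eta] makes the first term at most [e / 2],
     that of [d] makes [(1 + eta^-1) * m] less than [e / 2]. *)
  pose y := n t + 1; have y0 : 0 < y by rewrite ltr_wpDl// N2_ge0.
  pose eta := e / (2 * y); have eta0 : 0 < eta by rewrite divr_gt0// mulr_gt0.
  have e1 : eta * n t <= e / 2.
    have n0 : 0 <= n t by exact: N2_ge0.
    rewrite (_ : e / 2 = eta * y); last by rewrite /eta; field; lra.
    by rewrite ler_wpM2l ?(ltW eta0)// /y lerDl.
  clearbody eta; pose d := e / (2 * (1 + eta^-1)).
  have d1 : 0 < 2 * (1 + eta^-1) by rewrite mulr_gt0// addr_gt0// invr_gt0.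
  have d0 : 0 < d by rewrite divr_gt0.
  have [h h0 Hh] := ca _ tT _ d0.
  rewrite near_withinE; apply/nbhs_ballP; exists h => // s /= sh sT.
  have {}sT : 0 <= s <= T by move: sT; rewrite in_itv.
  have {}Hh := Hh _ sT; rewrite distrC in Hh; have {Hh} hd := Hh sh.
  have [k1 k2] := la _ sT.
  have lb1 := l2B k1 l1; have lb2 := l2B k2 l2'.
  have E : n s = n t + 2 * 1 * Q2 (a1 t) (a2 t) (fun r => a1 s r - a1 t r) (fun r => a2 s r - a2 t r)
      + 1 ^+ 2 * N2 (fun r => a1 s r - a1 t r) (fun r => a2 s r - a2 t r).
    by rewrite -N2_expand//; apply: eq_N2 => r; ring.
  have P1 := N2_ge0 (fun r => a1 t r + eta^-1 * (a1 s r - a1 t r)) (fun r => a2 t r + eta^-1 * (a2 s r - a2 t r)).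
  have P2 := N2_ge0 (fun r => a1 t r + (- eta^-1) * (a1 s r - a1 t r)) (fun r => a2 t r + (- eta^-1) * (a2 s r - a2 t r)).
  rewrite N2_expand// -/(n t) in P1; rewrite N2_expand// -/(n t) in P2.
  change (`|n t - n s| < e); rewrite E; move: hd P1 P2; set q := Q2 _ _ _ _; set m := N2 _ _ => hd P1 P2.
  have m0 : 0 <= m by exact: N2_ge0.
  rewrite /d ltr_pdivlMr// in hd.
  have ii : eta * eta^-1 = 1 by rewrite mulfV// gt_eqF.
  have P1' := young_sign eta0 P1.
  have P2' : 2 * q <= eta * n t + eta^-1 * m.
    have := @young_sign (n t) (- q) m eta eta0; rewrite !mulrN opprK; apply.
    by move: P2; rewrite sqrrN mulrN mulNr.
  rewrite mulr1 expr1n mul1r ltr_norml; apply/andP; split; lra.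
have [||c cT Hc] := @compact_EVT_max R R n `[0, T]%classic _ _ cn.
- by exists 0; rewrite /= in_itv/= lexx ltW.
- exact: segment_compact.
by exists (n c) => t tT; apply: Hc; rewrite inE /= in_itv.
Qed.

(** The extension by 0 is made jointly in [(s, r)], so that joint measurability on the open strip
    yields measurability on the plane. *)
Definition patchT (T : R) (p : R[i] -> R) (w : R -> R -> R[i]) (s r : R) : R :=
  ((fun z : R * R => p (w z.1 z.2)) \_ (`]0, T[ `*` H)) (s, r).

Lemma patchT_in (T : R) p w s : 0 < s < T -> patchT T p w s = (fun r => p (w s r)) \_ H.
Proof.
move=> sT; apply/funext => r; rewrite /patchT !patchE; have [rH|rH] := pselect (H r).
  by rewrite mem_set ?mem_set//; split=> //; rewrite /= in_itv.
by rewrite memNset ?memNset// => -[].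
Qed.

Lemma patchT_out (T : R) p w s : ~~ (0 < s < T) -> patchT T p w s = fun=> 0.
Proof.
move=> sT; apply/funext => r; rewrite /patchT patchE memNset// => -[/= + _].
by rewrite in_itv/=; exact/negP.
Qed.

Lemma patchT_le1 (T : R) p w s r : r <= 1 -> patchT T p w s r = 0.
Proof.
by move=> r1; rewrite /patchT patchE memNset// => -[_ /= /halflineP]; rewrite ltNge r1.
Qed.

Lemma patchT_meas (T : R) (p : R[i] -> R) (w : R -> R -> R[i]) :
  measurable_fun (`]0, T[ `*` H) (fun z : R * R => p (w z.1 z.2)) ->
  jmeas (patchT T p w).
Proof.
move=> m; have mD : measurable (`]0, T[%classic `*` H : set (R * R)).
  by apply: measurableX; [exact: measurable_itv|exact: mH].
have := (measurable_restrictT (fun z : R * R => p (w z.1 z.2)) mD).1 m.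
by apply: eq_measurable_fun => -[s r] _.
Qed.

Lemma jl2_of_bound (T : R) (p : R[i] -> R) w (G : R -> \bar R) : jmeas (patchT T p w) ->
  measurable_fun setT G ->
  (forall s, (\int[mu]_r (patchT T p w s r ^+ 2)%:E <= G s)%E) ->
  (\int[mu]_s G s < +oo)%E -> jl2 T (patchT T p w).
Proof.
move=> m mG FG fin; split=> //.
- by move=> s r sT; rewrite patchT_out.
- by move=> s r; exact: patchT_le1.
have m2 : measurable_fun [set: R * R] (fun z => (patchT T p w z.1 z.2 ^+ 2)%:E).
  by apply/measurable_EFinP; exact: measurable_funX.
apply: (@integrable12ltyP _ _ _ _ _ mu mu _ m2).2; apply: le_lt_trans fin.
apply: ge0_le_integral => //.
- by move=> s _; exact: integral_ge0.
- apply: (@measurable_fun_fubini_tonelli_F _ _ _ _ R mu (fun z => `|(patchT T p w z.1 z.2 ^+ 2)%:E|%E)) => //.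
  exact: measurableT_comp.
- move=> s _; apply: le_trans (FG s); rewrite le_eqVlt; apply/orP; left; apply/eqP.
  by apply: eq_integral => r _ /=; rewrite ger0_norm ?sqr_ge0.
Qed.

Lemma LpL2norm2_sq (T : R) w : (LpL2norm T 2%:E w `^ 2 = \int[mu]_s \int[mu]_r
  (patchT T Re w s r ^+ 2 + patchT T Im w s r ^+ 2)%:E)%E.
Proof.
rewrite /LpL2norm poweR_Lnorm//; apply: eq_integral => s _.
rewrite patchE; have [sT|sT] := boolP (0 < s < T).
  rewrite mem_set; last by rewrite /= in_itv.
  rewrite gee0_abs ?Lnorm_ge0// L2norm_sq; apply: eq_integral => r _.
  by rewrite !patchT_in.
rewrite memNset; last by rewrite /= in_itv/=; exact/negP.
rewrite abse0 poweR0r//; under eq_integral do rewrite !patchT_out// expr0n addr0.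
by rewrite integral0.
Qed.

Lemma L2inner_real (f : R -> R[i]) (g : R -> R) : l2 g ->
  L2inner f (fun r => (g r)%:C) = (ip (ra f) g) +i* (ip (ia f) g).
Proof.
move=> [_ g0 _]; rewrite /L2inner /cintegral; congr (_ +i* _).
  rewrite Rintegral_mkcond; apply: eq_Rintegral => r _; rewrite restrE /ra restrE.
  case: ltP => r1; last by rewrite mul0r.
  by case: (f r) => a b /=; rewrite oppr0 mulr0 subr0.
rewrite Rintegral_mkcond; apply: eq_Rintegral => r _; rewrite restrE /ia restrE.
case: ltP => r1; last by rewrite mul0r.
by case: (f r) => a b /=; rewrite oppr0 mulr0 add0r.
Qed.

Lemma Tform_real k (nu B : R) (u du : R -> R[i]) (g dg : R -> R) : l2 g -> l2 dg ->
  l2 (ra u) -> l2 (ia u) ->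
  Tform k nu B u du (fun r => (g r)%:C) (fun r => (dg r)%:C) =
  (nu * ip (ra du) dg + nu * (k%:~R ^+ 2 - 4^-1) * ip (fun r => Xp r * ra u r) g
     - k%:~R * B * ip (fun r => Xp r * ia u r) g) +i*
  (nu * ip (ia du) dg + nu * (k%:~R ^+ 2 - 4^-1) * ip (fun r => Xp r * ia u r) g
     + k%:~R * B * ip (fun r => Xp r * ra u r) g).
Proof.
move=> lg ldg lu1 lu2; rewrite /Tform !L2inner_real//.
have bX := bdmul_Xp; have lX1 := l2M bX lu1; have lX2 := l2M bX lu2.
set c := nu * (_ - _); set K := k%:~R * B.
have e1 : ra (fun r => Tpotential k nu B r * u r) =
    (fun r => c * (Xp r * ra u r) - K * (Xp r * ia u r)).
  apply/funext => r; rewrite /ra /ia !restrE; case: ifP => _; last by ring.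
  by case: (u r) => a b; rewrite /Tpotential /Xp /c /K /=; ring.
have e2 : ia (fun r => Tpotential k nu B r * u r) =
    (fun r => c * (Xp r * ia u r) + K * (Xp r * ra u r)).
  apply/funext => r; rewrite /ra /ia !restrE; case: ifP => _; last by ring.
  by case: (u r) => a b; rewrite /Tpotential /Xp /c /K /=; ring.
have lcX1 := l2Z c lX1; have lcX2 := l2Z c lX2; have lK1 := l2Z K lX1; have lK2 := l2Z K lX2.
rewrite e1 e2 ipBl// ipDl// !ipZl//.
by apply/eqP; rewrite eq_complex /=; apply/andP; split; apply/eqP; ring.
Qed.

Lemma complex_eq0_parts (a b c d : R) (z : R[i]) : (a +i* b) - (c +i* d) + z = 0 ->
  a - c + Re z = 0 /\ b - d + Im z = 0.
Proof. by case: z => x y /eqP; rewrite eq_complex /= => /andP[/eqP -> /eqP ->]. Qed.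

Lemma weak_solution_rsol k (nu B T : R) w0 w : 0 < T -> weak_solution k nu B T w0 w ->
  exists F1 F2 dF1 dF2, [/\ rsol nu (nu * (k%:~R ^+ 2 - 4^-1)) (k%:~R * B) T
     (fun t => ra (w t)) (fun t => ia (w t)) F1 F2 dF1 dF2,
    F1 = patchT T Re w & F2 = patchT T Im w].
Proof.
move=> T0 [[mw1 mw2] lw cw w00 [dw [[mdw1 mdw2] hdw fdw weak]]].
exists (patchT T Re w), (patchT T Im w), (patchT T Re dw), (patchT T Im dw); split=> //.
have la t : 0 <= t <= T -> l2 (ra (w t)) /\ l2 (ia (w t)).
  by move=> /lw /L2_l2.
have ca t : 0 <= t <= T -> forall e : R, 0 < e -> exists2 h, 0 < h &
    forall s, 0 <= s <= T -> `|s - t| < h ->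
      N2 (fun r => ra (w s) r - ra (w t) r) (fun r => ia (w s) r - ia (w t) r) < e.
  move=> tT e e0; have se0 : 0 < Num.sqrt e by rewrite sqrtr_gt0.
  have [h /= h0 Hh] : nbhs_ball t [set s : R | `[0, T]%classic s ->
      (L2norm (fun r => (w s r - w t r)%R) < (Num.sqrt e)%:E)%E].
    have FW : Filter (within `[0, T]%classic (nbhs t)) by exact: within_filter.
    by apply/nbhs_ballP; have := cvge0_lt se0 (cw _ tT); rewrite near_withinE; apply.
  exists h => // s sT sh; have [l1 l2'] := la _ tT; have [l3 l4] := la _ sT.
  have sb : ball t h s by rewrite /ball /= distrC.
  have := Hh s sb; rewrite /= in_itv => /(_ sT) /(L2norm_lt se0).
  rewrite sqint_N2; last 2 first.
  - rewrite (_ : ra _ = (fun r => ra (w s) r - ra (w t) r)); last exact/funext/raB.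
    exact: l2B.
  - rewrite (_ : ia _ = (fun r => ia (w s) r - ia (w t) r)); last exact/funext/iaB.
    exact: l2B.
  rewrite lte_fin sqr_sqrtr ?ltW//; apply: le_lt_trans.
  by rewrite le_eqVlt (eq_N2 (raB _ _) (iaB _ _)) eqxx.
have mF1 := patchT_meas mw1; have mF2 := patchT_meas mw2.
have mdF1 := patchT_meas mdw1; have mdF2 := patchT_meas mdw2.
split=> //.
- by move=> s sT; rewrite !patchT_in.
(* Joint square integrability of [w] follows from the bound uniform in time; that of [dw], treated
   next, from the finiteness of its norm in [L^2((0,T); L^2_r)]. *)
- have [M HM] := N2_bounded T0 la ca.
  have fin : (\int[mu]_s (M * chiT T s)%:E < +oo)%E.
    by have := intRZ M (chiT_int T) => /integrable_lty; apply.
  have mG : measurable_fun setT (fun s => (M * chiT T s)%:E).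
    by apply/measurable_EFinP; exact: intR_meas (intRZ M (chiT_int T)).
  split; apply: jl2_of_bound mG _ fin => // s.
  + have [sT|sT] := boolP (0 < s < T); last first.
      rewrite patchT_out// chiTE (negbTE sT) mulr0; under eq_integral do rewrite expr0n.
      by rewrite integral0.
    have sT' : 0 <= s <= T by case/andP: sT => /ltW -> /ltW ->.
    have [l1 l2'] := la _ sT'; have [_ _ I1] := l1.
    rewrite chiTE sT mulr1 patchT_in// (intR_Rint I1) lee_fin.
    apply: le_trans (HM _ sT'); rewrite /N2 (_ : Rintegral _ _ _ = ip (ra (w s)) (ra (w s))).
      by rewrite lerDl ip_ge0.
    by apply: eq_Rintegral => r _; rewrite expr2.
  + have [sT|sT] := boolP (0 < s < T); last first.
      rewrite patchT_out// chiTE (negbTE sT) mulr0; under eq_integral do rewrite expr0n.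
      by rewrite integral0.
    have sT' : 0 <= s <= T by case/andP: sT => /ltW -> /ltW ->.
    have [l1 l2'] := la _ sT'; have [_ _ I1] := l2'.
    rewrite chiTE sT mulr1 patchT_in// (intR_Rint I1) lee_fin.
    apply: le_trans (HM _ sT'); rewrite /N2 (_ : Rintegral _ _ _ = ip (ia (w s)) (ia (w s))).
      by rewrite lerDr ip_ge0.
    by apply: eq_Rintegral => r _; rewrite expr2.
- have fin : (LpL2norm T 2%:E dw `^ 2 < +oo)%E by exact: poweR_lty.
  rewrite LpL2norm2_sq in fin.
  have mS : measurable_fun [set: R * R]
      (fun z => (patchT T Re dw z.1 z.2 ^+ 2 + patchT T Im dw z.1 z.2 ^+ 2)%:E).
    by apply/measurable_EFinP; apply: measurable_funD; exact: measurable_funX.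
  have mG := @measurable_fun_fubini_tonelli_F _ _ _ _ R mu _ mS
    (fun z => ltac:(by rewrite lee_fin addr_ge0 ?sqr_ge0)).
  split; apply: (jl2_of_bound _ mG) => // s; apply: ge0_le_integral => //.
  + by move=> r _; rewrite lee_fin sqr_ge0.
  + by apply/measurable_EFinP; apply: measurable_funX; exact: jmeas_sec1.
  + by apply: (measurableT_comp mS); exact: pair1_measurable.
  + by move=> r _; rewrite lee_fin lerDl sqr_ge0.
  + by move=> r _; rewrite lee_fin sqr_ge0.
  + by apply/measurable_EFinP; apply: measurable_funX; exact: jmeas_sec1.
  + by apply: (measurableT_comp mS); exact: pair1_measurable.
  + by move=> r _; rewrite lee_fin lerDr sqr_ge0.
- apply: aeS hdw => s hs; have [sT|sT] := boolP (0 < s < T).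
    by have [h1 h2] := H10_h10 (hs sT); rewrite !patchT_in.
  by rewrite !patchT_out//; split; exact: h10_0.
- move=> g dg hg t tT; have [lg ldg] := l2_h10 hg.
  have := weak _ _ (h10_H10 hg) _ tT; rewrite !L2inner_real//.
  have T00 : 0 <= (0 : R) <= T by rewrite lexx ltW.
  move=> /complex_eq0_parts[e1 e2].
  have inT s : s \in `]0, t[%classic -> 0 < s < T.
    rewrite inE /= in_itv /= => /andP[-> st]; case/andP: tT => _ tT.
    exact: lt_le_trans st tT.
  split; [rewrite -[RHS]e1|rewrite -[RHS]e2]; congr (_ + _);
    apply: eq_Rintegral => s /inT sT;
    have sT' : 0 <= s <= T by [case/andP: sT => /ltW -> /ltW ->];
    have [l1 l2'] := la _ sT'; by rewrite Tform_real// !patchT_in.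
Qed.

End RealSolution.

(** * Mollifiers in time *)

Section Mollifiers.
Context {R : realType}.
Notation mu := (@lebesgue_measure R).

Lemma is_derive_mul (f g : R -> R) (f' g' x : R) :
  is_derive x 1 f f' -> is_derive x 1 g g' ->
  is_derive x 1 (fun y => f y * g y) (f' * g x + f x * g').
Proof.
by move=> D E; have H := is_deriveM D E; apply: (is_derive_eq H); rewrite /GRing.scale /=; ring.
Qed.

Lemma is_derive_add (f g : R -> R) (f' g' x : R) :
  is_derive x 1 f f' -> is_derive x 1 g g' -> is_derive x 1 (fun y => f y + g y) (f' + g').
Proof. by move=> D E; exact: is_deriveD. Qed.

Lemma is_derive_scale (c : R) (f : R -> R) (f' x : R) :
  is_derive x 1 f f' -> is_derive x 1 (fun y => c * f y) (c * f').
Proof.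
by move=> D; have H := is_derive_mul (is_derive_cst c x 1) D; apply: (is_derive_eq H);
  rewrite /cst; ring.
Qed.

Lemma is_derive_shift (c : R) (f : R -> R) (f' x : R) :
  is_derive x 1 f f' -> is_derive x 1 (fun y => c + f y) f'.
Proof.
by move=> D; have H := is_derive_add (is_derive_cst c x 1) D; apply: (is_derive_eq H); rewrite /cst; ring.
Qed.

Lemma ftc_R (F f : R -> R) (a b : R) : a < b -> (forall x : R, is_derive x 1 F (f x)) ->
  continuous f -> \int[mu]_(x in `[a, b]) f x = F b - F a.
Proof.
move=> ab dF cf; rewrite /Rintegral (@continuous_FTC2 R f F)//.
- exact: continuous_subspaceT.
- have cF x : {for x, continuous F} by apply: derivable_cont; case: (dF x).
  split=> [x _||]; first by case: (dF x).
  + by apply: cvg_at_right_filter; exact: cF.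
  + by apply: cvg_at_left_filter; exact: cF.
- by move=> x _; rewrite derive1E; case: (dF x).
Qed.

Lemma is_derive_shift_comp (F f : R -> R) (t x : R) : (forall x : R, is_derive x 1 F (f x)) ->
  is_derive x 1 (fun s => F (s - t)) (f (x - t)).
Proof.
move=> dF; have D := is_deriveB (is_derive_id x (1 : R)) (is_derive_cst t x (1 : R)).
have d1 : is_derive x 1 (fun s : R => s - t) 1 by apply: (is_derive_eq D); rewrite subr0.
have d2 : is_derive x 1 (F \o (fun s : R => s - t)) (f (x - t) * 1).
  by apply: is_derive1_comp; exact: dF.
by apply: (is_derive_eq d2); rewrite mulr1.
Qed.

Lemma continuous_shift (f : R -> R) (t : R) : continuous f -> continuous (fun s => f (s - t)).
Proof.
move=> cf x; apply: (@continuous_comp _ _ _ (fun s : R => s - t) f); last exact: cf.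
by apply: cvgB; [exact: cvg_id|exact: cvg_cst].
Qed.

(* The support lies in (0, h): averages only look forward in time, so that a regularised
   solution solves the equation on [0, T - h], initial time included. *)
Definition mollifier (h : R) (k k' : R -> R) (M : R) :=
  [/\ forall x : R, is_derive x 1 k (k' x), continuous k',
     forall x, `|k x| <= M /\ `|k' x| <= M,
     forall x, 0 <= k x & (forall x, ~~ (0 < x < h) -> k x = 0 /\ k' x = 0) /\
     forall t, \int[mu]_s k (s - t) = 1].

Lemma max0_neg (x : R) : x <= 0 -> Num.max 0 x = 0.
Proof. by move=> x0; apply: max_l. Qed.

Lemma max0_pos (x : R) : 0 <= x -> Num.max 0 x = x.
Proof. by move=> x0; apply: max_r. Qed.

Lemma continuous_max0 : continuous (fun x : R => Num.max 0 x).
Proof. by move=> x; apply: continuous_max; [exact: cvg_cst|exact: cvg_id]. Qed.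

(** The two branches are glued at 0 by Caratheodory's criterion: the difference quotient there is
    [max 0 z] itself, which is continuous. *)
Lemma is_derive_max0_sq (x : R) : is_derive x 1 (fun x : R => Num.max 0 x ^+ 2) (2 * Num.max 0 x).
Proof.
have [x0|x0|->] := ltgtP x 0.
- rewrite mulr0; apply: (@near_eq_is_derive _ _ _ (cst 0)).
  near=> y; rewrite max0_neg ?expr0n//; apply: ltW; near: y; exact: near_lt.
- have D := is_deriveM (is_derive_id x (1 : R)) (is_derive_id x (1 : R)).
  apply: (@near_eq_is_derive _ _ _ (fun y : R => y * y)).
    near=> y; rewrite max0_pos ?expr2//; apply: ltW; near: y; exact: near_gt.
  by apply: (is_derive_eq D); rewrite ?fctE /GRing.scale /=; ring.
- apply/is_derive1_caratheodory; exists (fun z => Num.max 0 z); split.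
  + move=> z; rewrite maxxx expr0n subr0 subr0.
    by have [z0|z0] := leP z 0; rewrite ?expr0n ?mul0r ?expr2.
  + exact: continuous_max0.
  + by rewrite maxxx mulr0.
Unshelve. all: by end_near. Qed.

Lemma mollifier_exists (h : R) : 0 < h -> exists k k' M, mollifier h k k' M.
Proof.
(* Squaring the positive part of [x (h - x)] gives a C^1 bump on (0, h). *)
move=> h0; pose m (x : R) := Num.max 0 (x * (h - x)).
pose k0 x := m x ^+ 2; pose k0' x := 2 * m x * (h - 2 * x).
have m0 x : ~~ (0 < x < h) -> m x = 0.
  move=> H; apply: max0_neg; rewrite leNgt; apply: contra H => H.
  have [x0|x0] := ltP 0 x; first by move: H; rewrite pmulr_rgt0// subr_gt0.
  have hx : 0 <= h - x by lra.
  by move: H; rewrite ltNge mulr_le0_ge0.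
have mge0 x : 0 <= m x by rewrite le_max lexx.
have mle x : m x <= h ^+ 2.
  have [/andP[x0 xh]|/m0 ->] := boolP (0 < x < h); last exact: sqr_ge0.
  by rewrite ge_max sqr_ge0/=; nra.
have dpoly (x : R) : is_derive x 1 (fun x : R => x * (h - x)) (h - 2 * x).
  have D1 := is_deriveB (is_derive_cst h x (1 : R)) (is_derive_id x (1 : R)).
  have D := is_deriveM (is_derive_id x (1 : R)) D1.
  by apply: (is_derive_eq D); rewrite ?fctE /GRing.scale /=; ring.
have cpoly : continuous (fun x : R => x * (h - x)).
  by move=> x; apply: derivable_cont; case: (dpoly x).
have cm : continuous m.
  by move=> x; apply: (@continuous_comp _ _ _ (fun x : R => x * (h - x)) (Num.max 0));
    [exact: cpoly|exact: continuous_max0].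
have dk (x : R) : is_derive x 1 k0 (k0' x).
  have D : is_derive x 1 ((fun x : R => Num.max 0 x ^+ 2) \o (fun x : R => x * (h - x)))
     (2 * m x * (h - 2 * x)).
    by apply: is_derive1_comp; exact: is_derive_max0_sq.
  exact: D.
have ck' : continuous k0'.
  move=> x; apply: cvgM; last first.
    by apply: cvgB; [exact: cvg_cst|apply: cvgM; [exact: cvg_cst|exact: cvg_id]].
  by apply: cvgM; [exact: cvg_cst|exact: cm].
have z0 x : ~~ (0 < x < h) -> k0 x = 0 /\ k0' x = 0.
  by move=> /m0 mx; rewrite /k0 /k0' mx expr0n mulr0 mul0r.
(* [h^5 / 30] is the integral of [(x (h - x))^2] over [0, h]. Its antiderivative [P] is in Horner
   form, so that repeated product rules differentiate it. *)
pose kap := h ^+ 5 / 30; have kap0 : 0 < kap by rewrite divr_gt0// exprn_gt0.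
pose P (x : R) := x * (x * (x * (h ^+ 2 / 3 + x * (- (h / 2) + 5^-1 * x)))).
have dP (x : R) : is_derive x 1 P ((x * (h - x)) ^+ 2).
  have D1 := is_derive_shift (- (h / 2)) (is_derive_scale 5^-1 (is_derive_id x (1 : R))).
  have D2 := is_derive_shift (h ^+ 2 / 3) (is_derive_mul (is_derive_id x (1 : R)) D1).
  have D3 := is_derive_mul (is_derive_id x (1 : R)) D2.
  have D := is_derive_mul (is_derive_id x (1 : R)) (is_derive_mul (is_derive_id x (1 : R)) D3).
  by apply: (is_derive_eq D); field.
have intk t : \int[mu]_s k0 (s - t) = kap.
  rewrite (@Rintegral_itv _ _ t (t + h)); last first.
    move=> s H; have [|-> //] := z0 (s - t).
    by apply: contra H => /andP[h1 h2]; lra.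
  have tth : t < t + h by rewrite ltrDl.
  have -> : \int[mu]_(s in `[t, t + h]) k0 (s - t) =
      \int[mu]_(s in `[t, t + h]) ((s - t) * (h - (s - t))) ^+ 2.
    apply: eq_Rintegral => s; rewrite inE /= in_itv/= => /andP[s1 s2].
    by rewrite /k0 /m max0_pos// mulr_ge0//; lra.
  rewrite (ftc_R tth (fun x => is_derive_shift_comp t x dP)); last first.
    apply: (@continuous_shift (fun x => (x * (h - x)) ^+ 2)) => x.
    by apply: cvgM; exact: cpoly.
  by rewrite subrr addrAC subrr add0r /P /kap; field.
exists (fun x => kap^-1 * k0 x), (fun x => kap^-1 * k0' x),
  (kap^-1 * ((h ^+ 2) ^+ 2 + 2 * h ^+ 2 * h)).
have ki0 : 0 <= kap^-1 by rewrite invr_ge0 ltW.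
split.
- move=> x; have D := is_deriveM (is_derive_cst kap^-1 x (1 : R)) (dk x).
  by apply: (is_derive_eq D); rewrite ?fctE /GRing.scale /=; ring.
- by move=> x; apply: cvgM; [exact: cvg_cst|exact: ck'].
- have p1 : 0 <= (h ^+ 2) ^+ 2 by exact: sqr_ge0.
  have p2 : 0 <= 2 * h ^+ 2 * h by rewrite !mulr_ge0 ?sqr_ge0// ltW.
  have b1 x : `|k0 x| <= (h ^+ 2) ^+ 2.
    by rewrite /k0 ger0_norm ?sqr_ge0// lerXn2r ?nnegrE ?sqr_ge0.
  have b2 x : `|k0' x| <= 2 * h ^+ 2 * h.
    have [/andP[x0 xh]|/z0[_ ->]] := boolP (0 < x < h); last by rewrite normr0.
    rewrite /k0' normrM ler_pM//; first by rewrite ger0_norm ?mulr_ge0// ler_wpM2l.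
    by rewrite ler_norml; apply/andP; split; lra.
  have sc (a b y : R) : `|y| <= a -> a <= b -> `|kap^-1 * y| <= kap^-1 * b.
    by move=> ya ab; rewrite normrM (ger0_norm ki0) ler_wpM2l// (le_trans ya).
  by move=> x; split; [apply: sc (b1 x) _; rewrite lerDl|apply: sc (b2 x) _; rewrite lerDr].
- by move=> x; rewrite mulr_ge0// sqr_ge0.
- split; first by move=> x /z0[-> ->]; rewrite mulr0.
  move=> t; rewrite RintegralZl//.
    by rewrite intk mulVf// gt_eqF.
  apply: (@intR_itv _ _ t (t + h)).
    move=> s H; have [|-> //] := z0 (s - t).
    by apply: contra H => /andP[h1 h2]; lra.
  apply: continuous_compact_integrable; first exact: segment_compact.
  apply/continuous_subspaceT/continuous_shift => x.
  by apply: derivable_cont; case: (dk x).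
Qed.

End Mollifiers.

(** * Regularised solutions *)

Section Regularised.
Context {R : realType}.
Notation mu := (@lebesgue_measure R).
Variables (nu c K T : R) (a1 a2 F1 F2 dF1 dF2 : R -> R -> R).
Hypotheses (T0 : 0 < T) (S : rsol nu c K T a1 a2 F1 F2 dF1 dF2).
Variables (h : R) (k k' : R -> R) (M : R).
Hypotheses (h0 : 0 < h) (mk : mollifier h k k' M).

Definition reg (F : R -> R -> R) (t : R) : R -> R := Av (fun s => k (s - t)) F.
(** The time derivative of [reg F], by [Av_shift_derive]. *)
Definition dreg (F : R -> R -> R) (t : R) : R -> R := Av (fun s => - k' (s - t)) F.

Let dk (x : R) : is_derive x 1 k (k' x). Proof. by case: mk => + _ _ _ _; exact. Qed.
Let ck' : continuous k'. Proof. by case: mk. Qed.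
Let mk' : measurable_fun setT k'. Proof. exact: continuous_measurable_fun. Qed.
Let kM x : `|k x| <= M. Proof. by case: mk => _ _ /(_ x)[]. Qed.
Let kM' x : `|k' x| <= M. Proof. by case: mk => _ _ /(_ x)[]. Qed.
Let k_ge0 x : 0 <= k x. Proof. by case: mk. Qed.
Let kz x : ~~ (0 < x < h) -> k x = 0 /\ k' x = 0.
Proof. by case: mk => _ _ _ _ [+ _]; exact. Qed.
Let kint t : \int[mu]_s k (s - t) = 1. Proof. by case: mk => _ _ _ _ [_]. Qed.

Lemma bker_reg t : bker (fun s => k (s - t)). Proof. exact: (bker_shift dk kM). Qed.
Lemma bker_dreg t : bker (fun s => - k' (s - t)). Proof. exact: (bker_shift' mk' kM'). Qed.

Lemma reg_h10 t : [/\ h10 (reg F1 t) (reg dF1 t), h10 (reg F2 t) (reg dF2 t),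
  h10 (dreg F1 t) (dreg dF1 t) & h10 (dreg F2 t) (dreg dF2 t)].
Proof.
have [j1 j2] := rs_jF S; have [j3 j4] := rs_jdF S; have ae := rs_h10 S.
have ae1 : {ae mu, forall s, h10 (F1 s) (dF1 s)} by apply: aeS ae => s [].
have ae2 : {ae mu, forall s, h10 (F2 s) (dF2 s)} by apply: aeS ae => s [].
have b1 := bker_reg t; have b2 := bker_dreg t.
by split; apply: (h10_Av T0).
Qed.

Lemma jint_tensor (f g : R -> R) : intR f -> intR g -> jint (fun s r => f s * g r).
Proof.
move=> If Ig; have mf := intR_meas If; have mg := intR_meas Ig.
have m2 : measurable_fun [set: R * R] (fun z => (f z.1 * g z.2)%:E).
  by apply/measurable_EFinP; apply: measurable_funM; exact: measurableT_comp.
apply: (@integrable12ltyP _ _ _ _ _ mu mu _ m2).2 => /=.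
have Ig' : intR (fun r => `|g r|) by exact: integrable_norm.
have If' : intR (fun r => `|f r|) by exact: integrable_norm.
under eq_integral => s _.
  under eq_integral => r _ do rewrite normrM.
  rewrite (intR_Rint (intRZ `|f s| Ig')) RintegralZl// mulrC.
  over.
exact/integrable_lty/(intRZ _ If').
Qed.

(* Integration by parts in time against the absolutely continuous function
   y = y0 - \int_0^s G, done with Fubini. *)
Lemma weak_parts (y G : R -> R) (y0 t : R) : 0 <= t <= T - h -> intR G ->
  (forall s, ~~ (0 < s < T) -> G s = 0) ->
  (forall s, 0 < s < T -> y s - y0 + \int[mu]_(x in `]0, s[) G x = 0) ->
  \int[mu]_s (- k' (s - t) * (chiT T s * y s)) + \int[mu]_s (k (s - t) * G s) = 0.
Proof.
move=> /andP[t0 tT] IG G0 Hy.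
(* Since [0 <= t] and [t + h <= T], the shifted kernel is supported inside (0, T). *)
have kT s : ~~ (0 < s < T) -> k' (s - t) = 0.
  by move=> H; apply: (kz _).2; apply: contra H => /andP[h1 h2]; lra.
have ds (s : R) : is_derive s 1 (fun s => k (s - t)) (k' (s - t)) by exact: is_derive_shift_comp.
(* Writes the primitive of [G] up to [s] as an integral over a fixed domain, so that the two
   integrations can be exchanged. *)
pose ind : R -> R -> R := fun s x => if x <= s then 1 else 0.
have mind : jmeas ind.
  apply: measurable_fun_ifT; [|exact: measurable_cst|exact: measurable_cst].
  exact: measurable_fun_ler.
have ckt : continuous (fun s : R => k' (s - t)) by exact: continuous_shift.
have mkt : measurable_fun setT (fun s : R => k' (s - t)) by exact: continuous_measurable_fun.
have J : jint (fun s x => k' (s - t) * ind s x * G x).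
  apply: (@le_jint _ _ (fun s x => M * (chiT T s * `|G x|))).
  - apply: measurable_funM; last exact: (measurableT_comp (intR_meas IG) (@measurable_snd _ _ R R)).
    by apply: measurable_funM; [exact: (measurableT_comp mkt (@measurable_fst _ _ R R))|exact: mind].
  - move=> s x; rewrite !normrM -!mulrA.
    have [sT|/kT ->] := boolP (0 < s < T); last first.
      by rewrite normr0 mul0r !mulr_ge0 ?chiT_ge0// (le_trans _ (kM 0)).
    rewrite chiTE sT mul1r ler_pM ?mulr_ge0// /ind.
    by case: ifP => _; rewrite ?normr1 ?mul1r ?normr0 ?mul0r.
  - apply: jintZ; apply: jint_tensor; [exact: chiT_int|exact: integrable_norm].
have inner s : 0 < s < T -> \int[mu]_x (k' (s - t) * ind s x * G x) =
    k' (s - t) * (y0 - y s).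
  move=> sT; have -> : y0 - y s = \int[mu]_(x in `]0, s[) G x by have := Hy _ sT; lra.
  rewrite (@Rintegral_itv_bndo_bndc _ _ s G); last by apply: integrableS IG.
  rewrite [X in _ * X]Rintegral_mkcond -RintegralZl//; last first.
    have := (@integrable_mkcond _ _ _ mu `]0, s]%classic (EFin \o G) (measurable_itv _)).1.
    by rewrite restrict_EFin; apply; apply: integrableS IG.
  apply: eq_Rintegral => x _; rewrite -mulrA; congr (_ * _).
  rewrite patchE /ind; have [xs|xs] := boolP (x <= s); case: ifPn.
  - by rewrite mul1r.
  - rewrite notin_setE /= in_itv/= xs andbT => /negP x0; rewrite G0 ?mulr0//.
    by apply: contra x0 => /andP[].
  - by rewrite inE /= in_itv /= (negbTE xs) andbF.
  - by rewrite mul0r.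
have outer x : \int[mu]_s (k' (s - t) * ind s x * G x) = - (k (x - t) * G x).
  have [xT|/G0 ->] := boolP (0 < x < T); last first.
    rewrite mulr0 oppr0 (_ : (fun _ => _) = cst 0) ?Rintegral_cst ?mul0r//.
    by apply/funext => s; rewrite mulr0.
  have Ikx : mu.-integrable `[x, T] (EFin \o (fun s => k' (s - t))).
    apply: continuous_compact_integrable; first exact: segment_compact.
    exact: continuous_subspaceT.
  rewrite [LHS](_ : _ = \int[mu]_s (((fun s => k' (s - t)) \_ `[x, T]) s * G x)); last first.
    apply: eq_Rintegral => s _; congr (_ * _).
    rewrite patchE /ind; have [xs|xs] := boolP (x <= s); case: ifPn.
    + by rewrite mulr1.
    + rewrite notin_setE /= in_itv/= xs/= => /negP sT; rewrite kT ?mul0r//.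
      by apply: contra sT => /andP[_ /ltW].
    + by rewrite inE /= in_itv/= (negbTE xs).
    + by rewrite mulr0.
  rewrite RintegralZr//; last first.
    have := (@integrable_mkcond _ _ _ mu `[x, T]%classic (EFin \o (fun s => k' (s - t))) (measurable_itv _)).1 Ikx.
    by rewrite restrict_EFin.
  have xT' : x < T by case/andP: xT.
  rewrite -Rintegral_mkcond (ftc_R xT' ds ckt).
  (* The boundary term at [T] vanishes because [T - t >= h]. *)
  rewrite (_ : k (T - t) = 0) ?sub0r ?mulNr//.
  by apply: (kz _).1; apply/negP => /andP[h1 h2]; lra.
have e1 s : \int[mu]_x (k' (s - t) * ind s x * G x) =
    k' (s - t) * (chiT T s * (y0 - y s)).
  have [sT|sT] := boolP (0 < s < T); first by rewrite inner// chiTE sT mul1r.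
  rewrite (kT _ sT) mul0r (_ : (fun _ => _) = cst 0) ?Rintegral_cst ?mul0r//.
  by apply/funext => x; rewrite !mul0r.
have Ik' : intR (fun s => k' (s - t)).
  apply: (@intR_itv _ _ 0 T).
    by move=> s H; apply: kT; apply: contra H => /andP[h1 h2]; rewrite !ltW.
  apply: continuous_compact_integrable; first exact: segment_compact.
  exact: continuous_subspaceT.
(* The kernel vanishes at both ends, so [k'] has integral 0 and the initial value [y0] drops out. *)
have k'0 : \int[mu]_s k' (s - t) = 0.
  rewrite (@Rintegral_itv _ _ 0 T); last first.
    by move=> s H; apply: kT; apply: contra H => /andP[h1 h2]; rewrite !ltW.
  rewrite (ftc_R T0 ds ckt).
  have [|-> _] := kz (x := T - t); first by apply/negP => /andP[h1 h2]; lra.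
  have [|-> _] := kz (x := 0 - t); first by apply/negP => /andP[h1 h2]; lra.
  by rewrite subrr.
have [I1 _ E] := fubiniR J.
have I1' : intR (fun s => k' (s - t) * (chiT T s * (y0 - y s))) by exact: eq_intR I1.
have -> : \int[mu]_s (- k' (s - t) * (chiT T s * y s)) =
    \int[mu]_s (k' (s - t) * (chiT T s * (y0 - y s)) - y0 * k' (s - t)).
  apply: eq_Rintegral => s _; have [sT|/kT ->] := boolP (0 < s < T).
    by rewrite chiTE sT !mul1r; ring.
  by rewrite oppr0 !mulr0 !mul0r subr0.
rewrite (RintegralB measurableT I1' (intRZ y0 Ik')).
rewrite RintegralZl// k'0 mulr0 subr0.
have -> : \int[mu]_s (k' (s - t) * (chiT T s * (y0 - y s))) =
    \int[mu]_s \int[mu]_x (k' (s - t) * ind s x * G x).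
  by apply: eq_Rintegral => s _; rewrite e1.
rewrite {}E.
have IkG : intR (fun s => k (s - t) * G s).
  apply: (@le_intR _ _ (fun s => M * `|G s|)).
  - apply: measurable_funM; last exact: intR_meas.
    by have [] := bker_reg t.
  - by move=> s; rewrite normrM ler_wpM2r.
  - by apply: intRZ; exact: integrable_norm.
rewrite -RintegralD//; last first.
  by apply: eq_intR (intRZ (-1) IkG) => x; rewrite outer mulN1r.
rewrite (_ : (fun _ => _) = cst 0) ?Rintegral_cst ?mul0r//.
by apply/funext => x; rewrite outer addNr.
Qed.


(** One statement for both equations of the system: [F'] is the other component, not a derivative,
    and [e] is the coupling, [- K] or [K]. *)
Lemma reg_weak_gen (F dF F' : R -> R -> R) (e y0 t : R) (g dg : R -> R) :
  jl2 T F -> jl2 T dF -> jl2 T F' -> l2 g -> l2 dg -> 0 <= t <= T - h ->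
  (forall s, 0 < s < T -> ip (F s) g - y0 + \int[mu]_(x in `]0, s[)
     (nu * ip (dF x) dg + c * ip (fun r => Xp r * F x r) g
      + e * ip (fun r => Xp r * F' x r) g) = 0) ->
  ip (dreg F t) g + (nu * ip (reg dF t) dg + c * ip (fun r => Xp r * reg F t r) g
      + e * ip (fun r => Xp r * reg F' t r) g) = 0.
Proof.
move=> jF jdF jF' lg ldg tT Hy; have lX := l2M bdmul_Xp lg.
have bk := bker_reg t; have bk' := bker_dreg t.
pose G s := nu * ip (dF s) dg + c * ip (F s) (fun r => Xp r * g r)
  + e * ip (F' s) (fun r => Xp r * g r).
have z f s : jl2 T f -> ~~ (0 < s < T) -> f s = (fun=> 0).
  by move=> [_ f0 _ _] sT; apply/funext => r; rewrite f0.
have [J1 E1] := Av_ip jF bk' lg.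
have [J2 E2] := Av_ip jdF bk ldg.
have [J3 E3] := Av_ip jF bk lX.
have [J4 E4] := Av_ip jF' bk lX.
have int1 f u : jl2 T f -> l2 u -> intR (fun s => ip (f s) u).
  move=> jf lu; have [I1 _] := Av_ip jf bker1 lu.
  by apply: eq_intR I1 => s; rewrite mul1r.
have IG : intR G.
  apply: intRD; last by apply: intRZ; exact: int1.
  by apply: intRD; apply: intRZ; exact: int1.
have G0 s : ~~ (0 < s < T) -> G s = 0.
  by move=> sT; rewrite /G (z dF s)// (z F s)// (z F' s)// !ip0l !mulr0 !addr0.
have Hy' s : 0 < s < T -> ip (F s) g - y0 + \int[mu]_(x in `]0, s[) G x = 0.
  move=> sT; have EG : \int[mu]_(x in `]0, s[) G x = \int[mu]_(x in `]0, s[)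
     (nu * ip (dF x) dg + c * ip (fun r => Xp r * F x r) g
      + e * ip (fun r => Xp r * F' x r) g).
    by apply: eq_Rintegral => x _; rewrite /G !ipMl.
  by rewrite EG; exact: Hy.
have := weak_parts tT IG G0 Hy'.
have -> : \int[mu]_s (- k' (s - t) * (chiT T s * ip (F s) g)) = ip (dreg F t) g.
  rewrite /dreg E1; apply: eq_Rintegral => s _.
  have [sT|sT] := boolP (0 < s < T); first by rewrite chiTE sT mul1r.
  by rewrite (z F s)// ip0l !mulr0.
have -> : \int[mu]_s (k (s - t) * G s) = nu * ip (reg dF t) dg +
    c * ip (fun r => Xp r * reg F t r) g + e * ip (fun r => Xp r * reg F' t r) g; last by [].
rewrite !ipMl /reg E2 E3 E4 -!RintegralZl//.
rewrite -RintegralD//; [|exact: intRZ|exact: intRZ].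
rewrite -RintegralD//; [|by apply: intRD; exact: intRZ|exact: intRZ].
by apply: eq_Rintegral => s _; rewrite /G; ring.
Qed.

Lemma reg_weak (g dg : R -> R) (t : R) : h10 g dg -> 0 <= t <= T - h ->
  ip (dreg F1 t) g + (nu * ip (reg dF1 t) dg + c * ip (fun r => Xp r * reg F1 t r) g
      + (- K) * ip (fun r => Xp r * reg F2 t r) g) = 0 /\
  ip (dreg F2 t) g + (nu * ip (reg dF2 t) dg + c * ip (fun r => Xp r * reg F2 t r) g
      + K * ip (fun r => Xp r * reg F1 t r) g) = 0.
Proof.
move=> hg tT; have [lg ldg] := l2_h10 hg.
have [j1 j2] := rs_jF S; have [j3 j4] := rs_jdF S.
have key s : 0 < s < T -> 0 <= s <= T by case/andP=> /ltW -> /ltW ->.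
split.
- apply: (@reg_weak_gen F1 dF1 F2 (- K) (ip (a1 0) g) t g dg) => // s sT.
  have [+ _] := rs_weak S hg (key _ sT); rewrite -((rs_eq S sT).1) => W.
  rewrite (_ : Rintegral _ _ _ = \int[mu]_(s in `]0, s[)
      (nu * ip (dF1 s) dg + c * ip (fun r => Xp r * F1 s r) g
       - K * ip (fun r => Xp r * F2 s r) g)) ?W//.
  by apply: eq_Rintegral => x _; rewrite mulNr.
- apply: (@reg_weak_gen F2 dF2 F1 K (ip (a2 0) g) t g dg) => // s sT.
  by have [_] := rs_weak S hg (key _ sT); rewrite -((rs_eq S sT).2).
Qed.

End Regularised.

(** * Distance of a regularised solution from the solution *)

Section RegularisedClose.
Context {R : realType}.
Notation mu := (@lebesgue_measure R).
Variables (nu c K T : R) (a1 a2 F1 F2 dF1 dF2 : R -> R -> R).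
Hypotheses (T0 : 0 < T) (S : rsol nu c K T a1 a2 F1 F2 dF1 dF2).
Variables (h : R) (k k' : R -> R) (M : R).
Hypotheses (h0 : 0 < h) (mk : mollifier h k k' M).

Let kz (x : R) : ~~ (0 < x < h) -> k x = 0 /\ k' x = 0.
Proof. by case: mk => _ _ _ _ [+ _]; exact. Qed.

Lemma kshift_int t : intR (fun s => k (s - t)).
Proof.
apply: (@intR_itv _ _ t (t + h)).
  move=> s H; have [|-> //] := kz (x := s - t).
  apply: contra H; rewrite subr_gt0 ltrBlDl => /andP[h1 h2].
  by rewrite !ltW.
apply: continuous_compact_integrable; first exact: segment_compact.
have ck : continuous k by move=> x; apply: derivable_cont; case: mk => /(_ x)[].
by apply: continuous_subspaceT; exact: continuous_shift.
Qed.

Lemma mean_le (D n : R) : n <= (D + n) / 2 -> n <= D.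
Proof. lra. Qed.

Lemma polar_le (D n m q : R) : m <= D -> 0 <= m + 2 * -1 * q + (-1) ^+ 2 * n ->
  q <= (D + n) / 2.
Proof. by rewrite sqrrN expr1n; lra. Qed.

(** A form of Jensen's inequality. The squared error [n] is the average, against the kernel, of the
    pairing of [a(s) - a(t)] with the error itself; each pairing is at most [(D + n) / 2], hence
    [n <= (D + n) / 2]. *)
Lemma reg_close (t D : R) : 0 <= t <= T - h ->
  (forall s, t < s < t + h ->
    N2 (fun r => a1 s r - a1 t r) (fun r => a2 s r - a2 t r) <= D) ->
  N2 (fun r => reg k F1 t r - a1 t r) (fun r => reg k F2 t r - a2 t r) <= D.
Proof.
have kint x : \int[mu]_s k (s - x) = 1 by case: mk => _ _ _ _ [_].
have k_ge0 x : 0 <= k x by case: mk.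
move=> /andP[t0 tT] HD; have [j1 j2] := rs_jF S.
have bk := bker_reg mk t; have ttT : 0 <= t <= T by rewrite t0/= (le_trans tT)// gerBl ltW.
have [l1 l2'] := rs_l2 S ttT.
set e1 := fun r => reg k F1 t r - a1 t r; set e2 := fun r => reg k F2 t r - a2 t r.
have lr1 : l2 (reg k F1 t) by exact: (Av_l2 T0 j1 bk).
have lr2 : l2 (reg k F2 t) by exact: (Av_l2 T0 j2 bk).
have le1 : l2 e1 by exact: l2B.
have le2 : l2 e2 by exact: l2B.
have [J1 E1] := Av_ip j1 bk le1.
have [J2 E2] := Av_ip j2 bk le2.
have Ik := kshift_int t.
set n := N2 e1 e2.
have En : n = \int[mu]_s (k (s - t) * ip (F1 s) e1 + k (s - t) * ip (F2 s) e2
    - (ip (a1 t) e1 + ip (a2 t) e2) * k (s - t)).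
  rewrite RintegralB//; [|exact: intRD|exact: intRZ].
  rewrite RintegralD// RintegralZl// kint mulr1 -E1 -E2.
  rewrite /n /N2 {1}/e1 {2}/e2 !ipBl//; rewrite /reg; ring.
suff : n <= (D + n) / 2 by exact: mean_le.
have ER : \int[mu]_s ((D + n) / 2 * k (s - t)) = (D + n) / 2.
  by rewrite RintegralZl// kint mulr1.
apply: (@le_trans _ _ (\int[mu]_s ((D + n) / 2 * k (s - t)))); last by rewrite ER.
rewrite {1}En; apply: le_Rintegral => //.
- by apply: intRB; [exact: intRD|exact: intRZ].
- exact: intRZ.
move=> s _; have [/andP[s1 s2]|H] := boolP (0 < s - t < h); last first.
  by rewrite (kz H).1 !(mul0r, mulr0) addr0 subr0.
rewrite subr_gt0 in s1; rewrite ltrBlDl in s2.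
have sT : 0 < s < T.
  by rewrite (le_lt_trans t0 s1) (lt_le_trans s2)// -lerBrDr.
have sT' : 0 <= s <= T by case/andP: sT => /ltW -> /ltW ->.
have [l3 l4] := rs_l2 S sT'.
rewrite (rs_eq S sT).1 (rs_eq S sT).2.
have -> : k (s - t) * ip (a1 s) e1 + k (s - t) * ip (a2 s) e2 -
  (ip (a1 t) e1 + ip (a2 t) e2) * k (s - t) =
  k (s - t) * Q2 (fun r => a1 s r - a1 t r) (fun r => a2 s r - a2 t r) e1 e2.
  by rewrite /Q2 !ipBl//; ring.
rewrite [leRHS]mulrC; apply: ler_wpM2l => //.
have lb1 := l2B l3 l1; have lb2 := l2B l4 l2'.
have P := N2_ge0 (fun r => (a1 s r - a1 t r) + (-1) * e1 r) (fun r => (a2 s r - a2 t r) + (-1) * e2 r).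
rewrite N2_expand// in P.
apply: (@polar_le D n _ _ _ P).
by apply: HD; rewrite s1 s2.
Qed.

End RegularisedClose.

(** * The scaled quadratic form *)

Section Pointwise.
Context {R : realType}.
Implicit Types x y : R.

Lemma young (k a b x y : R) : 0 < a \/ 0 < b -> k ^+ 2 <= 4 * a * b ->
  k * (x * y) <= a * x ^+ 2 + b * y ^+ 2.
Proof.
move=> ab kab; case: ab => [a0|b0].
  rewrite -(ler_pM2l (mulr_gt0 (ltr0n R 4) a0)).
  by have := sqr_ge0 (2 * a * x - k * y); have := sqr_ge0 y; nra.
rewrite -(ler_pM2l (mulr_gt0 (ltr0n R 4) b0)).
by have := sqr_ge0 (2 * b * y - k * x); have := sqr_ge0 x; nra.
Qed.

Lemma sqr_le_abs x y : - y <= x -> x <= y -> x ^+ 2 <= y ^+ 2.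
Proof. by move=> h1 h2; nra. Qed.

(* s = 1 / (1 + tau), th = 1 - s, and g, qt are the functions [gw], [qw] below; the
   variables of the quadratic form are u, V = e r u' and D = e^2 r^2 u''. *)
Record scaled (s g qt e n sg d th : R) : Prop := Scaled {
  _ : 0 < d; _ : d <= 1 / 1000; _ : 0 <= s; _ : s <= 1; _ : 0 <= g; _ : g <= d / 100;
  _ : 0 <= qt; _ : 0 <= e; _ : e + e * qt <= d / 100; _ : 0 <= n; _ : sg ^+ 2 = 1;
  _ : 0 <= th; _ : th <= 1; _ : 1 / 2 <= s ^+ 2 + th ^+ 2 }.

Section Scaled.
Variables s g qt e n sg d th : R.
Hypothesis H : scaled s g qt e n sg d th.

Lemma scaled_facts :
  [/\ 0 <= e * qt, forall x, (sg * x) ^+ 2 = x ^+ 2, 0 <= th ^+ 2 /\ th ^+ 2 <= th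
    & 0 <= s ^+ 2 /\ s ^+ 2 <= 1].
Proof.
have [d0 d1 s0 s1 g0 gd qt0 e0 e1 n0 sg1 th0 th1 sth] := H; split.
- by rewrite mulr_ge0.
- by move=> x; rewrite exprMn sg1 mul1r.
- by rewrite sqr_ge0 expr2 ler_piMl.
- by rewrite sqr_ge0 expr_le1.
Qed.

(** This and the next seven bounds absorb the indefinite products of [scaled_dissipation]. The
    coefficients on the right are shares of the diagonal terms in [u], [V] and [D]; [scaled_coef_u],
    [scaled_coef_V] and [scaled_coef_D] check that the shares do not exceed what is available. *)
Lemma scaled_cross1 (x y : R) :
  sg * d * (2 * th * s ^+ 2 + g * th ^+ 2) * (x * y) <=
  d * th ^+ 2 / 16 * x ^+ 2 + 1 / 8 * y ^+ 2.
Proof.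
have [_ sg_sq [t20 t21] [_ s21]] := scaled_facts.
have [d0 d1 s0 _ g0 gd _ _ _ _ _ th0 _ _] := H.
apply: young; first by right; lra.
rewrite -mulrA sg_sq.
apply: (@le_trans _ _ ((3 * d * th) ^+ 2)).
  apply: sqr_le_abs.
    have : 0 <= d * (2 * th * s ^+ 2 + g * th ^+ 2).
      by rewrite !(mulr_ge0, addr_ge0)// ltW.
    have : 0 <= 3 * d * th by rewrite !mulr_ge0// ltW.
    lra.
  have : 2 * th * s ^+ 2 + g * th ^+ 2 <= 3 * th.
    have h1 : th * s ^+ 2 <= th by rewrite ler_piMr.
    have h2 : g * th ^+ 2 <= th ^+ 2 by rewrite ler_piMl//; lra.
    lra.
  by move=> /(ler_wpM2l (ltW d0)); lra.
have : 0 <= d * th ^+ 2 by rewrite mulr_ge0// ltW.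
rewrite !exprMn; have : d * d * th ^+ 2 <= d * (1 / 1000) * th ^+ 2.
  by rewrite ler_wpM2r// ler_wpM2l// ltW.
lra.
Qed.

Lemma scaled_cross2 (x y : R) :
  - (2 * e * (2 * th * s - 4 * qt * (1 + s))) * (x * y) <=
  d / 16 * x ^+ 2 + 1 / 8 * y ^+ 2.
Proof.
have [eqt0 _ _ _] := scaled_facts.
have [d0 d1 s0 s1 _ _ _ e0 e1 _ _ th0 th1 _] := H.
apply: young; first by left; lra.
apply: (@le_trans _ _ ((16 * (d / 100)) ^+ 2)).
  have h1 : 0 <= e * (th * s) by rewrite !mulr_ge0.
  have h2 : e * (th * s) <= e by rewrite ler_piMr// mulr_ile1.
  have h3 : 0 <= e * qt * s by rewrite mulr_ge0.
  have h4 : e * qt * s <= e * qt by rewrite ler_piMr.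
  by apply: sqr_le_abs; lra.
rewrite expr2; have : d * d <= d * (1 / 1000) by rewrite ler_wpM2l// ltW.
lra.
Qed.

Lemma scaled_cross3 (x y : R) :
  - (2 * e * d * th * (2 * th - 4 * qt)) * (x * y) <=
  1 / 8 * x ^+ 2 + d * th / 8 * y ^+ 2.
Proof.
have [eqt0 _ _ _] := scaled_facts.
have [d0 d1 _ _ _ _ _ e0 e1 _ _ th0 th1 _] := H.
apply: young; first by left; lra.
apply: (@le_trans _ _ ((8 * (d / 100) * (d * th)) ^+ 2)).
  have dth : 0 <= d * th by rewrite mulr_ge0// ltW.
  have h1 : 0 <= e * th by rewrite mulr_ge0.
  have h2 : e * th <= e by rewrite ler_piMr.
  have e3 : - (8 * (d / 100)) <= 2 * (e * (2 * th - 4 * qt)) by lra.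
  have e4 : 2 * (e * (2 * th - 4 * qt)) <= 8 * (d / 100) by lra.
  have := ler_wpM2r dth e3; have := ler_wpM2r dth e4 => h5 h6.
  by apply: sqr_le_abs; lra.
have h7 : d * th * (d * th) <= d * th by rewrite ler_piMr ?mulr_ge0 ?mulr_ile1//; lra.
have h8 : d * d * (d * th * (d * th)) <= 1 * (d * th * (d * th)).
  rewrite ler_wpM2r//; first by rewrite !mulr_ge0// ltW.
  by rewrite mulr_ile1//; lra.
rewrite [leLHS](_ : _ = (64 / 10000) * (d * d * (d * th * (d * th)))); last by field.
have dth : 0 <= d * th by rewrite mulr_ge0// ltW.
lra.
Qed.

(** There is no upper bound on [n], which grows with [k^2], so products with the factor [n] are
    charged only to diagonal terms that carry [n] as well; the same is done in [scaled_cross7]. *)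
Lemma scaled_cross4 (x y : R) :
  4 * n * d * e * th * (x * y) <= n / 2 * x ^+ 2 + n * d * th * y ^+ 2.
Proof.
have [eqt0 _ _ _] := scaled_facts.
have [d0 d1 _ _ _ _ _ e0 e1 n0 _ th0 th1 _] := H.
have [->|nn] := eqVneq n 0; first by rewrite !(mul0r, mulr0) addr0.
have np : 0 < n by rewrite lt_neqAle eq_sym nn.
apply: young; first by left; lra.
have ee : e <= 1 by lra.
have : d * th * (8 * d * e * e * th) <= d * th * 1.
  rewrite ler_wpM2l//; first by rewrite mulr_ge0// ltW.
  have h1 : e * e <= 1 by rewrite mulr_ile1.
  have h2 : e * e * th <= 1 by rewrite mulr_ile1// mulr_ge0.
  have h3 : 8 * d * (e * e * th) <= 1 by rewrite mulr_ile1// ?mulr_ge0//; lra.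
  by move: h3; rewrite !mulrA.
move=> /(ler_wpM2l (mulr_ge0 n0 n0)).
rewrite [X in X <= _ -> _](_ : _ = (4 * n * d * e * th) ^+ 2 / 2); last by field.
lra.
Qed.

Lemma scaled_cross5 (x y : R) :
  - (4 * sg * d * th) * (x * y) <= 1 / 8 * x ^+ 2 + d * th ^+ 2 / 16 * 8 * y ^+ 2.
Proof.
have [_ sg_sq [t20 _] _] := scaled_facts.
have [d0 d1 _ _ _ _ _ _ _ _ _ _ _ _] := H.
apply: young; first by left; lra.
rewrite [leLHS](_ : _ = 16 * (sg * (d * th)) ^+ 2); last by ring.
rewrite sg_sq; have : d * d * th ^+ 2 <= d * (1 / 1000) * th ^+ 2.
  by rewrite ler_wpM2r// ler_wpM2l// ltW.
rewrite exprMn; have : 0 <= d * th ^+ 2 by rewrite mulr_ge0// ltW.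
lra.
Qed.

Lemma scaled_cross6 (x y : R) :
  - (sg * (2 * d * th ^+ 2)) * (x * y) <= d * th / 8 * x ^+ 2 + 1 / 8 * y ^+ 2.
Proof.
have [_ sg_sq [_ t21] _] := scaled_facts.
have [d0 d1 _ _ _ _ _ _ _ _ _ th0 th1 _] := H.
apply: young; first by right; lra.
rewrite sqrrN sg_sq.
have h1 : (d * th) * (d * th) <= (d * th) * (1 / 1000 * 1).
  rewrite ler_wpM2l ?mulr_ge0 ?ler_pM//; lra.
have h2 : (d * th) * (d * th) * th ^+ 2 <= (d * th) * (d * th) * 1.
  by rewrite ler_wpM2l ?mulr_ge0// ?(le_trans t21)// ltW.
rewrite [leLHS](_ : _ = 4 * ((d * th) * (d * th) * th ^+ 2)); last by ring.
have : 0 <= d * th by rewrite mulr_ge0// ltW.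
lra.
Qed.

Lemma scaled_cross7 (x y : R) :
  sg * (2 * n * d * th ^+ 2) * (x * y) <= n / 2 * x ^+ 2 + n * d * th * y ^+ 2.
Proof.
have [_ sg_sq [t20 t21] _] := scaled_facts.
have [d0 d1 _ _ _ _ _ _ _ n0 _ th0 th1 _] := H.
have [->|nn] := eqVneq n 0; first by rewrite !(mul0r, mulr0) addr0.
have np : 0 < n by rewrite lt_neqAle eq_sym nn.
apply: young; first by left; lra.
rewrite sg_sq.
have : d * th * (2 * d * th ^+ 2 * th) <= d * th * 1.
  rewrite ler_wpM2l//; first by rewrite mulr_ge0// ltW.
  have h2 : th ^+ 2 * th <= 1 by rewrite mulr_ile1// (le_trans t21).
  have h3 : 2 * d * (th ^+ 2 * th) <= 1 by rewrite mulr_ile1// ?mulr_ge0//; lra.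
  by move: h3; rewrite !mulrA.
move=> /(ler_wpM2l (mulr_ge0 n0 n0)).
rewrite [X in X <= _ -> _](_ : _ = (2 * n * d * th ^+ 2) ^+ 2 / 2); last by field.
lra.
Qed.

(** Both shares degenerate as [th] tends to 0, like [th^2] and [th]. They suffice because the
    squared coefficient is of order [th^4], and [th^4 <= th^3]. *)
Lemma scaled_cross8 (x y : R) :
  - (sg * (d * e * th ^+ 2 * (1 - 4 * s - 4 * qt))) * (x * y) <=
  d * th ^+ 2 / 16 * x ^+ 2 + d * th / 8 * y ^+ 2.
Proof.
have [eqt0 sg_sq [t20 t21] _] := scaled_facts.
have [d0 d1 s0 s1 _ _ _ e0 e1 _ _ th0 _ _] := H.
have [->|tn] := eqVneq th 0.
  by rewrite expr0n/= !(mulr0, mul0r) addr0 oppr0 mul0r.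
have tp : 0 < th by rewrite lt_neqAle eq_sym tn.
apply: young; first by right; rewrite divr_gt0// mulr_gt0.
rewrite sqrrN sg_sq.
apply: (@le_trans _ _ ((4 * (d / 100) * (d * th ^+ 2)) ^+ 2)).
  have dth : 0 <= d * th ^+ 2 by rewrite mulr_ge0// ltW.
  have h3 : 0 <= e * s by rewrite mulr_ge0.
  have h4 : e * s <= e by rewrite ler_piMr.
  have e3 : - (4 * (d / 100)) <= e * (1 - 4 * s - 4 * qt) by lra.
  have e4 : e * (1 - 4 * s - 4 * qt) <= 4 * (d / 100) by lra.
  have := ler_wpM2r dth e3; have := ler_wpM2r dth e4 => h5 h6.
  by apply: sqr_le_abs; lra.
have h1 : th ^+ 2 * th ^+ 2 <= th ^+ 2 * th by rewrite ler_wpM2l.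
have h2 : d * d * (d * d) <= d * d * (1 / 1000 * (1 / 1000)).
  by rewrite ler_wpM2l ?mulr_ge0 ?ler_pM// ltW.
have := ler_pM _ _ h2 h1.
rewrite !mulr_ge0// ?(ltW d0)// => /(_ isT isT).
rewrite [X in X <= _ -> _](_ : _ = (4 * (d / 100) * (d * th ^+ 2)) ^+ 2 * (100 ^+ 2 / 16)); last by field.
have : 0 <= d * d * (th ^+ 2 * th) by rewrite !mulr_ge0// ltW.
lra.
Qed.

(** As [d <= 1], the term [s^2] and what the shares leave of [2 d th^2] give at least
    [d (s^2 + th^2) >= d / 2]. The losses are [d / 50] from the growth of the weight and [d / 16]
    from [scaled_cross2]; the terms in [n] have the good sign. *)
Lemma scaled_coef_u :
  g * (1 + s) - s ^+ 2 - 2 * n * (1 + s) - 2 * d * th ^+ 2 + d * th ^+ 2 / 16 + d / 16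
   + n / 2 + d * th ^+ 2 / 16 * 8 + n / 2 + d * th ^+ 2 / 16 <= - (d / 4).
Proof.
have [_ _ [t20 _] [s20 _]] := scaled_facts.
have [d0 d1 s0 s1 g0 gd _ _ _ n0 _ _ _ sth] := H.
have h1 : g * (1 + s) <= d / 100 * 2 by rewrite ler_pM//; lra.
have h2 : 0 <= n * s by rewrite mulr_ge0.
have h3 : d * s ^+ 2 <= s ^+ 2 by rewrite ler_piMl//; lra.
have h4 : d * (1 / 2) <= d * (s ^+ 2 + th ^+ 2).
  by rewrite ler_wpM2l ?(ltW d0).
have h5 : 0 <= d * th ^+ 2 by rewrite mulr_ge0// ltW.
lra.
Qed.

Lemma scaled_coef_V :
  d * (s ^+ 2 + g * th) - 2 * (1 + s) - 2 * n * d * th + 1 / 8 + 1 / 8 + 1 / 8 + n * d * th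
   + 1 / 8 + 1 / 8 + n * d * th <= 0.
Proof.
have [_ _ _ [_ s21]] := scaled_facts.
have [_ d1 s0 _ g0 gd _ _ _ _ _ th0 th1 _] := H.
have h1 : g * th <= 1 * 1 by rewrite ler_pM//; lra.
have h2 : d * (s ^+ 2 + g * th) <= 1 * 2 by rewrite ler_pM// ?addr_ge0 ?mulr_ge0//; lra.
have h3 : d * (s ^+ 2 + g * th) <= 1 / 1000 * 2 by rewrite ler_pM// ?addr_ge0 ?mulr_ge0//; lra.
lra.
Qed.

Lemma scaled_coef_D :
  - (2 * d * th) + d * th / 8 + d * th / 8 + d * th / 8 <= 0.
Proof.
have [d0 _ _ _ _ _ _ _ _ _ _ th0 _ _] := H.
have : 0 <= d * th by rewrite mulr_ge0// ltW.
lra.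
Qed.

(** The left side is the integrand of [dE/dt], after integration by parts and division by
    [Phi m / r^2]. The last term, [- 2 d th^2 |u|^2], is the gain from the shear. *)
Lemma scaled_dissipation (u1 u2 V1 V2 D1 D2 : R) :
  (g * (1 + s) - s ^+ 2) * (u1 ^+ 2 + u2 ^+ 2) + d * (s ^+ 2 + g * th) * (V1 ^+ 2 + V2 ^+ 2)
  - sg * d * (2 * th * s ^+ 2 + g * th ^+ 2) * (u1 * V2 - u2 * V1)
  - 2 * (1 + s) * (V1 ^+ 2 + V2 ^+ 2)
  - 2 * e * (2 * th * s - 4 * qt * (1 + s)) * (u1 * V1 + u2 * V2)
  - 2 * n * (1 + s) * (u1 ^+ 2 + u2 ^+ 2) - 2 * d * th * (D1 ^+ 2 + D2 ^+ 2)
  - 2 * e * d * th * (2 * th - 4 * qt) * (V1 * D1 + V2 * D2)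
  - 2 * n * d * th * (V1 ^+ 2 + V2 ^+ 2) + 4 * n * d * e * th * (u1 * V1 + u2 * V2)
  - 4 * sg * d * th * (V1 * u2 - V2 * u1)
  - sg * (2 * d * th ^+ 2 * (D1 * V2 - D2 * V1) - 2 * n * d * th ^+ 2 * (u1 * V2 - u2 * V1)
     + d * e * th ^+ 2 * (1 - 4 * s - 4 * qt) * (u2 * D1 - u1 * D2))
  - 2 * d * th ^+ 2 * (u1 ^+ 2 + u2 ^+ 2)
  <= - (d / 4) * (u1 ^+ 2 + u2 ^+ 2).
Proof.
have := ler_wpM2r (sqr_ge0 u1) scaled_coef_u; have := ler_wpM2r (sqr_ge0 u2) scaled_coef_u.
have := ler_wpM2r (sqr_ge0 V1) scaled_coef_V; have := ler_wpM2r (sqr_ge0 V2) scaled_coef_V.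
have := ler_wpM2r (sqr_ge0 D1) scaled_coef_D; have := ler_wpM2r (sqr_ge0 D2) scaled_coef_D.
have := scaled_cross1 u1 (- V2); have := scaled_cross1 u2 V1.
have := scaled_cross2 u1 V1; have := scaled_cross2 u2 V2.
have := scaled_cross3 V1 D1; have := scaled_cross3 V2 D2.
have := scaled_cross4 u1 V1; have := scaled_cross4 u2 V2.
have := scaled_cross5 V1 u2; have := scaled_cross5 V2 (- u1).
have := scaled_cross6 D1 V2; have := scaled_cross6 D2 (- V1).
have := scaled_cross7 u1 V2; have := scaled_cross7 u2 (- V1).
have := scaled_cross8 u2 D1; have := scaled_cross8 u1 (- D2).
rewrite !mul0r !sqrrN.
lra.
Qed.

End Scaled.

(** The cross term carries [th^2] and the gradient term [th]; for small [d], Young's inequality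
    therefore costs at most half of [|u|^2], uniformly down to [th = 0]. *)
Lemma scaled_positivity (u1 u2 V1 V2 s sg d : R) : 0 < d -> d <= 1 / 1000 ->
  0 <= s -> s <= 1 -> sg ^+ 2 = 1 ->
  1 / 2 * (u1 ^+ 2 + u2 ^+ 2) <= (1 + s) * (u1 ^+ 2 + u2 ^+ 2)
    + d * (1 - s) * (V1 ^+ 2 + V2 ^+ 2) - sg * d * (1 - s) ^+ 2 * (u1 * V2 - u2 * V1).
Proof.
move=> d0 d1 s0 s1 sg1; have [th thE] : exists th, th = 1 - s by exists (1 - s).
rewrite -thE; have th0 : 0 <= th by lra.
have th1 : th <= 1 by lra.
have key x y : sg * d * th ^+ 2 * (x * y) <= 1 / 2 * x ^+ 2 + d * th * y ^+ 2.
  apply: young; first by left; lra.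
  rewrite -mulrA exprMn sg1 mul1r.
  have h1 : d * th * (d * th * th ^+ 2) <= d * th * 2.
    rewrite ler_wpM2l ?mulr_ge0 ?(ltW d0)//.
    have h2 : d * th <= 1 by rewrite mulr_ile1//; lra.
    have h3 : d * th * th ^+ 2 <= 1.
      by rewrite mulr_ile1 ?mulr_ge0 ?sqr_ge0 ?(ltW d0)// expr_le1.
    lra.
  rewrite [leLHS](_ : _ = d * th * (d * th * th ^+ 2)); last by ring.
  lra.
have := key u1 V2; have := key u2 (- V1); rewrite sqrrN.
have : 0 <= s * (u1 ^+ 2 + u2 ^+ 2) by rewrite mulr_ge0// addr_ge0 ?sqr_ge0.
lra.
Qed.

End Pointwise.

(** * Energy dissipation at a fixed time *)

Section StaticDissipation.
Context {R : realType}.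
Implicit Types rho eta : R -> R.

Definition Xp' (r : R) := - 2 * (r ^+ 3)^-1.

Record mulw (rho rho' : R -> R) : Prop := MulW {
  mw_rsm : rsm rho; mw_bd : bdmul rho; mw_bd' : bdmul rho';
  mw_derive : forall r : R, 1 < r -> is_derive r 1 rho (rho' r) }.

Lemma mulwM rho rho' eta eta' : mulw rho rho' -> mulw eta eta' ->
  mulw (fun r => rho r * eta r) (fun r => rho' r * eta r + rho r * eta' r).
Proof.
move=> [r1 b1 b1' d1] [r2 b2 b2' d2]; split.
- exact: rsm_mul.
- exact: bdmulM.
- by apply: bdmulD; exact: bdmulM.
- move=> r rr; have D := is_deriveM (d1 r rr) (d2 r rr).
  by apply: (is_derive_eq D); rewrite /GRing.scale /=; ring.
Qed.

Lemma mulw_h10 rho rho' u v : mulw rho rho' -> h10 u v ->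
  h10 (fun r => rho r * u r) (fun r => rho' r * u r + rho r * v r).
Proof. by move=> [? ? ? ?]; exact: h10M. Qed.

(** Time is frozen: [u] stands for the solution, [v] for [d_r u], [z] for [d_t u] and [y] for
    [d_r d_t u]. Among the weights a prime marks the radial derivative and a final [t] the time
    derivative. *)
Variables (nu c K sg : R) (u1 u2 v1 v2 z1 z2 y1 y2 : R -> R).
Hypotheses (nu0 : 0 < nu).
Hypotheses (hu1 : h10 u1 v1) (hu2 : h10 u2 v2) (hz1 : h10 z1 y1) (hz2 : h10 z2 y2).
Hypothesis (weak : forall g dg, h10 g dg ->
  ip z1 g + (nu * ip v1 dg + c * ip (fun r => Xp r * u1 r) g
      + (- K) * ip (fun r => Xp r * u2 r) g) = 0 /\
  ip z2 g + (nu * ip v2 dg + c * ip (fun r => Xp r * u2 r) g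
      + K * ip (fun r => Xp r * u1 r) g) = 0).
Variables (A A' At al al' alt be be' bet kap : R -> R).
Hypotheses (wA : mulw A A') (wal : mulw al al') (wbe : mulw be be') (wX : mulw (@Xp R) Xp').
Hypotheses (bAt : bdmul At) (balt : bdmul alt) (bbet : bdmul bet) (bkap : bdmul kap).
Hypothesis pointwise : forall r p1 p2 q1 q2 d1 d2 : R, 1 < r ->
  At r * (p1 ^+ 2 + p2 ^+ 2) + alt r * (q1 ^+ 2 + q2 ^+ 2)
  - sg * bet r * (p1 * q2 - p2 * q1) - 2 * nu * A r * (q1 ^+ 2 + q2 ^+ 2)
  - 2 * nu * A' r * (p1 * q1 + p2 * q2) - 2 * c * Xp r * A r * (p1 ^+ 2 + p2 ^+ 2)
  - 2 * nu * al r * (d1 ^+ 2 + d2 ^+ 2) - 2 * nu * al' r * (q1 * d1 + q2 * d2)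
  - 2 * c * al r * Xp r * (q1 ^+ 2 + q2 ^+ 2) - 2 * c * al r * Xp' r * (p1 * q1 + p2 * q2)
  + 2 * K * al r * Xp' r * (q1 * p2 - q2 * p1)
  - sg * (2 * be r * nu * (d1 * q2 - d2 * q1) - 2 * be r * c * Xp r * (p1 * q2 - p2 * q1)
      + nu * be' r * (p2 * d1 - p1 * d2))
  + sg * K * be r * Xp' r * (p1 ^+ 2 + p2 ^+ 2) <= - kap r * (p1 ^+ 2 + p2 ^+ 2).

(** [dE/dt] by the product rule: in each group of three the derivative falls on the weight, on the
    first factor and on the second. *)
Definition energy_rate :=
  (ip (fun r => At r * u1 r) u1 + ip (fun r => A r * z1 r) u1 + ip (fun r => A r * u1 r) z1)
  + (ip (fun r => At r * u2 r) u2 + ip (fun r => A r * z2 r) u2 + ip (fun r => A r * u2 r) z2)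
  + (ip (fun r => alt r * v1 r) v1 + ip (fun r => al r * y1 r) v1 + ip (fun r => al r * v1 r) y1)
  + (ip (fun r => alt r * v2 r) v2 + ip (fun r => al r * y2 r) v2 + ip (fun r => al r * v2 r) y2)
  - sg * ((ip (fun r => bet r * u1 r) v2 + ip (fun r => be r * z1 r) v2 + ip (fun r => be r * u1 r) y2)
    - (ip (fun r => bet r * u2 r) v1 + ip (fun r => be r * z2 r) v1 + ip (fun r => be r * u2 r) y1)).

(** The second radial derivatives, defined as what the equation says they are:
    [nu d_r^2 u = d_t u + (c + i K) u / r^2]. *)
Let d1 r := nu^-1 * (z1 r + c * (Xp r * u1 r) - K * (Xp r * u2 r)).
Let d2 r := nu^-1 * (z2 r + c * (Xp r * u2 r) + K * (Xp r * u1 r)).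

Lemma second_derivative g dg : h10 g dg -> ip v1 dg + ip d1 g = 0 /\ ip v2 dg + ip d2 g = 0.
Proof.
move=> hg; have [w1 w2] := weak hg.
have [lu1 _] := l2_h10 hu1; have [lu2 _] := l2_h10 hu2.
have [lz1 _] := l2_h10 hz1; have [lz2 _] := l2_h10 hz2; have [lg _] := l2_h10 hg.
have lX1 := l2M (@bdmul_Xp R) lu1; have lX2 := l2M (@bdmul_Xp R) lu2.
have lc1 := l2Z c lX1; have lc2 := l2Z c lX2; have lK1 := l2Z K lX1; have lK2 := l2Z K lX2.
have s1 := l2D lz1 lc1; have s2 := l2D lz2 lc2.
have q1 := l2B s1 lK2; have q2 := l2D s2 lK1.
have nn : nu != 0 by rewrite gt_eqF.
rewrite /d1 /d2 !ipZl// ipBl// ipDl// (ipDl s2)// (ipDl lz2)// !ipZl//.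
split; apply: (mulfI nn); rewrite mulr0 mulrDr mulrA mulfV// mul1r; [rewrite -w1|rewrite -w2]; ring.
Qed.

Ltac l2_tac := first [ assumption | apply: l2D; l2_tac | apply: l2M; [assumption | l2_tac] ].

Lemma energy_rate_le :
  energy_rate <= - (ip (fun r => kap r * u1 r) u1 + ip (fun r => kap r * u2 r) u2).
Proof.
have [lu1 lv1] := l2_h10 hu1; have [lu2 lv2] := l2_h10 hu2.
have [lz1 ly1] := l2_h10 hz1; have [lz2 ly2] := l2_h10 hz2.
have bX := @bdmul_Xp R.
have ld1 : l2 d1.
  by apply: l2Z; apply: l2B; [apply: l2D => //|]; apply: l2Z; exact: l2M.
have ld2 : l2 d2.
  by apply: l2Z; apply: l2D; [apply: l2D => //|]; apply: l2Z; exact: l2M.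
have [_ bA bA' _] := wA; have [_ bal bal' _] := wal; have [_ bbe bbe' _] := wbe.
have walX := mulwM wal wX; have wbeX := mulwM wbe wX.
have [_ balX balX' _] := walX; have [_ bbeX bbeX' _] := wbeX.
(* The equation is tested with [A u], [al z] and [al Xp u]; the remaining identities are
   integrations by parts with [be z] and [be Xp u]. Testing with [al z] and [be z] is where the time
   derivative has to lie in H^1_0. *)
have [n11 _] := second_derivative (mulw_h10 wA hu1).
have [_ n12] := second_derivative (mulw_h10 wA hu2).
have [n21 _] := second_derivative (mulw_h10 wal hz1).
have [_ n22] := second_derivative (mulw_h10 wal hz2).
have [n41 n52] := second_derivative (mulw_h10 walX hu1).
have [n51 n42] := second_derivative (mulw_h10 walX hu2).
have n31 := h10_ibp hu1 (mulw_h10 wbe hz2).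
have n32 := h10_ibp hu2 (mulw_h10 wbe hz1).
have n61 := h10_ibp hu1 (mulw_h10 wbeX hu1).
have n62 := h10_ibp hu2 (mulw_h10 wbeX hu2).
(* Rate and dissipation, plus multiples of the null integrals n11, ..., n62: the sum is
   unchanged and the integrand becomes the form bounded in [pointwise]. *)
pose L := [::
  (1, fun r => At r * u1 r, u1); (1, fun r => A r * z1 r, u1); (1, fun r => A r * u1 r, z1);
  (1, fun r => At r * u2 r, u2); (1, fun r => A r * z2 r, u2); (1, fun r => A r * u2 r, z2);
  (1, fun r => alt r * v1 r, v1); (1, fun r => al r * y1 r, v1); (1, fun r => al r * v1 r, y1);
  (1, fun r => alt r * v2 r, v2); (1, fun r => al r * y2 r, v2); (1, fun r => al r * v2 r, y2);
  (- sg, fun r => bet r * u1 r, v2); (- sg, fun r => be r * z1 r, v2); (- sg, fun r => be r * u1 r, y2);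
  (sg, fun r => bet r * u2 r, v1); (sg, fun r => be r * z2 r, v1); (sg, fun r => be r * u2 r, y1);
  (1, fun r => kap r * u1 r, u1); (1, fun r => kap r * u2 r, u2);
  (- (2 * nu), v1, fun r => A' r * u1 r + A r * v1 r); (- (2 * nu), d1, fun r => A r * u1 r);
  (- (2 * nu), v2, fun r => A' r * u2 r + A r * v2 r); (- (2 * nu), d2, fun r => A r * u2 r);
  (- 2, v1, fun r => al' r * z1 r + al r * y1 r); (- 2, d1, fun r => al r * z1 r);
  (- 2, v2, fun r => al' r * z2 r + al r * y2 r); (- 2, d2, fun r => al r * z2 r);
  (- (2 * c), v1, fun r => (al' r * Xp r + al r * Xp' r) * u1 r + al r * Xp r * v1 r);
  (- (2 * c), d1, fun r => al r * Xp r * u1 r);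
  (- (2 * c), v2, fun r => (al' r * Xp r + al r * Xp' r) * u2 r + al r * Xp r * v2 r);
  (- (2 * c), d2, fun r => al r * Xp r * u2 r);
  (2 * K, v1, fun r => (al' r * Xp r + al r * Xp' r) * u2 r + al r * Xp r * v2 r);
  (2 * K, d1, fun r => al r * Xp r * u2 r);
  (- (2 * K), v2, fun r => (al' r * Xp r + al r * Xp' r) * u1 r + al r * Xp r * v1 r);
  (- (2 * K), d2, fun r => al r * Xp r * u1 r);
  (sg, v1, fun r => be r * z2 r); (sg, u1, fun r => be' r * z2 r + be r * y2 r);
  (- sg, v2, fun r => be r * z1 r); (- sg, u2, fun r => be' r * z1 r + be r * y1 r);
  (sg * K, v1, fun r => be r * Xp r * u1 r);
  (sg * K, u1, fun r => (be' r * Xp r + be r * Xp' r) * u1 r + be r * Xp r * v1 r);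
  (sg * K, v2, fun r => be r * Xp r * u2 r);
  (sg * K, u2, fun r => (be' r * Xp r + be r * Xp' r) * u2 r + be r * Xp r * v2 r) ].
have ls : l2s L.
  rewrite /L /=; repeat (split; [l2_tac|l2_tac|]).
  exact: I.
have : wsum L <= 0.
  apply: wsum_le0 ls _ => r r1.
  rewrite /L !big_cons big_nil /=.
  have := pointwise (u1 r) (u2 r) (v1 r) (v2 r) (d1 r) (d2 r) r1.
  have nn : nu != 0 by rewrite gt_eqF.
  (* The time derivatives are eliminated through the pointwise form of the equation, and [y1], [y2]
     cancel; a quadratic form in [u], [v] and [d] is left. *)
  have -> : z1 r = nu * d1 r - c * (Xp r * u1 r) + K * (Xp r * u2 r).
    by rewrite /d1 mulrA mulfV// mul1r; ring.
  have -> : z2 r = nu * d2 r - c * (Xp r * u2 r) - K * (Xp r * u1 r).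
    by rewrite /d2 mulrA mulfV// mul1r; ring.
  move: (d1 r) (d2 r) (u1 r) (u2 r) (v1 r) (v2 r) (y1 r) (y2 r) => D1 D2 U1 U2 V1 V2 Y1 Y2.
  move: (A r) (A' r) (At r) (al r) (al' r) (alt r) (be r) (be' r) (bet r) (kap r) (Xp r) (Xp' r).
  move=> a a' at_ l l' lt b b' bt k x x' P.
  rewrite -subr_le0 in P; apply: le_trans P; rewrite le_eqVlt; apply/orP; left; apply/eqP.
  ring.
rewrite /wsum /L !big_cons big_nil /= /energy_rate {L ls}.
have e (k a b : R) : a + b = 0 -> k * a + k * b = 0 by rewrite -mulrDr => ->; rewrite mulr0.
move: (e (- (2 * nu)) _ _ n11) (e (- (2 * nu)) _ _ n12) (e (- 2) _ _ n21) (e (- 2) _ _ n22)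
  (e sg _ _ n31) (e (- sg) _ _ n32) (e (- (2 * c)) _ _ n41) (e (- (2 * c)) _ _ n42)
  (e (2 * K) _ _ n51) (e (- (2 * K)) _ _ n52) (e (sg * K) _ _ n61) (e (sg * K) _ _ n62).
clear.
do !(match goal with |- context [@ip _ ?f ?g] => generalize (ip f g) end).
by move=> *; lra.
Qed.

End StaticDissipation.

(** * The weights *)

Section Weights.
Context {R : realType}.

Definition ubd (D : set R) (rho : R -> R -> R) :=
  (forall x, D x -> measurable_fun (@halfline R) (rho x)) /\
  exists C : R, forall x r, D x -> 1 < r -> `|rho x r| <= C.

Lemma ubd_bdmul D rho x : D x -> ubd D rho -> bdmul (rho x).
Proof. by move=> Dx [m [C HC]]; split; [exact: m|exists C => r; exact: HC]. Qed.

Lemma ubdM D rho eta : ubd D rho -> ubd D eta -> ubd D (fun x r => rho x r * eta x r).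
Proof.
move=> [mr [C hC]] [me [B hB]]; split.
  by move=> x Dx; apply: measurable_funM; [exact: mr|exact: me].
by exists (C * B) => x r Dx r1; rewrite normrM ler_pM//; [exact: hC|exact: hB].
Qed.

Lemma ubdD D rho eta : ubd D rho -> ubd D eta -> ubd D (fun x r => rho x r + eta x r).
Proof.
move=> [mr [C hC]] [me [B hB]]; split.
  by move=> x Dx; apply: measurable_funD; [exact: mr|exact: me].
exists (C + B) => x r Dx r1.
by rewrite (le_trans (ler_normD _ _))// lerD//; [exact: hC|exact: hB].
Qed.

Lemma ubd_cst D c : ubd D (fun _ _ => c).
Proof. by split=> [x _|]; [exact: measurable_cst|exists `|c|]. Qed.

Lemma ubdB D rho eta : ubd D rho -> ubd D eta -> ubd D (fun x r => rho x r - eta x r).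
Proof.
move=> hr he; have := ubdD hr (ubdM (ubd_cst D (-1)) he).
by under [X in ubd D X -> _]eq_fun do under eq_fun do rewrite mulN1r.
Qed.

Lemma ubdX D rho n : ubd D rho -> ubd D (fun x r => rho x r ^+ n).
Proof.
move=> hr; elim: n => [|n IH]; first by exact: ubd_cst.
have := ubdM hr IH.
by under [X in ubd D X -> _]eq_fun do under eq_fun do rewrite -exprS.
Qed.

Lemma ubdV D rho (e : R) : 0 < e -> ubd D rho -> (forall x r, D x -> 1 < r -> e <= rho x r) ->
  ubd D (fun x r => (rho x r)^-1).
Proof.
move=> e0 [mr _] H; split=> [x Dx|].
  apply: (@eq_measurable_fun _ _ _ _ _ (fun r => rho x r `^ (-1))).
    move=> r; rewrite inE /halfline /= in_itv/= andbT => r1.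
    by rewrite powR_inv1// (le_trans (ltW e0))// H.
  by apply: (measurableT_comp (measurable_powR _)); exact: mr.
exists e^-1 => x r Dx r1; have h := H _ _ Dx r1; have h0 := lt_le_trans e0 h.
by rewrite ger0_norm ?invr_ge0 ?(ltW h0)// lef_pV2 ?posrE.
Qed.

Lemma ubd_r D (f : R -> R) : bdmul f -> ubd D (fun _ r => f r).
Proof. by move=> [m [C HC]]; split=> // ; exists C => _ r _; exact: HC. Qed.

Lemma ubd_t (a b : R) : ubd `]a, b[ (fun t _ => t).
Proof.
split=> [x _|]; first exact: measurable_cst.
exists (`|a| + `|b|) => x r; rewrite /= in_itv/= => /andP[ax xb] _.
have := ler_norm (- a); have := ler_norm b; have := normr_ge0 a; have := normr_ge0 b.
by rewrite normrN ler_norml => h1 h2 h3 h4; apply/andP; split; lra.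
Qed.

Lemma bdmul_inv : bdmul (fun r : R => r^-1).
Proof.
split.
  apply: open_continuous_measurable_fun; first exact: interval_open.
  move=> x /set_mem /halflineP x1; apply: cvgV; last exact: cvg_id.
  by rewrite gt_eqF// (lt_trans ltr01 x1).
exists 1 => r r1; have r0 : 0 < r by exact: lt_trans r1.
by rewrite ger0_norm ?invr_ge0 ?(ltW r0)// invf_le1// ltW.
Qed.

Lemma is_derive_pow (f : R -> R) (f' x : R) n : is_derive x 1 f f' -> f x != 0 ->
  is_derive x 1 (fun y => f y ^+ n) (n%:R * f' / f x * f x ^+ n).
Proof.
move=> D fx; elim: n => [|n IH].
  by under eq_fun do rewrite expr0; rewrite !mul0r; exact: is_derive_cst.
under eq_fun do rewrite exprS.
have D1 := is_deriveM D IH; apply: (is_derive_eq D1); rewrite /GRing.scale /= exprS.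
by rewrite -natr1; field.
Qed.



Lemma is_derive_inv1 (f : R -> R) (f' x : R) : is_derive x 1 f f' -> f x != 0 ->
  is_derive x 1 (fun y => (f y)^-1) (- f' * (f x)^-1 ^+ 2).
Proof.
move=> D fx; have D1 := is_deriveV fx D; apply: (is_derive_eq D1).
by rewrite /GRing.scale /= exprVn; ring.
Qed.

Lemma is_derive_Xp (r : R) : r != 0 -> is_derive r 1 (@Xp R) (Xp' r).
Proof.
move=> r0; have D1 := is_deriveM (is_derive_id r 1) (is_derive_id r 1).
have r2 : r * r != 0 by rewrite mulf_neq0.
have D := is_derive_inv1 D1 r2; apply: (is_derive_eq D).
by rewrite /Xp' /GRing.scale !fctE /=; field.
Qed.

Variables (Phi e d kq : R) (q : nat).
Hypotheses (Phi0 : 0 < Phi) (kq0 : 0 < kq) (kq1 : kq <= 1).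

(* tau = Phi t / r^2; the weight m = [mw] has d_t m = Phi m gw / r^2 and
   d_r m = - 4 m qw / r. With th = 1 - sw, the energy weights are A = m (1 + sw),
   al = d e^2 r^2 th m and be = d e r th^2 m, written so that they are bounded on r > 1. *)
Definition sw (t r : R) := (1 + Phi * t * Xp r)^-1.
Definition bw (t r : R) := 1 + kq * (Phi * t * Xp r).
Definition mw (t r : R) := bw t r ^+ (2 * q).
Definition gw (t r : R) := 2 * q%:R * kq * (bw t r)^-1.
Definition qw (t r : R) := q%:R * (bw t r - 1) * (bw t r)^-1.
Definition Aw (t r : R) := mw t r * (1 + sw t r).
Definition alw (t r : R) := d * e ^+ 2 * Phi * (t * (sw t r * mw t r)).
Definition bew (t r : R) := d * e * Phi * (t * (sw t r * r^-1) * (1 - sw t r) * mw t r).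
Definition Aw' (t r : R) :=
  mw t r * (2 * (1 - sw t r) * sw t r - 4 * qw t r * (1 + sw t r)) * r^-1.
Definition alw' (t r : R) := alw t r * (2 * (1 - sw t r) - 4 * qw t r) * r^-1.
Definition bew' (t r : R) :=
  d * e * ((1 - sw t r) ^+ 2 * mw t r * (1 - 4 * sw t r - 4 * qw t r)).
Definition Awt (t r : R) :=
  Phi * (Xp r * mw t r * (gw t r * (1 + sw t r) - sw t r ^+ 2)).
Definition alwt (t r : R) :=
  d * e ^+ 2 * Phi * (mw t r * (sw t r ^+ 2 + gw t r * (1 - sw t r))).
Definition bewt (t r : R) := d * e * Phi *
  (r^-1 * mw t r * (2 * (1 - sw t r) * sw t r ^+ 2 + gw t r * (1 - sw t r) ^+ 2)).
Definition kapw (t r : R) := d / 4 * Phi * (Xp r * mw t r).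
Definition kapwt (t r : R) := d / 4 * Phi * (Xp r * (mw t r * gw t r * Phi * Xp r)).

(** The weights are needed slightly before [t = 0], to have 0 inside the interval of
    differentiation, and for [r > 1 / 2], the margin of [rsm]. There [Xp r <= 4], so
    [Phi t >= - 1 / 8] keeps [1 + tau] at least [1 / 2]. *)
Lemma tau_ge (t r : R) : - (8 * Phi)^-1 <= t -> 2^-1 < r -> - 2^-1 <= Phi * t * Xp r.
Proof.
move=> t0 r0; have x4 : Xp r <= 4.
  rewrite /Xp -[leRHS]invrK lef_pV2 ?posrE ?exprn_gt0 ?invr_gt0//; last exact: lt_trans r0.
  have -> : (4 : R)^-1 = 2^-1 ^+ 2 by field.
  by rewrite lerXn2r ?nnegrE ?(ltW r0) ?invr_ge0// (le_trans _ (ltW r0)).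
have x0 : 0 <= Xp r by rewrite /Xp invr_ge0 sqr_ge0.
have : - 8^-1 <= Phi * t.
  have -> : - 8^-1 = Phi * - (8 * Phi)^-1 by field; rewrite gt_eqF.
  by rewrite ler_wpM2l// ltW.
move: (Phi * t) => y y0; nra.
Qed.

Lemma sw_den (t r : R) : - (8 * Phi)^-1 <= t -> 2^-1 < r -> 2^-1 <= 1 + Phi * t * Xp r.
Proof. by move=> t0 r0; have := tau_ge t0 r0; lra. Qed.

Lemma bw_den (t r : R) : - (8 * Phi)^-1 <= t -> 2^-1 < r -> 2^-1 <= bw t r.
Proof.
move=> t0 r0; rewrite /bw; have := tau_ge t0 r0; move: (Phi * t * Xp r) => y y0.
by have := kq0; have := kq1; nra.
Qed.



(** * Derivatives of the weights in time and radius *)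

Section At.
Variables (t r : R).
Hypotheses (t0 : - (8 * Phi)^-1 <= t) (r0 : 2^-1 < r).

Let rn0 : r != 0. Proof. by rewrite gt_eqF// (lt_trans _ r0)// invr_gt0. Qed.
Let sn0 : 1 + Phi * t * Xp r != 0.
Proof. by rewrite gt_eqF// (lt_le_trans _ (sw_den t0 r0))// invr_gt0. Qed.
Let bn0 : bw t r != 0.
Proof. by rewrite gt_eqF// (lt_le_trans _ (bw_den t0 r0))// invr_gt0. Qed.

Let tauE : Phi * t * Xp r = (sw t r)^-1 - 1.
Proof. by rewrite /sw invrK; ring. Qed.

Lemma is_derive_sw_t : is_derive t 1 (sw ^~ r) (- (Phi * Xp r) * sw t r ^+ 2).
Proof.
have D : is_derive t 1 (fun t => 1 + Phi * t * Xp r) (Phi * Xp r).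
  apply: is_derive_shift; have H := is_derive_scale (Phi * Xp r) (is_derive_id t 1).
  under eq_fun do rewrite mulrAC.
  by apply: (is_derive_eq H); rewrite mulr1.
exact: is_derive_inv1 D sn0.
Qed.

Lemma is_derive_bw_t : is_derive t 1 (bw ^~ r) (kq * (Phi * Xp r)).
Proof.
apply: is_derive_shift; apply: is_derive_scale.
have H := is_derive_scale (Phi * Xp r) (is_derive_id t 1).
under eq_fun do rewrite mulrAC.
by apply: (is_derive_eq H); rewrite mulr1.
Qed.

Lemma is_derive_mw_t : is_derive t 1 (mw ^~ r) (mw t r * gw t r * Phi * Xp r).
Proof.
have H := is_derive_pow (2 * q) is_derive_bw_t bn0; apply: (is_derive_eq H).
by rewrite /gw natrM -/(mw t r); ring.
Qed.

Lemma is_derive_sw_r : is_derive r 1 (sw t) (2 * (1 - sw t r) * sw t r * r^-1).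
Proof.
have D := is_derive_shift 1 (is_derive_scale (Phi * t) (is_derive_Xp rn0)).
have H := is_derive_inv1 D sn0; apply: (is_derive_eq H).
rewrite -/(sw t r) (_ : Phi * t * Xp' r = - 2 * (Phi * t * Xp r) * r^-1); last first.
  by rewrite /Xp /Xp'; field.
by rewrite tauE; field; rewrite /sw invr_eq0; apply/andP.
Qed.

Lemma is_derive_bw_r : is_derive r 1 (bw t) (- 2 * (bw t r - 1) * r^-1).
Proof.
have H := is_derive_shift 1 (is_derive_scale kq (is_derive_scale (Phi * t) (is_derive_Xp rn0))).
apply: (is_derive_eq H); rewrite /bw /Xp' /Xp; field.
exact: rn0.
Qed.

Lemma is_derive_mw_r : is_derive r 1 (mw t) (- 4 * qw t r * mw t r * r^-1).
Proof.
have H := is_derive_pow (2 * q) is_derive_bw_r bn0; apply: (is_derive_eq H).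
by rewrite /qw natrM -/(mw t r); ring.
Qed.

Lemma is_derive_Aw_t : is_derive t 1 (Aw ^~ r) (Awt t r).
Proof.
have H := is_derive_mul is_derive_mw_t (is_derive_shift 1 is_derive_sw_t).
by apply: (is_derive_eq H); rewrite /Awt; ring.
Qed.

Lemma is_derive_Aw_r : is_derive r 1 (Aw t) (Aw' t r).
Proof.
have H := is_derive_mul is_derive_mw_r (is_derive_shift 1 is_derive_sw_r).
by apply: (is_derive_eq H); rewrite /Aw'; ring.
Qed.

(** The relation [tau s = th], through which the bounded forms of the weights are exchanged for
    those with [r^2 th] and [r th^2]. *)
Let tsE : t * Phi * Xp r * sw t r = 1 - sw t r.
Proof. by rewrite [t * _]mulrC tauE; field; rewrite /sw invr_eq0. Qed.

Lemma is_derive_alw_t : is_derive t 1 (alw ^~ r) (alwt t r).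
Proof.
have H := is_derive_scale (d * e ^+ 2 * Phi)
  (is_derive_mul (is_derive_id t 1) (is_derive_mul is_derive_sw_t is_derive_mw_t)).
apply: (is_derive_eq H); rewrite /alwt; congr (_ * _).
transitivity (mw t r * sw t r - (t * Phi * Xp r * sw t r) * mw t r * sw t r
   + (t * Phi * Xp r * sw t r) * mw t r * gw t r); first by ring.
by rewrite tsE; ring.
Qed.

Lemma is_derive_alw_r : is_derive r 1 (alw t) (alw' t r).
Proof.
have H := is_derive_scale (d * e ^+ 2 * Phi)
  (is_derive_scale t (is_derive_mul is_derive_sw_r is_derive_mw_r)).
by apply: (is_derive_eq H); rewrite /alw' /alw; ring.
Qed.

Lemma is_derive_bew_t : is_derive t 1 (bew ^~ r) (bewt t r).
Proof.
have D1 : is_derive t 1 (fun t => t * (sw t r * r^-1)) (sw t r ^+ 2 * r^-1).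
  have D := is_derive_mul is_derive_sw_t (is_derive_cst (r^-1) t 1).
  have H := is_derive_mul (is_derive_id t 1) D; apply: (is_derive_eq H).
  transitivity (sw t r / r * (1 - t * Phi * Xp r * sw t r)); first by rewrite /cst; ring.
  by rewrite tsE; ring.
have D2 := is_derive_shift 1 (is_derive_scale (-1) is_derive_sw_t).
under [X in is_derive _ _ X]eq_fun do rewrite /bew -[- sw _ r]mulN1r.
have H := is_derive_scale (d * e * Phi) (is_derive_mul (is_derive_mul D1 D2) is_derive_mw_t).
apply: (is_derive_eq H); rewrite /bewt; congr (_ * _).
transitivity (r^-1 * mw t r * (sw t r ^+ 2 * (1 - sw t r)
  + (t * Phi * Xp r * sw t r) * (sw t r ^+ 2 + gw t r * (1 - sw t r)))); first by ring.
by rewrite tsE; ring.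
Qed.

Lemma bewE : bew t r = d * e * r * ((1 - sw t r) ^+ 2 * mw t r).
Proof.
rewrite /bew; transitivity (d * e * r * ((t * Phi * Xp r * sw t r) * (1 - sw t r) * mw t r)).
  by rewrite /Xp; field; exact: rn0.
by rewrite tsE; ring.
Qed.

Lemma alwE : alw t r = d * e ^+ 2 * r ^+ 2 * ((1 - sw t r) * mw t r).
Proof.
rewrite /alw; transitivity (d * e ^+ 2 * r ^+ 2 * ((t * Phi * Xp r * sw t r) * mw t r)).
  by rewrite /Xp; field; exact: rn0.
by rewrite tsE; ring.
Qed.

Lemma is_derive_bew_r : is_derive r 1 (bew t) (bew' t r).
Proof.
have D1 := is_derive_mul is_derive_sw_r (is_derive_inv1 (is_derive_id r 1) rn0).
have D2 := is_derive_shift 1 (is_derive_scale (-1) is_derive_sw_r).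
under [X in is_derive _ _ X]eq_fun do rewrite /bew -[- sw _ _]mulN1r.
have H := is_derive_scale (d * e * Phi)
  (is_derive_mul (is_derive_mul (is_derive_scale t D1) D2) is_derive_mw_r).
apply: (is_derive_eq H); rewrite /bew'.
transitivity (d * e * ((t * Phi * Xp r * sw t r) * mw t r *
  (2 * (1 - sw t r) ^+ 2 - (1 - sw t r) - 2 * (1 - sw t r) * sw t r - 4 * qw t r * (1 - sw t r)))).
  by rewrite /Xp; field; exact: rn0.
by rewrite tsE; ring.
Qed.

Lemma is_derive_kapw_t : is_derive t 1 (kapw ^~ r) (kapwt t r).
Proof. exact: is_derive_scale (is_derive_scale (Xp r) is_derive_mw_t). Qed.

End At.

Lemma rsm_tau (t : R) : rsm (fun r => Phi * t * Xp r).
Proof.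
apply: rsm_mul; first exact: rsm_cst.
apply: rsm_inv; first exact/rsm_exp/rsm_id.
by move=> r r0; rewrite expf_neq0// gt_eqF// (lt_trans _ r0)// invr_gt0.
Qed.

Lemma rsm_sub (f g : R -> R) : rsm f -> rsm g -> rsm (fun r => f r - g r).
Proof.
move=> rf rg; have := rsm_add rf (rsm_mul (rsm_cst (-1)) rg).
by under [X in rsm X -> _]eq_fun do rewrite mulN1r.
Qed.

Section Rsm.
Variable t : R.
Hypothesis t0 : - (8 * Phi)^-1 <= t.

Lemma rsm_sw : rsm (sw t).
Proof.
apply: rsm_inv; first by apply: rsm_add; [exact: rsm_cst|exact: rsm_tau].
by move=> r r0; rewrite gt_eqF// (lt_le_trans _ (sw_den t0 r0))// invr_gt0.
Qed.

Lemma rsm_mw : rsm (mw t).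
Proof.
apply: rsm_exp; apply: rsm_add; first exact: rsm_cst.
by apply: rsm_mul; [exact: rsm_cst|exact: rsm_tau].
Qed.

Lemma rsm_Aw : rsm (Aw t).
Proof.
apply: rsm_mul; first exact: rsm_mw.
by apply: rsm_add; [exact: rsm_cst|exact: rsm_sw].
Qed.

Lemma rsm_alw : rsm (alw t).
Proof.
apply: rsm_mul; first exact: rsm_cst; apply: rsm_mul; first exact: rsm_cst.
by apply: rsm_mul; [exact: rsm_sw|exact: rsm_mw].
Qed.

Lemma rsm_bew : rsm (bew t).
Proof.
apply: rsm_mul; first exact: rsm_cst; apply: rsm_mul; last exact: rsm_mw.
apply: rsm_mul; last by apply: rsm_sub; [exact: rsm_cst|exact: rsm_sw].
apply: rsm_mul; first exact: rsm_cst; apply: rsm_mul; first exact: rsm_sw.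
apply: rsm_inv; first exact: rsm_id.
by move=> r r0; rewrite gt_eqF// (lt_trans _ r0)// invr_gt0.
Qed.

End Rsm.

(** * Bounds on the weights, uniform in time *)

Section Bounded.
Variable b : R.
Let D : set R := `](- (8 * Phi)^-1), b[.

Let D0 t : D t -> - (8 * Phi)^-1 <= t.
Proof. by rewrite /D /= in_itv/= => /andP[/ltW]. Qed.

Let half1 (r : R) : 1 < r -> 2^-1 < r.
Proof. by apply: lt_trans; rewrite invf_lt1 ?ltr1n. Qed.

Lemma ubd_tau : ubd D (fun t r => Phi * t * Xp r).
Proof.
by apply: ubdM; [apply: ubdM; [exact: ubd_cst|exact: ubd_t]|exact/ubd_r/bdmul_Xp].
Qed.

Lemma ubd_sw : ubd D sw.
Proof.
apply: (@ubdV D _ 2^-1); first by rewrite invr_gt0.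
  by apply: ubdD; [exact: ubd_cst|exact: ubd_tau].
by move=> t r Dt r1; apply: sw_den; [exact: D0|exact: half1].
Qed.

Lemma ubd_bw : ubd D bw.
Proof. by apply: ubdD; [exact: ubd_cst|apply: ubdM; [exact: ubd_cst|exact: ubd_tau]]. Qed.

Lemma ubd_bwV : ubd D (fun t r => (bw t r)^-1).
Proof.
apply: (@ubdV D _ 2^-1); [by rewrite invr_gt0|exact: ubd_bw|].
by move=> t r Dt r1; apply: bw_den; [exact: D0|exact: half1].
Qed.

Lemma ubd_mw : ubd D mw. Proof. exact/ubdX/ubd_bw. Qed.

Lemma ubd_gw : ubd D gw. Proof. by apply: ubdM; [exact: ubd_cst|exact: ubd_bwV]. Qed.

Lemma ubd_qw : ubd D qw.
Proof.
apply: ubdM; last exact: ubd_bwV; apply: ubdM; first exact: ubd_cst.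
by apply: ubdB; [exact: ubd_bw|exact: ubd_cst].
Qed.

Ltac ubd_tac := first [ exact: ubd_cst | exact: ubd_t | exact: ubd_sw | exact: ubd_mw
  | exact: ubd_gw | exact: ubd_qw | exact: (ubd_r _ bdmul_inv) | exact: (ubd_r _ (@bdmul_Xp R))
  | apply: ubdX; ubd_tac | apply: ubdB; ubd_tac | apply: ubdD; ubd_tac | apply: ubdM; ubd_tac ].

Lemma ubd_Aw : ubd D Aw. Proof. rewrite /Aw; ubd_tac. Qed.
Lemma ubd_alw : ubd D alw. Proof. rewrite /alw; ubd_tac. Qed.
Lemma ubd_bew : ubd D bew. Proof. rewrite /bew; ubd_tac. Qed.
Lemma ubd_kapw : ubd D kapw. Proof. rewrite /kapw; ubd_tac. Qed.
Lemma ubd_Aw' : ubd D Aw'. Proof. rewrite /Aw'; ubd_tac. Qed.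
Lemma ubd_alw' : ubd D alw'. Proof. rewrite /alw' /alw; ubd_tac. Qed.
Lemma ubd_bew' : ubd D bew'. Proof. rewrite /bew'; ubd_tac. Qed.
Lemma ubd_Awt : ubd D Awt. Proof. rewrite /Awt; ubd_tac. Qed.
Lemma ubd_alwt : ubd D alwt. Proof. rewrite /alwt; ubd_tac. Qed.
Lemma ubd_bewt : ubd D bewt. Proof. rewrite /bewt; ubd_tac. Qed.
Lemma ubd_kapwt : ubd D kapwt. Proof. rewrite /kapwt; ubd_tac. Qed.

Lemma mulw_Aw t : D t -> mulw (Aw t) (Aw' t).
Proof.
move=> Dt; split; [exact/rsm_Aw/D0|exact: (ubd_bdmul Dt ubd_Aw)|exact: (ubd_bdmul Dt ubd_Aw')|].
by move=> r /half1 r1; apply: is_derive_Aw_r => //; exact: D0.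
Qed.

Lemma mulw_alw t : D t -> mulw (alw t) (alw' t).
Proof.
move=> Dt; split; [exact/rsm_alw/D0|exact: (ubd_bdmul Dt ubd_alw)|exact: (ubd_bdmul Dt ubd_alw')|].
by move=> r /half1 r1; apply: is_derive_alw_r => //; exact: D0.
Qed.

Lemma mulw_bew t : D t -> mulw (bew t) (bew' t).
Proof.
move=> Dt; split; [exact/rsm_bew/D0|exact: (ubd_bdmul Dt ubd_bew)|exact: (ubd_bdmul Dt ubd_bew')|].
by move=> r /half1 r1; apply: is_derive_bew_r => //; exact: D0.
Qed.

End Bounded.

Lemma mulw_Xp : mulw (@Xp R) (@Xp' R).
Proof.
split; [|exact: bdmul_Xp| |].
- apply: rsm_inv; first exact/rsm_exp/rsm_id.
  by move=> r r0; rewrite expf_neq0// gt_eqF// (lt_trans _ r0)// invr_gt0.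
- have h := bdmulM (bdmul_cst (-2)) (bdmulM bdmul_inv (@bdmul_Xp R)).
  rewrite (_ : Xp' = (fun r => - 2 * (r^-1 * Xp r))) //.
  by apply/funext => r; rewrite /Xp' /Xp exprS invfM.
- by move=> r r1; apply: is_derive_Xp; rewrite gt_eqF// (lt_trans _ r1).
Qed.

Lemma sw_range (t r : R) : 0 <= t -> 0 <= sw t r <= 1.
Proof.
move=> t0; have h : 0 <= Phi * t * Xp r.
  by rewrite !mulr_ge0 ?(ltW Phi0)// /Xp invr_ge0 sqr_ge0.
by rewrite /sw invr_ge0 invf_le1 ?ltr_pwDl// addr_ge0//= lerDl.
Qed.

Lemma bw_ge1 (t r : R) : 0 <= t -> 1 <= bw t r.
Proof.
move=> t0; rewrite /bw lerDl !mulr_ge0 ?(ltW Phi0) ?(ltW kq0)//.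
by rewrite /Xp invr_ge0 sqr_ge0.
Qed.

Lemma mw_ge1 (t r : R) : 0 <= t -> 1 <= mw t r.
Proof. by move=> t0; rewrite exprn_ege1// bw_ge1. Qed.

Variables (nu n sg K c : R).
Hypotheses (d0 : 0 < d) (dsmall : d <= 1 / 1000) (e0 : 0 < e) (sg1 : sg ^+ 2 = 1) (n0 : 0 <= n).
Hypotheses (KE : K = sg * (Phi / e)) (nuE : nu = e ^+ 2 * Phi) (cE : c = Phi * n).
Hypotheses (kqE : kq * (1 + q%:R) = d / 200) (eq1 : e * (1 + q%:R) <= d / 100).

(** Origin of the constants: [gw <= 2 q kq], and [kq (1 + q) = d / 200] makes this at most
    [d / 100]; since [qw <= q], the bound on [e (1 + q)] gives the one on [e + e qw]. *)
Lemma scaled_weights (t r : R) : 0 <= t ->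
  scaled (sw t r) (gw t r) (qw t r) e n sg d (1 - sw t r).
Proof.
move=> t0; have /andP[s0 s1] := sw_range r t0; have b1 := bw_ge1 r t0.
have bp : 0 < bw t r by exact: lt_le_trans b1.
have bV : (bw t r)^-1 <= 1 by rewrite invf_le1.
have bV0 : 0 <= (bw t r)^-1 by rewrite invr_ge0 ltW.
have q0 : (0 : R) <= q%:R by [].
have g0 : 0 <= gw t r by rewrite /gw !mulr_ge0// ltW.
have gd : gw t r <= d / 100.
  apply: (@le_trans _ _ (2 * q%:R * kq)); first by rewrite /gw ler_piMr// !mulr_ge0// ltW.
  by have := kqE; have := kq0; have := d0; nra.
have qw0 : 0 <= qw t r by rewrite /qw !mulr_ge0// subr_ge0.
have qw1 : qw t r <= q%:R.
  by rewrite /qw -mulrA ler_piMr// ler_pdivrMr// mul1r gerBl.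
have eqw : e + e * qw t r <= d / 100.
  by apply: le_trans eq1; rewrite mulrDr mulr1 lerD2l ler_wpM2l// ltW.
split=> //; rewrite ?(ltW e0)//; [by rewrite subr_ge0|by rewrite gerBl|].
by have := sqr_ge0 (sw t r - 1 / 2); lra.
Qed.

(** [scaled_dissipation] at [V = e r q], [D = e^2 r^2 d], multiplied by [Phi m / r^2]. The powers of
    [e] and [r] match through [nu = e^2 Phi] and [K = sg Phi / e]. *)
Lemma weights_dissipation (t r p1 p2 q1 q2 d1 d2 : R) : 0 <= t -> 1 < r ->
  Awt t r * (p1 ^+ 2 + p2 ^+ 2) + alwt t r * (q1 ^+ 2 + q2 ^+ 2)
  - sg * bewt t r * (p1 * q2 - p2 * q1) - 2 * nu * Aw t r * (q1 ^+ 2 + q2 ^+ 2)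
  - 2 * nu * Aw' t r * (p1 * q1 + p2 * q2) - 2 * c * Xp r * Aw t r * (p1 ^+ 2 + p2 ^+ 2)
  - 2 * nu * alw t r * (d1 ^+ 2 + d2 ^+ 2) - 2 * nu * alw' t r * (q1 * d1 + q2 * d2)
  - 2 * c * alw t r * Xp r * (q1 ^+ 2 + q2 ^+ 2) - 2 * c * alw t r * Xp' r * (p1 * q1 + p2 * q2)
  + 2 * K * alw t r * Xp' r * (q1 * p2 - q2 * p1)
  - sg * (2 * bew t r * nu * (d1 * q2 - d2 * q1) - 2 * bew t r * c * Xp r * (p1 * q2 - p2 * q1)
      + nu * bew' t r * (p2 * d1 - p1 * d2))
  + sg * K * bew t r * Xp' r * (p1 ^+ 2 + p2 ^+ 2) <= - kapw t r * (p1 ^+ 2 + p2 ^+ 2).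
Proof.
move=> t0 r1; have rn0 : r != 0 by rewrite gt_eqF// (lt_trans _ r1).
have en0 : e != 0 by rewrite gt_eqF.
have r2 : 2^-1 < r by rewrite (lt_trans _ r1)// invf_lt1 ?ltr1n.
have t1 : - (8 * Phi)^-1 <= t.
  by rewrite (le_trans _ t0)// oppr_le0 invr_ge0 mulr_ge0// ltW.
have H := scaled_dissipation (scaled_weights r t0) p1 p2 (e * r * q1) (e * r * q2)
  (e ^+ 2 * r ^+ 2 * d1) (e ^+ 2 * r ^+ 2 * d2).
have P : 0 <= Phi * Xp r * mw t r.
  rewrite !mulr_ge0 ?(ltW Phi0)//; first by rewrite /Xp invr_ge0 sqr_ge0.
  exact: le_trans (mw_ge1 r t0).
have := ler_wpM2l P H.
have sgK : sg * K = Phi / e by rewrite KE mulrA -expr2 sg1 mul1r.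
rewrite sgK {}KE.
rewrite /Awt /alwt /bewt /Aw /Aw' /alw' /bew' /kapw bewE// alwE// nuE cE /Xp' /Xp.
move: (sw t r) (mw t r) (gw t r) (qw t r) => s m g qt.
set L := (X in X <= _ -> _); set RR := (X in _ <= X -> _).
set L' := (X in _ -> X <= _); set RR' := (X in _ -> _ <= X).
have -> : L' = L by rewrite /L /L'; field; apply/andP.
by have -> : RR' = RR by rewrite /RR /RR'; field.
Qed.

End Weights.

(** * Energy estimate for regularised solutions *)

Section EnergyDecay.
Context {R : realType}.
Notation mu := (@lebesgue_measure R).

Lemma is_derive_combination (c : R) (f1 f2 f3 f4 f5 f6 : R -> R) (d1 d2 d3 d4 d5 d6 t : R) :
  is_derive t 1 f1 d1 -> is_derive t 1 f2 d2 -> is_derive t 1 f3 d3 -> is_derive t 1 f4 d4 ->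
  is_derive t 1 f5 d5 -> is_derive t 1 f6 d6 ->
  is_derive t 1 (fun x => f1 x + f2 x + f3 x + f4 x - c * (f5 x - f6 x))
    (d1 + d2 + d3 + d4 - c * (d5 - d6)).
Proof.
move=> D1 D2 D3 D4 D5 D6.
exact: is_deriveB (is_derive_add (is_derive_add (is_derive_add D1 D2) D3) D4)
  (is_derive_scale c (is_deriveB D5 D6)).
Qed.

(** [E x] plus the integral of [D] up to [x] is nonincreasing. The derivative is assumed on an
    interval that starts below 0, which gives continuity of [E] at the endpoint 0. *)
Lemma decay_integral (E E' D : R -> R) (a b t : R) : a < 0 -> 0 < t -> t < b ->
  (forall x, a < x < b -> is_derive x 1 E (E' x)) ->
  (forall x, a < x < b -> {for x, continuous D}) ->
  (forall x, 0 <= x <= t -> E' x <= - D x) ->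
  mu.-integrable `[0, t] (EFin \o D) /\ E t + \int[mu]_(x in `[0, t]) D x <= E 0.
Proof.
move=> a0 t0 tb dE cD ED.
have ab x : 0 <= x <= t -> a < x < b.
  by move=> /andP[h1 h2]; rewrite (lt_le_trans a0 h1) (le_lt_trans h2 tb).
have cw (f : R -> R) : (forall x, a < x < b -> {for x, continuous f}) ->
    {within `[0, t], continuous f}.
  move=> cf; apply: continuous_in_subspaceT => x; rewrite inE /= in_itv/= => /ab.
  exact: cf.
have ID : mu.-integrable `[0, t] (EFin \o D).
  by apply: continuous_compact_integrable; [exact: segment_compact|exact: cw].
split=> //.
pose F x := E x + \int[mu]_(y in `[0, x]) D y.
have dF x : x \in `]0, t[ -> is_derive x 1 F (E' x + D x).
  rewrite in_itv/= => /andP[x0 xt]; have xab : a < x < b by apply: ab; rewrite !ltW.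
  have [d1 d2] := continuous_FTC1_closed xt ID x0 (cD _ xab).
  apply: is_derive_add; first exact: dE.
  by apply: DeriveDef; [exact: d1|rewrite -d2 derive1E].
have := @ler0_derive1_nincr R F 0 t _ _ _ 0 t (lexx _) (ltW t0) (lexx _).
rewrite /F set_itv1 Rintegral_set1 addr0; apply.
- by move=> x /dF[].
- move=> x xt; have [_ Dx] := dF _ xt; rewrite derive1E Dx.
  by move: xt; rewrite in_itv/= => /andP[x0 xt]; rewrite -lerBrDr sub0r ED// !ltW.
- have c1 : {within `[0, t], continuous E}.
    by apply: cw => x xab; apply: derivable_cont; case: (dE _ xab).
  have c2 := parameterized_integral_continuous (ltW t0) ID.
  by move=> x; apply: cvgD; [exact: c1|exact: c2].
Qed.

End EnergyDecay.

(** * Decay of the energy along a regularised solution *)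

Section RegularisedEnergy.
Context {R : realType}.
Notation mu := (@lebesgue_measure R).
Variables (nu c K T : R) (a1 a2 F1 F2 dF1 dF2 : R -> R -> R).
Hypotheses (T0 : 0 < T) (S : rsol nu c K T a1 a2 F1 F2 dF1 dF2).
Variables (h : R) (k k' : R -> R) (M : R).
Hypotheses (h0 : 0 < h) (mk : mollifier h k k' M).

Lemma reg_ae_bound F : jl2 T F ->
  {ae mu, forall r, forall t, `|reg k F t r| <= M * Nf F r /\ `|dreg k' F t r| <= M * Nf F r}.
Proof.
move=> jF; case: mk => dk ck' kM _ _.
apply: (@Av_shift_bound R T F jF k k' M dk).
- exact: continuous_measurable_fun.
- by move=> x; case: (kM x).
- by move=> x; case: (kM x).
Qed.

Lemma reg_ae_derive F : jl2 T F ->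
  {ae mu, forall r, forall t : R, is_derive t 1 (fun t => reg k F t r) (dreg k' F t r)}.
Proof.
move=> jF; case: mk => dk ck' kM _ _.
apply: (@Av_shift_derive R T F jF k k' M dk).
- by move=> x; case: (kM x).
- by move=> x; case: (kM x).
Qed.

Lemma is_derive_reg_ip (rho rho' F G : R -> R -> R) (a b t : R) : jl2 T F -> jl2 T G ->
  a < t < b -> ubd `]a, b[ rho -> ubd `]a, b[ rho' ->
  (forall x r : R, a < x < b -> 1 < r -> is_derive x 1 (rho ^~ r) (rho' x r)) ->
  is_derive t 1 (fun x => ip (fun r => rho x r * reg k F x r) (reg k G x))
    (ip (fun r => rho' t r * reg k F t r) (reg k G t)
     + ip (fun r => rho t r * dreg k' F t r) (reg k G t)
     + ip (fun r => rho t r * reg k F t r) (dreg k' G t)).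
Proof.
move=> jF jG tab ur ur' drho.
have I x : a < x < b -> `]a, b[%classic x by rewrite /= in_itv.
have lreg H x : jl2 T H -> l2 (reg k H x).
  by move=> jH; apply: (Av_l2 T0 jH); exact: (bker_reg mk).
have ldreg H x : jl2 T H -> l2 (dreg k' H x).
  by move=> jH; apply: (Av_l2 T0 jH); exact: (bker_dreg mk).
have [[_ [C HC]] [_ [C' HC']]] := (ur, ur').
apply: (@is_derive_ip _ a b rho rho' _ _ _ _ (fun r => M * Nf F r) (fun r => M * Nf G r)
  (Num.max C C')) => //.
- by move=> x xab; split; [exact: lreg|exact: ldreg|exact: lreg|exact: ldreg].
- by move=> x /I Ix; split; [exact: (ubd_bdmul Ix ur)|exact: (ubd_bdmul Ix ur')].
- by move=> x r /I Ix r1; rewrite !le_max HC// HC'// orbT.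
- by apply: l2Z; exact: (Nf_l2 T0 jF).
- by apply: l2Z; exact: (Nf_l2 T0 jG).
- have H := aeI (reg_ae_bound jF) (reg_ae_bound jG).
  by apply: aeS H => r [H1 H2] x _; split; [exact: H1|exact: H2].
- have H := aeI (reg_ae_derive jF) (reg_ae_derive jG).
  by apply: aeS H => r [H1 H2] x _; split; [exact: H1|exact: H2].
Qed.

Variables (Phi e d kq sg n : R) (q : nat).
Hypotheses (Phi0 : 0 < Phi) (kq0 : 0 < kq) (kq1 : kq <= 1).
Hypotheses (d0 : 0 < d) (dsmall : d <= 1 / 1000) (e0 : 0 < e) (sg1 : sg ^+ 2 = 1) (n0 : 0 <= n).
Hypotheses (KE : K = sg * (Phi / e)) (nuE : nu = e ^+ 2 * Phi) (cE : c = Phi * n).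
Hypotheses (kqE : kq * (1 + q%:R) = d / 200) (eq1 : e * (1 + q%:R) <= d / 100).

Definition energy (t : R) :=
  ip (fun r => Aw Phi kq q t r * reg k F1 t r) (reg k F1 t)
  + ip (fun r => Aw Phi kq q t r * reg k F2 t r) (reg k F2 t)
  + ip (fun r => alw Phi e d kq q t r * reg k dF1 t r) (reg k dF1 t)
  + ip (fun r => alw Phi e d kq q t r * reg k dF2 t r) (reg k dF2 t)
  - sg * (ip (fun r => bew Phi e d kq q t r * reg k F1 t r) (reg k dF2 t)
    - ip (fun r => bew Phi e d kq q t r * reg k F2 t r) (reg k dF1 t)).

Definition dissip (t : R) :=
  ip (fun r => kapw Phi d kq q t r * reg k F1 t r) (reg k F1 t)
  + ip (fun r => kapw Phi d kq q t r * reg k F2 t r) (reg k F2 t).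

Definition energy' (t : R) := energy_rate sg (reg k F1 t) (reg k F2 t) (reg k dF1 t) (reg k dF2 t)
  (dreg k' F1 t) (dreg k' F2 t) (dreg k' dF1 t) (dreg k' dF2 t)
  (Aw Phi kq q t) (Awt Phi kq q t) (alw Phi e d kq q t) (alwt Phi e d kq q t)
  (bew Phi e d kq q t) (bewt Phi e d kq q t).

Let half1 (r : R) : 1 < r -> 2^-1 < r.
Proof. by apply: lt_trans; rewrite invf_lt1 ?ltr1n. Qed.

Let lowb (x : R) : - (8 * Phi)^-1 < x < T -> - (8 * Phi)^-1 <= x.
Proof. by move=> /andP[/ltW]. Qed.

Lemma is_derive_energy t : - (8 * Phi)^-1 < t < T -> is_derive t 1 energy (energy' t).
Proof.
move=> tab; have [j1 j2] := rs_jF S; have [jd1 jd2] := rs_jdF S.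
have DA F (jF : jl2 T F) := is_derive_reg_ip jF jF tab
  (ubd_Aw kq q Phi0 T) (ubd_Awt q Phi0 kq0 kq1 T)
  (fun x r xab r1 => is_derive_Aw_t q Phi0 kq0 kq1 (lowb xab) (half1 r1)).
have Dal F (jF : jl2 T F) := is_derive_reg_ip jF jF tab
  (ubd_alw e d kq q Phi0 T) (ubd_alwt e d q Phi0 kq0 kq1 T)
  (fun x r xab r1 => is_derive_alw_t e d q Phi0 kq0 kq1 (lowb xab) (half1 r1)).
have Dbe F G (jF : jl2 T F) (jG : jl2 T G) := is_derive_reg_ip jF jG tab
  (ubd_bew e d kq q Phi0 T) (ubd_bewt e d q Phi0 kq0 kq1 T)
  (fun x r xab r1 => is_derive_bew_t e d q Phi0 kq0 kq1 (lowb xab) (half1 r1)).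
exact: (is_derive_combination sg (DA _ j1) (DA _ j2) (Dal _ jd1) (Dal _ jd2)
  (Dbe _ _ j1 jd2) (Dbe _ _ j2 jd1)).
Qed.

Lemma dissip_cont t : - (8 * Phi)^-1 < t < T -> {for t, continuous dissip}.
Proof.
move=> tab; have [j1 j2] := rs_jF S.
have DA F (jF : jl2 T F) := is_derive_reg_ip jF jF tab
  (ubd_kapw Phi d kq q T) (ubd_kapwt d q Phi0 kq0 kq1 T)
  (fun x r xab r1 => is_derive_kapw_t d q Phi0 kq0 kq1 (lowb xab) (half1 r1)).
by apply: derivable_cont; case: (is_derive_add (DA _ j1) (DA _ j2)).
Qed.

Lemma energy'_le t : 0 <= t <= T - h -> energy' t <= - dissip t.
Proof.
move=> tT; have /andP[t0 t1] := tT.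
have tb : - (8 * Phi)^-1 < t < T.
  apply/andP; split; last by rewrite (le_lt_trans t1)// gtrBl.
  by rewrite (lt_le_trans _ t0)// oppr_lt0 invr_gt0 mulr_gt0.
have It : `](- (8 * Phi)^-1), T[%classic t by rewrite /= in_itv.
have [H1 H2 H3 H4] := reg_h10 T0 S mk t.
have nu0 : 0 < nu by rewrite nuE mulr_gt0// exprn_gt0.
apply: (energy_rate_le nu0 H1 H2 H3 H4 _ (mulw_Aw q Phi0 kq0 kq1 It)
  (mulw_alw e d q Phi0 kq0 kq1 It) (mulw_bew e d q Phi0 kq0 kq1 It) (@mulw_Xp R)
  (ubd_bdmul It (ubd_Awt q Phi0 kq0 kq1 T)) (ubd_bdmul It (ubd_alwt e d q Phi0 kq0 kq1 T))
  (ubd_bdmul It (ubd_bewt e d q Phi0 kq0 kq1 T)) (ubd_bdmul It (ubd_kapw Phi d kq q T))).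
  by move=> g dg hg; exact: (reg_weak T0 S mk hg tT).
move=> r p1 p2 q1 q2 d1 d2 r1.
exact: (weights_dissipation Phi0 kq0 d0 dsmall e0 sg1 n0 KE nuE cE kqE eq1).
Qed.

Definition wnorm t :=
  ip (fun r => mw Phi kq q t r * reg k F1 t r) (reg k F1 t)
  + ip (fun r => mw Phi kq q t r * reg k F2 t r) (reg k F2 t).

Lemma energy_lower t : 0 <= t < T -> 1 / 2 * wnorm t <= energy t.
Proof.
move=> /andP[t0 tT].
have It : `](- (8 * Phi)^-1), T[%classic t.
  rewrite /= in_itv/= tT andbT (lt_le_trans _ t0)// oppr_lt0 invr_gt0 mulr_gt0//.
have [/l2_h10[lu1 lv1] /l2_h10[lu2 lv2] _ _] := reg_h10 T0 S mk t.
have bA := ubd_bdmul It (ubd_Aw kq q Phi0 T).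
have bal := ubd_bdmul It (ubd_alw e d kq q Phi0 T).
have bbe := ubd_bdmul It (ubd_bew e d kq q Phi0 T).
have bm := ubd_bdmul It (ubd_mw Phi kq q T).
have := @wsum_le0 R [:: (1 / 2, (fun r => mw Phi kq q t r * reg k F1 t r), reg k F1 t);
  (1 / 2, (fun r => mw Phi kq q t r * reg k F2 t r), reg k F2 t);
  (-1, (fun r => Aw Phi kq q t r * reg k F1 t r), reg k F1 t);
  (-1, (fun r => Aw Phi kq q t r * reg k F2 t r), reg k F2 t);
  (-1, (fun r => alw Phi e d kq q t r * reg k dF1 t r), reg k dF1 t);
  (-1, (fun r => alw Phi e d kq q t r * reg k dF2 t r), reg k dF2 t);
  (sg, (fun r => bew Phi e d kq q t r * reg k F1 t r), reg k dF2 t);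
  (- sg, (fun r => bew Phi e d kq q t r * reg k F2 t r), reg k dF1 t)].
rewrite /wsum !big_cons !big_nil /= /energy /wnorm => H.
rewrite -subr_le0; apply: le_trans (H _ _); last 2 first.
- by repeat (split; [exact: l2M|assumption|]).
- move=> r r1; rewrite !big_cons !big_nil /=.
  have r2 := half1 r1; have tl : - (8 * Phi)^-1 <= t.
    by rewrite (le_trans _ t0)// oppr_le0 invr_ge0 mulr_ge0// ltW.
  have /andP[s0 s1] := sw_range Phi0 r t0.
  have := scaled_positivity (reg k F1 t r) (reg k F2 t r) (e * r * reg k dF1 t r)
    (e * r * reg k dF2 t r) d0 dsmall s0 s1 sg1.
  have m0 : 0 <= mw Phi kq q t r by rewrite (le_trans ler01)// mw_ge1.
  move=> /(ler_wpM2l m0).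
  rewrite /Aw (bewE e d kq q Phi0 tl r2) (alwE e d kq q Phi0 tl r2).
  rewrite -subr_le0; apply: le_trans; rewrite le_eqVlt; apply/orP; left; apply/eqP.
  move: (mw _ _ _ _ _) (sw _ _ _) (reg k F1 t r) (reg k F2 t r) (reg k dF1 t r) (reg k dF2 t r).
  by move=> m s u1 u2 v1 v2; field.
rewrite le_eqVlt; apply/orP; left; apply/eqP.
do !(match goal with |- context [@ip _ ?f ?g] => generalize (ip f g) end).
by move=> *; field.
Qed.

(** At [t = 0] one has [s = 1] and the weights of all terms with [d_r w] vanish. The radial
    derivative of the regularised datum, not controlled as [h] tends to 0, thus does not enter. *)
Lemma energy0 : energy 0 = 2 * N2 (reg k F1 0) (reg k F2 0).
Proof.
have [/l2_h10[lu1 lv1] /l2_h10[lu2 lv2] _ _] := reg_h10 T0 S mk 0.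
have z r : [/\ Aw Phi kq q 0 r = 2, alw Phi e d kq q 0 r = 0 & bew Phi e d kq q 0 r = 0].
  rewrite /Aw /mw /bw /sw /alw /bew !(mulr0, mul0r) addr0 invr1 expr1n; split=> //.
  by rewrite mul1r.
have zA f g : ip (fun r => Aw Phi kq q 0 r * f r) g = ip (fun r => 2 * f r) g.
  by apply: eq_ip => // r; have [-> _ _] := z r.
have zal f g : ip (fun r => alw Phi e d kq q 0 r * f r) g = 0.
  transitivity (ip (fun=> 0) g); last exact: ip0l.
  apply: eq_ip => // r.
  by have [_ -> _] := z r; rewrite mul0r.
have zbe f g : ip (fun r => bew Phi e d kq q 0 r * f r) g = 0.
  transitivity (ip (fun=> 0) g); last exact: ip0l.
  apply: eq_ip => // r.
  by have [_ _ ->] := z r; rewrite mul0r.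
by rewrite /energy !zA !zal !zbe !ipZl// subr0 mulr0 subr0 !addr0 /N2 mulrDr.
Qed.

Lemma energy_estimate t : 0 < t -> t <= T - h ->
  mu.-integrable `[0, t] (EFin \o dissip) /\
  1 / 2 * wnorm t + \int[mu]_(s in `[0, t]) dissip s <= 2 * N2 (reg k F1 0) (reg k F2 0).
Proof.
move=> t0 tT; have tT' : t < T by rewrite (le_lt_trans tT)// gtrBl.
have a0 : - (8 * Phi)^-1 < 0 by rewrite oppr_lt0 invr_gt0 mulr_gt0.
have itvT x : 0 <= x <= t -> 0 <= x <= T - h.
  by move=> /andP[-> xt]; exact: le_trans tT.
have [I H] := decay_integral a0 t0 tT' (@is_derive_energy) (@dissip_cont)
  (fun x xt => energy'_le (itvT x xt)).
split=> //; rewrite -energy0; apply: le_trans H; rewrite lerD2r.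
by apply: energy_lower; rewrite ltW.
Qed.

End RegularisedEnergy.

(** * Passage to the limit *)

Section LimitTools.
Context {R : realType}.
Notation mu := (@lebesgue_measure R).

(* [ge0_le_integral] without its measurability hypotheses; those of t |-> L2norm (F t)
   are not available for the weighted solution. *)
Lemma integral_mono (D : set R) (f g : R -> \bar R) :
  (forall x, D x -> (0 <= f x <= g x)%E) ->
  (\int[mu]_(x in D) f x <= \int[mu]_(x in D) g x)%E.
Proof.
move=> fg; rewrite integral_mkcond [leRHS]integral_mkcond.
have H x : (0 <= (f \_ D) x <= (g \_ D) x)%E.
  by rewrite !patchE; case: ifPn => [/set_mem/fg//|_]; rewrite lexx.
rewrite !ge0_integralTE; last 2 first.
- by move=> x; have /andP[h1] := H x; exact: le_trans.
- by move=> x; have /andP[] := H x.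
apply: le_ereal_sup => _ [h hf <-]; exists h => // x.
by apply: le_trans (hf x) _; have /andP[] := H x.
Qed.

Lemma ip_cvg (rho : R -> R) (u : nat -> R -> R) (a : R -> R) : bdmul rho ->
  (forall n, l2 (u n)) -> l2 a ->
  (fun n => ip (fun r => u n r - a r) (fun r => u n r - a r)) @ \oo --> (0 : R) ->
  (fun n => ip (fun r => rho r * u n r) (u n)) @ \oo --> ip (fun r => rho r * a r) a.
Proof.
move=> brho lu la cu.
have [_ [C HC]] := brho.
have C0 : 0 <= C.
  by apply: le_trans (HC 2 _); rewrite ?ltr1n.
pose x n := ip (fun r => u n r - a r) (fun r => u n r - a r).
have x0 n : 0 <= x n by exact: ip_ge0.
have lra_ := l2M brho la.
have lw n : l2 (fun r => u n r - a r) by exact: l2B.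
pose B := Num.sqrt (ip (fun r => rho r * a r) (fun r => rho r * a r)).
(* Expansion around [a]: the linear part, which occurs twice, is bounded by Cauchy-Schwarz, the
   quadratic part by the bound [C] of [rho]. *)
pose y n := 2 * (B * Num.sqrt (x n)) + C * x n.
have cs : (fun n => Num.sqrt (x n)) @ \oo --> (0 : R).
  apply/cvgrPdist_lt => e e0; have e2 : 0 < e ^+ 2 by rewrite exprn_gt0.
  near=> n; rewrite sub0r normrN ger0_norm ?sqrtr_ge0//.
  rewrite -(ger0_norm (ltW e0)) -sqrtr_sqr ltr_sqrt//.
  have : `|0 - x n| < e ^+ 2 by near: n; exact: (cvgrPdist_lt _ _).1 cu _ e2.
  by rewrite sub0r normrN ger0_norm.
have cy : y @ \oo --> (0 : R).
  have -> : (0 : R) = 2 * (B * 0) + C * 0 by rewrite !mulr0 addr0.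
  apply: cvgD; last by apply: cvgM; [exact: cvg_cst|exact: cu].
  apply: cvgM; first exact: cvg_cst; apply: cvgM; first exact: cvg_cst.
  exact: cs.
pose L := ip (fun r => rho r * a r) a.
have E n : ip (fun r => rho r * u n r) (u n) = L
    + 2 * ip (fun r => rho r * a r) (fun r => u n r - a r)
    + ip (fun r => rho r * (u n r - a r)) (fun r => u n r - a r).
  have lwn := lw n; have lrw := l2M brho lwn.
  rewrite (@eq_ip _ (fun r => rho r * u n r) (fun r => rho r * a r + rho r * (u n r - a r))
    (u n) (fun r => a r + (u n r - a r))); [|by move=> r; ring|by move=> r; ring].
  rewrite ipDl//; last exact: l2D.
  have e1 : ip (fun r => rho r * (u n r - a r)) a =
      ip (fun r => rho r * a r) (fun r => u n r - a r).
    exact: etrans (ipMl _ _ _) (ipC _ _).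
  by rewrite (ipDr lra_ la lwn) (ipDr lrw la lwn) e1 -/L; ring.
have b1 n : `|ip (fun r => rho r * a r) (fun r => u n r - a r)| <= B * Num.sqrt (x n).
  rewrite -sqrtrM ?ip_ge0// -sqrtr_sqr; apply: ler_wsqrtr.
  exact: ip_cauchy.
have b2 n : `|ip (fun r => rho r * (u n r - a r)) (fun r => u n r - a r)| <= C * x n.
  have lwn := lw n; have lrw := l2M brho lwn; have lc := l2Z C lwn.
  have lN := l2Z (- C) lwn.
  have h r : 1 < r -> - C * ((u n r - a r) * (u n r - a r)) <=
      rho r * ((u n r - a r) * (u n r - a r)) <= C * ((u n r - a r) * (u n r - a r)).
    move=> r1; have := HC r r1; rewrite ler_norml => /andP[h1 h2].
    by rewrite -expr2 !ler_wpM2r ?sqr_ge0.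
  rewrite ler_norml; apply/andP; split.
    rewrite -mulNr -ipZl//; apply: ip_le => // r /h; rewrite -!mulrA; by case/andP.
  rewrite -ipZl//; apply: ip_le => // r /h; rewrite -!mulrA; by case/andP.
have hb n : L - y n <= ip (fun r => rho r * u n r) (u n) <= L + y n.
  move: (b1 n) (b2 n); rewrite E /y !ler_norml {E}.
  move: (ip _ _) (ip (fun r => _ * (_ - _)) _) (B * _) (C * _) => p1 p2 p3 p4.
  by move: {b1 b2 x0 y cy} L => L0 /andP[h1 h2] /andP[h3 h4]; apply/andP; split; lra.
apply: (@squeeze_cvgr _ _ _ _ (fun n => L - y n) (fun n => L + y n)).
- by apply: nearW => n; exact: hb.
- by rewrite -[X in _ --> X]subr0; apply: cvgB; [exact: cvg_cst|exact: cy].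
- by rewrite -[X in _ --> X]addr0; apply: cvgD; [exact: cvg_cst|exact: cy].
Unshelve. all: by end_near. Qed.

End LimitTools.

(** * Weighted bounds for the solution *)

Section SolutionBounds.
Context {R : realType}.
Notation mu := (@lebesgue_measure R).
Variables (nu c K T : R) (a1 a2 F1 F2 dF1 dF2 : R -> R -> R).
Hypotheses (T0 : 0 < T) (S : rsol nu c K T a1 a2 F1 F2 dF1 dF2).
Variables (Phi e d kq sg n : R) (q : nat).
Hypotheses (Phi0 : 0 < Phi) (kq0 : 0 < kq) (kq1 : kq <= 1).
Hypotheses (d0 : 0 < d) (dsmall : d <= 1 / 1000) (e0 : 0 < e) (sg1 : sg ^+ 2 = 1) (n0 : 0 <= n).
Hypotheses (KE : K = sg * (Phi / e)) (nuE : nu = e ^+ 2 * Phi) (cE : c = Phi * n).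
Hypotheses (kqE : kq * (1 + q%:R) = d / 200) (eq1 : e * (1 + q%:R) <= d / 100).

(** The shift by 2 keeps [hn m < T] already at [m = 0], so that [0, T - hn m] is never
    degenerate. *)
Let hn (m : nat) : R := T * m.+2%:R^-1.

Let hn0 m : 0 < hn m.
Proof. by rewrite mulr_gt0// invr_gt0. Qed.

Let hnT m : hn m < T.
Proof. by rewrite gtr_pMr// invf_lt1// ltr1n. Qed.

Let hn_small (x : R) : 0 < x -> \forall m \near \oo, hn m < x.
Proof.
move=> x0; have c0 : (fun m => hn m) @ \oo --> (0 : R).
  rewrite (_ : (0 : R) = T * 0); last by rewrite mulr0.
  apply: cvgM; first exact: cvg_cst.
  by have := @cvg_harmonic R; rewrite -cvg_shiftS.
by move/cvgrPdist_lt: c0 => /(_ _ x0); apply: filterS => m; rewrite sub0r normrN gtr0_norm.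
Qed.

Lemma reg_cvg (k : nat -> R -> R) (k' : nat -> R -> R) (M : nat -> R) (t : R) :
  (forall m, mollifier (hn m) (k m) (k' m) (M m)) -> 0 <= t < T ->
  (fun m => N2 (fun r => reg (k m) F1 t r - a1 t r) (fun r => reg (k m) F2 t r - a2 t r))
    @ \oo --> (0 : R).
Proof.
move=> mk /andP[t0 tT]; apply/cvgrPdist_le => x x0.
have tT' : 0 <= t <= T by rewrite t0 ltW.
have [y y0 Hy] := rs_cont S tT' x0.
(* [y] is the window of continuity at [t], and [T - t] keeps the support of the kernel inside the
   time interval. *)
have z0 : 0 < Num.min y (T - t) by rewrite lt_min y0 subr_gt0.
near=> m; have : hn m < Num.min y (T - t) by near: m; exact: hn_small.
rewrite lt_min => /andP[h1 h2].
rewrite sub0r normrN ger0_norm ?N2_ge0//.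
apply: (reg_close T0 S (hn0 m) (mk m)).
  by rewrite t0/= lerBrDl -lerBrDr ltW.
move=> s /andP[ts st]; apply/ltW/Hy.
  by rewrite (le_trans t0 (ltW ts))/= (le_trans (ltW st))// -lerBrDl ltW.
by rewrite gtr0_norm ?subr_gt0// ltrBlDl (lt_trans st)// ltrD2l.
Unshelve. all: by end_near. Qed.

Let mollifiers : exists (k k' : nat -> R -> R) (M : nat -> R),
  forall m, mollifier (hn m) (k m) (k' m) (M m).
Proof.
have H m : exists p : (R -> R) * (R -> R) * R, mollifier (hn m) p.1.1 p.1.2 p.2.
  by have [k [k' [M mk]]] := mollifier_exists (hn0 m); exists (k, k', M).
have [p Hp] := choice H.
by exists (fun m => (p m).1.1), (fun m => (p m).1.2), (fun m => (p m).2).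
Qed.

Let kapD (t : R) := ip (fun r => kapw Phi d kq q t r * a1 t r) (a1 t)
  + ip (fun r => kapw Phi d kq q t r * a2 t r) (a2 t).

Section Limit.
Variables (k k' : nat -> R -> R) (M : nat -> R).
Hypothesis mk : forall m, mollifier (hn m) (k m) (k' m) (M m).

Lemma reg_ip_cvg (rho : R -> R) (t : R) : bdmul rho -> 0 <= t < T ->
  (fun m => ip (fun r => rho r * reg (k m) F1 t r) (reg (k m) F1 t)
    + ip (fun r => rho r * reg (k m) F2 t r) (reg (k m) F2 t)) @ \oo -->
  ip (fun r => rho r * a1 t r) (a1 t) + ip (fun r => rho r * a2 t r) (a2 t).
Proof.
move=> brho tT; have tT' : 0 <= t <= T by case/andP: tT => -> /ltW.
have [l1 l2'] := rs_l2 S tT'.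
have lr m : l2 (reg (k m) F1 t) /\ l2 (reg (k m) F2 t).
  by have [/l2_h10[? _] /l2_h10[? _] _ _] := reg_h10 T0 S (mk m) t.
have cN := reg_cvg mk tT.
apply: cvgD.
- apply: ip_cvg => //; first by move=> m; case: (lr m).
  apply: (@squeeze_cvgr _ _ _ _ (fun=> 0) _ _ _ _ _ cN); last exact: cvg_cst.
  by apply: nearW => m; rewrite ip_ge0/= /N2 lerDl ip_ge0.
- apply: ip_cvg => //; first by move=> m; case: (lr m).
  apply: (@squeeze_cvgr _ _ _ _ (fun=> 0) _ _ _ _ _ cN); last exact: cvg_cst.
  by apply: nearW => m; rewrite ip_ge0/= /N2 lerDr ip_ge0.
Qed.

Lemma reg_N2_cvg : (fun m => 2 * N2 (reg (k m) F1 0) (reg (k m) F2 0)) @ \oo -->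
  2 * N2 (a1 0) (a2 0).
Proof.
have T00 : 0 <= (0 : R) < T by rewrite lexx.
have H := reg_ip_cvg (bdmul_cst 1) T00.
apply: cvgM; first exact: cvg_cst.
have E u v : N2 u v = ip (fun r => 1 * u r) u + ip (fun r => 1 * v r) v.
  by congr (_ + _); apply: eq_ip => // r; rewrite mul1r.
by rewrite E; apply: cvg_trans H; apply: near_eq_cvg; apply: nearW => m; rewrite E.
Qed.

Let inD t : 0 < t < T -> `](- (8 * Phi)^-1), T[%classic t.
Proof.
move=> /andP[t0 tT]; rewrite /= in_itv/= tT andbT.
by rewrite (lt_trans _ t0)// oppr_lt0 invr_gt0 mulr_gt0.
Qed.

Let estimate m t : 0 < t -> t <= T - hn m -> _ := fun t0 tT =>
  energy_estimate T0 S (hn0 m) (mk m) Phi0 kq0 kq1 d0 dsmall e0 sg1 n0 KE nuE cE kqE eq1 t0 tT.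

Lemma dissip_ge0 m s : 0 <= s -> 0 <= dissip F1 F2 (k m) Phi d kq q s.
Proof.
move=> s0; have w0 r : 0 <= kapw Phi d kq q s r.
  rewrite /kapw !mulr_ge0 ?(ltW Phi0) ?(ltW d0) ?invr_ge0 ?sqr_ge0//.
  by rewrite (le_trans ler01)// mw_ge1.
by apply: addr_ge0; apply: Rintegral_ge0 => r _; rewrite -mulrA mulr_ge0// -expr2 sqr_ge0.
Qed.

Lemma wnorm_bound t : 0 < t < T ->
  ip (fun r => mw Phi kq q t r * a1 t r) (a1 t) + ip (fun r => mw Phi kq q t r * a2 t r) (a2 t)
  <= 4 * N2 (a1 0) (a2 0).
Proof.
move=> tT; have /andP[t0 tT1] := tT.
have tT' : 0 <= t < T by rewrite ltW.
have cw := reg_ip_cvg (ubd_bdmul (inD tT) (ubd_mw Phi kq q T)) tT'.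
have cr : (fun m => 2 * (2 * N2 (reg (k m) F1 0) (reg (k m) F2 0))) @ \oo -->
    2 * (2 * N2 (a1 0) (a2 0)).
  by apply: cvgM; [exact: cvg_cst|exact: reg_N2_cvg].
(* One factor 2 is the value of the energy at time 0, the other undoes the [1 / 2] in its lower
   bound. *)
rewrite (_ : 4 * N2 (a1 0) (a2 0) = 2 * (2 * N2 (a1 0) (a2 0))); last by rewrite mulrA -natrM.
apply: (ler_cvg_to cw cr).
near=> m; have h1 : hn m < T - t by near: m; apply: hn_small; rewrite subr_gt0.
have h2 : t <= T - hn m by rewrite lerBrDl -lerBrDr ltW.
have [_ H] := estimate t0 h2.
have I0 : 0 <= \int[mu]_(s in `[0, t]) dissip F1 F2 (k m) Phi d kq q s.
  by apply: Rintegral_ge0 => s; rewrite /= in_itv/= => /andP[s0 _]; exact: dissip_ge0.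
move: H I0; rewrite /wnorm; move: (Rintegral _ _ _) (2 * N2 _ _) (ip _ _ + ip _ _) => x y z.
lra.
Unshelve. all: by end_near. Qed.

(** Fatou's lemma applied to the regularised dissipations. Measurability in time of the limit comes
    from the same approximation, as a pointwise limit. *)
Lemma dissip_bound : measurable_fun `]0, T[ (fun s => (kapD s)%:E) /\
  (\int[mu]_(s in `]0%R, T[) (kapD s)%:E <= (2 * N2 (a1 0) (a2 0))%:E)%E.
Proof.
(* The energy estimate holds up to [T - hn m] only, hence the truncation; every [s] in (0, T) is
   eventually inside. *)
pose g m := (EFin \o dissip F1 F2 (k m) Phi d kq q) \_ `[0, T - hn m].
have Tm m : 0 < T - hn m by rewrite subr_gt0 hnT.
have mI m : measurable (`[0, T - hn m]%classic : set R) by exact: measurable_itv.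
have mT : measurable (`]0, T[%classic : set R) by exact: measurable_itv.
have mg m : measurable_fun setT (g m).
  have [I _] := estimate (Tm m) (lexx _).
  by apply: (measurable_restrictT _ (mI m)).1; exact: (measurable_int _ I).
have g0 m s : (0 <= g m s)%E.
  rewrite /g patchE; case: ifPn => // /set_mem; rewrite /= in_itv/= => /andP[s0 _].
  by rewrite lee_fin dissip_ge0.
have gE m : (\int[mu]_(s in `]0%R, T[) g m s <= (2 * N2 (reg (k m) F1 0) (reg (k m) F2 0))%:E)%E.
  have [I H] := estimate (Tm m) (lexx _).
  apply: (@le_trans _ _ (\int[mu]_s g m s)%E).
    exact: (ge0_subset_integral mu mT measurableT (mg m) (fun s _ => g0 m s)).
  rewrite /g -integral_mkcond -[leLHS]fineK ?integrable_fin_num// lee_fin.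
  apply: le_trans H; rewrite [leRHS]addrC lerDl mulr_ge0//.
  rewrite /wnorm; have w0 r : 0 <= mw Phi kq q (T - hn m) r.
    by rewrite (le_trans ler01)// mw_ge1// ltW.
  by apply: addr_ge0; apply: Rintegral_ge0 => r _; rewrite -mulrA mulr_ge0// -expr2 sqr_ge0.
have gl s : `]0, T[%classic s -> (fun m => g m s) @ \oo --> (kapD s)%:E.
  rewrite /= in_itv/= => sT; have /andP[s0 sT1] := sT.
  have sT' : 0 <= s < T by rewrite ltW.
  have cw := reg_ip_cvg (ubd_bdmul (inD sT) (ubd_kapw Phi d kq q T)) sT'.
  have ce : (fun m => (dissip F1 F2 (k m) Phi d kq q s)%:E) @ \oo --> (kapD s)%:E.
    by apply: cvg_EFin; [exact: nearW|exact: cw].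
  apply: cvg_trans ce.
  apply: near_eq_cvg; near=> m.
  have h1 : hn m < T - s by near: m; apply: hn_small; rewrite subr_gt0.
  by rewrite /g patchE mem_set//= in_itv/= (ltW s0) lerBrDl -lerBrDr ltW.
split; first exact: emeasurable_fun_cvg (fun m => measurable_funTS (mg m)) gl.
have F := fatou mu mT (fun m => measurable_funTS (mg m)) (fun m s _ => g0 m s).
have c2 : (fun m => (2 * N2 (reg (k m) F1 0) (reg (k m) F2 0))%:E) @ \oo -->
    (2 * N2 (a1 0) (a2 0))%:E by apply: cvg_EFin; [exact: nearW|exact: reg_N2_cvg].
apply: (@le_trans _ _ (\int[mu]_(s in `]0%R, T[) limn_einf (g ^~ s))%E).
  rewrite le_eqVlt; apply/orP; left; apply/eqP; apply: eq_integral => s.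
  by rewrite inE => sT; rewrite (cvg_limn_einf_sup (gl _ sT)).1.
apply: le_trans F _; rewrite limn_einf_lim -(cvg_lim _ c2)//.
apply: lee_lim; [exact: is_cvg_einfs|by apply/cvg_ex; eexists; exact: c2|].
apply: nearW => m; apply: le_trans (gE m).
apply: ereal_inf_lbound; exists m => /=.
Unshelve. all: by end_near. Qed.

End Limit.

Lemma solution_bounds :
  (forall t, 0 < t < T ->
    ip (fun r => mw Phi kq q t r * a1 t r) (a1 t) + ip (fun r => mw Phi kq q t r * a2 t r) (a2 t)
    <= 4 * N2 (a1 0) (a2 0)) /\
  measurable_fun `]0, T[ (fun t => (ip (fun r => kapw Phi d kq q t r * a1 t r) (a1 t)
     + ip (fun r => kapw Phi d kq q t r * a2 t r) (a2 t))%:E) /\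
  (\int[mu]_(t in `]0%R, T[) (ip (fun r => kapw Phi d kq q t r * a1 t r) (a1 t)
     + ip (fun r => kapw Phi d kq q t r * a2 t r) (a2 t))%:E
    <= (2 * N2 (a1 0) (a2 0))%:E)%E.
Proof.
have [k [k' [M mk]]] := mollifiers.
by split=> [t tT|]; [exact: (wnorm_bound mk tT)|exact: (dissip_bound mk)].
Qed.

End SolutionBounds.

(** * The weighted norms *)

Section Norms.
Context {R : realType}.
Notation mu := (@lebesgue_measure R).

Lemma ra_scale (rho : R -> R) (f : R -> R[i]) :
  ra (fun r => (rho r)%:C * f r) = (fun r => rho r * ra f r).
Proof.
apply/funext => r; rewrite /ra !restrE; case: ifP => _; last by rewrite mulr0.
by case: (f r) => a b /=; rewrite mul0r subr0.
Qed.

Lemma ia_scale (rho : R -> R) (f : R -> R[i]) :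
  ia (fun r => (rho r)%:C * f r) = (fun r => rho r * ia f r).
Proof.
apply/funext => r; rewrite /ia !restrE; case: ifP => _; last by rewrite mulr0.
by case: (f r) => a b /=; rewrite mul0r addr0.
Qed.

Lemma L2normE (f : R -> R[i]) : l2 (ra f) -> l2 (ia f) ->
  L2norm f = (Num.sqrt (N2 (ra f) (ia f)))%:E.
Proof.
by move=> l1 l2'; rewrite L2norm_sqint sqint_N2// poweR_EFin powR12_sqrt ?N2_ge0.
Qed.

Lemma N2_weight (rho eta a b : R -> R) (A : R) : bdmul rho -> bdmul eta -> l2 a -> l2 b ->
  (forall r, 1 < r -> rho r ^+ 2 <= A * eta r) ->
  N2 (fun r => rho r * a r) (fun r => rho r * b r) <=
  A * (ip (fun r => eta r * a r) a + ip (fun r => eta r * b r) b).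
Proof.
move=> brho beta la lb H.
have key f : l2 f -> ip (fun r => rho r * f r) (fun r => rho r * f r) <=
    A * ip (fun r => eta r * f r) f.
  move=> lf; have lr := l2M brho lf; have le := l2M beta lf; have lA := l2Z A le.
  rewrite -ipZl//; apply: ip_le => // r r1.
  rewrite (_ : rho r * f r * (rho r * f r) = rho r ^+ 2 * f r ^+ 2); last by ring.
  rewrite (_ : A * (eta r * f r) * f r = A * eta r * f r ^+ 2); last by ring.
  by rewrite ler_wpM2r ?sqr_ge0// H.
have := key _ la; have := key _ lb; rewrite /N2 mulrDr; move=> h1 h2; exact: lerD.
Qed.

Lemma LpL2norm_oo_le (T : R) (F : R -> R -> R[i]) (y : \bar R) : (0 <= y)%E ->
  (forall t, 0 < t < T -> (L2norm (F t) <= y)%E) -> (LpL2norm T +oo%E F <= y)%E.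
Proof.
move=> y0 H; rewrite /LpL2norm unlock; case: ifP => // _.
apply/ess_supP; apply: aeW => t /=; rewrite patchE; case: ifPn => [/set_mem|_].
  by rewrite /= in_itv/= => /H; rewrite gee0_abs ?Lnorm_ge0.
by rewrite abse0.
Qed.

Lemma LpL2norm2_le (T : R) (F : R -> R -> R[i]) (g : R -> R) (y : R) : 0 <= y ->
  (forall t, 0 < t < T -> (sqint (F t) <= (g t)%:E)%E) ->
  (\int[mu]_(t in `]0%R, T[) (g t)%:E <= y%:E)%E ->
  (LpL2norm T 2%:E F <= (Num.sqrt y)%:E)%E.
Proof.
move=> y0 H Hg; rewrite /LpL2norm unlock.
have -> : (Num.sqrt y)%:E = (y%:E `^ 2^-1)%E by rewrite poweR_EFin powR12_sqrt.
apply: gt0_ler_poweR.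
- by rewrite invr_ge0.
- by rewrite in_itv/= leey andbT integral_ge0// => t _; exact: poweR_ge0.
- by rewrite in_itv/= leey andbT lee_fin.
apply: le_trans Hg.
apply: (@le_trans _ _ (\int[mu]_(t in `]0%R, T[) sqint (F t))%E).
  rewrite le_eqVlt; apply/orP; left; apply/eqP; rewrite [RHS]integral_mkcond.
  apply: eq_integral => t _; rewrite !patchE; case: ifP => _.
    by rewrite gee0_abs ?Lnorm_ge0// L2norm_sq.
  by rewrite abse0 poweR0r.
apply: integral_mono => t; rewrite /= in_itv/= => /H h.
by rewrite sqint_ge0.
Qed.

(** The solution attains its datum in the sense that the norm of the difference is 0. The factor 2
    of [N2D] is kept here and reappears in the constants 8 and 16 of the conclusion. *)
Lemma N2_perturb (f g : R -> R[i]) : L2 f -> L2 g -> L2norm (fun r => f r - g r) = 0%E ->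
  N2 (ra f) (ia f) <= 2 * N2 (ra g) (ia g).
Proof.
move=> /L2_l2[f1 f2] /L2_l2[g1 g2] H.
have d1 := l2B f1 g1; have d2 := l2B f2 g2.
have N0 : N2 (fun r => ra f r - ra g r) (fun r => ia f r - ia g r) = 0.
  have := L2norm_sq (fun r => f r - g r); rewrite H poweR0r//.
  have E1 : ra (fun r => f r - g r) = (fun r => ra f r - ra g r) by apply/funext/raB.
  have E2 : ia (fun r => f r - g r) = (fun r => ia f r - ia g r) by apply/funext/iaB.
  by rewrite sqint_N2 ?E1 ?E2// => -[].
have := N2D g1 g2 d1 d2; rewrite N0 mulr0 addr0; congr (_ <= _).
by apply: eq_N2 => r; ring.
Qed.

End Norms.

(** * The two norms of the theorem *)

Section WeightedNorms.
Context {R : realType}.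
Notation mu := (@lebesgue_measure R).

Lemma weight_compare (Phi kq t r : R) (q : nat) : 0 < Phi -> 0 < kq -> kq <= 1 -> 0 <= t ->
  ((1 + Phi * t / r ^+ 2) ^+ q) ^+ 2 <= (kq^-1 ^+ q) ^+ 2 * mw Phi kq q t r.
Proof.
move=> Phi0 kq0 kq1 t0.
have y0 : 0 <= Phi * t / r ^+ 2.
  by rewrite mulr_ge0 ?invr_ge0 ?sqr_ge0// mulr_ge0// ltW.
have i1 : 1 <= kq^-1 by rewrite invf_ge1.
rewrite /mw -!exprM mulnC -exprMn lerXn2r ?nnegrE//.
- by rewrite addr_ge0.
- by rewrite mulr_ge0 ?invr_ge0 ?(ltW kq0)// (le_trans ler01)// bw_ge1.
rewrite (_ : kq^-1 * bw Phi kq t r = kq^-1 + Phi * t / r ^+ 2) ?lerD2r//.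
by rewrite /bw /Xp mulrDr mulr1 [kq^-1 * (_ * _)]mulrA mulVf ?gt_eqF// mul1r.
Qed.

Variables (nu c K T : R) (w : R -> R -> R[i]) (F1 F2 dF1 dF2 : R -> R -> R).
Hypotheses (T0 : 0 < T)
  (S : rsol nu c K T (fun t => ra (w t)) (fun t => ia (w t)) F1 F2 dF1 dF2).
Variables (Phi e d kq sg n : R) (q : nat).
Hypotheses (Phi0 : 0 < Phi) (kq0 : 0 < kq) (kq1 : kq <= 1).
Hypotheses (d0 : 0 < d) (dsmall : d <= 1 / 1000) (e0 : 0 < e) (sg1 : sg ^+ 2 = 1) (n0 : 0 <= n).
Hypotheses (KE : K = sg * (Phi / e)) (nuE : nu = e ^+ 2 * Phi) (cE : c = Phi * n).
Hypotheses (kqE : kq * (1 + q%:R) = d / 200) (eq1 : e * (1 + q%:R) <= d / 100).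

Let N := N2 (ra (w 0)) (ia (w 0)).
Let A := kq^-1 ^+ q.
Let D : set R := `](- (8 * Phi)^-1), T[.

Let inD t : 0 < t < T -> D t.
Proof.
move=> /andP[t0 tT]; rewrite /D /= in_itv/= tT andbT.
by rewrite (lt_trans _ t0)// oppr_lt0 invr_gt0 mulr_gt0.
Qed.

Let l2w t : 0 < t < T -> l2 (ra (w t)) /\ l2 (ia (w t)).
Proof. by move=> /andP[t0 tT]; apply: (rs_l2 S); rewrite !ltW. Qed.

Let bdw t : 0 < t < T -> bdmul (fun r => (1 + Phi * t / r ^+ 2) ^+ q).
Proof.
move=> /inD Dt; apply: (ubd_bdmul Dt (rho := fun t r => (1 + Phi * t / r ^+ 2) ^+ q)).
by apply: ubdX; apply: ubdD; [exact: ubd_cst|exact: ubd_tau].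
Qed.

Lemma sup_norm_bound : (LpL2norm T +oo%E
  (fun t r => ((1 + Phi * t / r ^+ 2) ^+ q)%:C * w t r)%R <= (A * Num.sqrt (4 * N))%:E)%E.
Proof.
have [H1 _] := solution_bounds T0 S Phi0 kq0 kq1 d0 dsmall e0 sg1 n0 KE nuE cE kqE eq1.
have A0 : 0 <= A by rewrite exprn_ge0// invr_ge0 ltW.
apply: LpL2norm_oo_le; first by rewrite lee_fin mulr_ge0// sqrtr_ge0.
move=> t tT; have [l1 l2'] := l2w tT; have b := bdw tT; have /andP[t0 _] := tT.
rewrite L2normE ?ra_scale ?ia_scale; [|exact: l2M..].
rewrite lee_fin -[X in _ <= X * _](ger0_norm A0) -sqrtr_sqr -sqrtrM ?sqr_ge0//.
apply: ler_wsqrtr.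
apply: (@le_trans _ _ (A ^+ 2 * (ip (fun r => mw Phi kq q t r * ra (w t) r) (ra (w t))
   + ip (fun r => mw Phi kq q t r * ia (w t) r) (ia (w t))))).
  apply: N2_weight => //; first exact: (ubd_bdmul (inD tT) (ubd_mw Phi kq q T)).
  by move=> r _; apply: weight_compare => //; exact: ltW.
by rewrite ler_wpM2l ?sqr_ge0// H1.
Qed.

Lemma square_norm_bound : (LpL2norm T 2%:E
  (fun t r => ((1 + Phi * t / r ^+ 2) ^+ q)%:C * ((r^-1)%:C * w t r))%R
  <= (Num.sqrt (A ^+ 2 * (4 / (d * Phi)) * (2 * N)))%:E)%E.
Proof.
have [_ [mk Hk]] := solution_bounds T0 S Phi0 kq0 kq1 d0 dsmall e0 sg1 n0 KE nuE cE kqE eq1.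
have c0 : 0 <= A ^+ 2 * (4 / (d * Phi)).
  by rewrite mulr_ge0 ?sqr_ge0// divr_ge0// mulr_ge0// ltW.
have N0 : 0 <= 2 * N by rewrite mulr_ge0// N2_ge0.
(* [4 / (d Phi)] undoes the factor [d Phi / 4] of [kapw] and leaves [m / r^2]; [A ^+ 2] comes from
   [weight_compare]. *)
pose g t := A ^+ 2 * (4 / (d * Phi)) * (ip (fun r => kapw Phi d kq q t r * ra (w t) r) (ra (w t))
   + ip (fun r => kapw Phi d kq q t r * ia (w t) r) (ia (w t))).
apply: (@LpL2norm2_le _ _ _ g); first exact: mulr_ge0.
  move=> t tT; have [l1 l2'] := l2w tT; have b := bdw tT; have /andP[t0 _] := tT.
  have bi := bdmulM b (@bdmul_inv R).
  have E : (fun r => ((1 + Phi * t / r ^+ 2) ^+ q)%:C * ((r^-1)%:C * w t r)) =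
      (fun r => ((1 + Phi * t / r ^+ 2) ^+ q * r^-1)%:C * w t r).
    by apply/funext => r; rewrite rmorphM mulrA.
  rewrite E sqint_N2 ?ra_scale ?ia_scale; [|exact: l2M..].
  rewrite lee_fin; apply: N2_weight => //.
    exact: (ubd_bdmul (inD tT) (ubd_kapw Phi d kq q T)).
  move=> r r1; have := weight_compare r q Phi0 kq0 kq1 (ltW t0); rewrite -/A => h.
  have X0 : 0 <= Xp r by rewrite /Xp invr_ge0 sqr_ge0.
  have := ler_wpM2r X0 h; rewrite /kapw exprMn exprVn -/(Xp r).
  congr (_ <= _); field.
  by rewrite !gt_eqF// (lt_trans _ r1).
have mT : measurable (`]0, T[%classic : set R) by exact: measurable_itv.
have K0 t : `]0, T[%classic t ->
    (0 <= (ip (fun r => kapw Phi d kq q t r * ra (w t) r) (ra (w t))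
     + ip (fun r => kapw Phi d kq q t r * ia (w t) r) (ia (w t)))%:E)%E.
  rewrite /= in_itv/= => tT; have /andP[t0 _] := tT.
  have w0 r : 0 <= kapw Phi d kq q t r.
    rewrite /kapw !mulr_ge0 ?(ltW Phi0) ?(ltW d0) ?invr_ge0 ?sqr_ge0//.
    by rewrite (le_trans ler01)// mw_ge1// ltW.
  rewrite lee_fin; apply: addr_ge0; apply: Rintegral_ge0 => r _;
    by rewrite -mulrA mulr_ge0// -expr2 sqr_ge0.
under eq_integral do rewrite EFinM.
rewrite (ge0_integralZl_EFin mu mT K0 mk c0) EFinM.
by apply: lee_wpmul2l Hk; rewrite lee_fin.
Qed.

End WeightedNorms.

(** * Scaling parameters and conclusion *)

Lemma cube_root (R : realType) (x : R) : 0 < x -> (x `^ (3^-1)) ^+ 3 = x.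
Proof. by move=> x0; rewrite -powR_mulrn ?powR_ge0// -powRrM mulVf// powRr1// ltW. Qed.

Lemma PhiTE (R : realType) (k : int) (nu B : R) :
  PhiT k nu B = nu `^ (3^-1) * (`|k%:~R * B| `^ (3^-1)) ^+ 2.
Proof. by rewrite /PhiT -[X in _ = _ * X]powR_mulrn ?powR_ge0// -powRrM mulrC [3^-1 * 2]mulrC mulrC. Qed.

Lemma intr_sq_ge1 (R : realType) (k : int) : k != 0 -> 1 <= (k%:~R : R) ^+ 2.
Proof.
move=> k0; rewrite -rmorphXn -[1]/(1%:~R) ler_int.
by rewrite -gtz0_ge1 lt_neqAle sqr_ge0 eq_sym expf_neq0.
Qed.

(** [B != 0] is implicit in the quotient [nu / |k B|] of the English statement. It is written out
    because division by 0 yields 0 here, and the smallness condition would then hold at [B = 0]. *)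
Theorem theorem1p1 (R : realType) :
  exists c0 : R, 0 < c0 /\
  forall q : nat, exists C : R, 0 < C /\
  forall (k : int) (nu B T : R) (w0 : R -> R[i]) (w : R -> R -> R[i]),
    k != 0 -> 0 < nu -> B != 0 ->
    nu / `|k%:~R * B| <= c0 * (1 + q%:R) ^- 3 ->
    0 < T ->
    L2 w0 ->
    weak_solution k nu B T w0 w ->
    (LpL2norm T +oo
       (fun t r => ((1 + PhiT k nu B * t / r ^+ 2) ^+ q)%:C * w t r)%R
     + (PhiT k nu B `^ (2^-1))%:E *
       LpL2norm T 2%:E
         (fun t r => ((1 + PhiT k nu B * t / r ^+ 2) ^+ q)%:C * ((r^-1)%:C * w t r))%R
     <= C%:E * L2norm w0)%E.
Proof.
(* The value of [d] is hidden at once; what follows sees only [0 < d <= 1 / 1000]. *)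
have [d [d0 d1]] : exists d : R, 0 < d /\ d <= 1 / 1000.
  exists (1 / 1000); split; last exact: lexx.
  by apply: divr_gt0; rewrite ?ltr01 ?ltr0n.
have eta0 : 0 < d / 100 by rewrite divr_gt0.
(* As [e^3 = nu / |K|], the cube root of the smallness condition reads [e (1 + q) <= d / 100]. *)
exists ((d / 100) ^+ 3); split; first exact: exprn_gt0.
move=> q; have q1 : 0 < 1 + q%:R :> R by rewrite ltr_pwDl.
pose kq : R := d / 200 / (1 + q%:R).
have kq0 : 0 < kq by rewrite !divr_gt0.
have kqE : kq * (1 + q%:R) = d / 200 by rewrite /kq mulfVK// gt_eqF.
have kq1 : kq <= 1.
  have : kq * 1 <= kq * (1 + q%:R) by rewrite ler_wpM2l ?(ltW kq0)// lerDl.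
  by rewrite kqE; lra.
pose A := kq^-1 ^+ q; have A0 : 0 < A by rewrite exprn_gt0// invr_gt0.
(* The bounds below involve [4 * N] and [8 / d * N], where [N] is the squared norm of [w 0], itself
   at most twice that of [w0]. *)
exists (A * (Num.sqrt 8 + Num.sqrt (16 / d))); split.
  by rewrite mulr_gt0// ltr_pwDl ?sqrtr_gt0// sqrtr_ge0.
move=> k nu B T w0 w k0 nu0 B0 small T0 Lw0 sol.
have [F1 [F2 [dF1 [dF2 [S _ _]]]]] := weak_solution_rsol T0 sol.
have [_ Lw _ w00 _] := sol.
set K := k%:~R * B in small S.
have K0 : K != 0 by rewrite mulf_neq0// intr_eq0.
pose x := nu `^ (3^-1); pose y := `|K| `^ (3^-1).
have x0 : 0 < x by exact: powR_gt0.
have y0 : 0 < y by rewrite powR_gt0// normr_gt0.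
have x3 : x ^+ 3 = nu by exact: cube_root.
have y3 : y ^+ 3 = `|K| by rewrite cube_root// normr_gt0.
have [Phi PhiE] : exists Phi, Phi = PhiT k nu B by exists (PhiT k nu B).
have PhiE' : Phi = x * y ^+ 2 by rewrite PhiE PhiTE.
have [e eE] : exists e, e = x / y by exists (x / y).
have yn : y != 0 by rewrite gt_eqF.
have xn : x != 0 by rewrite gt_eqF.
have Phi0 : 0 < Phi by rewrite PhiE' mulr_gt0// exprn_gt0.
have e0 : 0 < e by rewrite eE divr_gt0.
have nuE : nu = e ^+ 2 * Phi by rewrite -x3 PhiE' eE; field.
have PeE : Phi / e = `|K| by rewrite -y3 PhiE' eE; field; apply/andP.
have KE : K = Num.sg K * (Phi / e) by rewrite PeE -numEsg.
have sg1 : Num.sg K ^+ 2 = 1 by rewrite sqr_sg K0.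
have cE : nu * (k%:~R ^+ 2 - 4^-1) = Phi * (e ^+ 2 * (k%:~R ^+ 2 - 4^-1)).
  by rewrite nuE; ring.
(* As [k] is a nonzero integer, [k^2 >= 1 > 1 / 4], and the real part of the potential has the good
   sign. *)
have n0 : 0 <= e ^+ 2 * (k%:~R ^+ 2 - 4^-1).
  rewrite mulr_ge0 ?sqr_ge0// subr_ge0 (le_trans _ (intr_sq_ge1 R k0))//.
  by rewrite invf_le1// ler1n.
have eq1 : e * (1 + q%:R) <= d / 100.
  rewrite -ler_pdivlMr// -(@ler_pXn2r _ 3)// ?nnegrE ?(ltW e0) ?divr_ge0 ?(ltW d0) ?(ltW q1)//.
  by rewrite exprMn exprVn (le_trans _ small)// eE exprMn exprVn x3 y3.
have B1 := sup_norm_bound T0 S Phi0 kq0 kq1 d0 d1 e0 sg1 n0 KE nuE cE kqE eq1.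
have B2 := square_norm_bound T0 S Phi0 kq0 kq1 d0 d1 e0 sg1 n0 KE nuE cE kqE eq1.
rewrite -PhiE; have [l1 l2'] := L2_l2 Lw0.
rewrite (L2normE l1 l2'); set N0 := N2 (ra w0) (ia w0).
have N00 : 0 <= N0 by exact: N2_ge0.
have NN : N2 (ra (w 0)) (ia (w 0)) <= 2 * N0.
  by apply: N2_perturb => //; apply: Lw; rewrite lexx ltW.
move: B1 B2 NN; rewrite -/A; have := N2_ge0 (ra (w 0)) (ia (w 0)).
move: (N2 _ _) => N N_ge0 B1 B2 NN.
apply: (@le_trans _ _ ((A * Num.sqrt (4 * N))%:E + (Phi `^ 2^-1)%:E *
   (Num.sqrt (A ^+ 2 * (4 / (d * Phi)) * (2 * N)))%:E)%E).
  by apply: leeD => //; apply: lee_wpmul2l; rewrite ?lee_fin ?powR_ge0.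
rewrite -EFinM -EFinD -EFinM lee_fin powR12_sqrt ?(ltW Phi0)//.
rewrite -sqrtrM ?(ltW Phi0)//.
have -> : Phi * (A ^+ 2 * (4 / (d * Phi)) * (2 * N)) = A ^+ 2 * (8 / d * N).
  by field; rewrite !gt_eqF.
have -> : Num.sqrt (A ^+ 2 * (8 / d * N)) = A * Num.sqrt (8 / d * N).
  by rewrite sqrtrM ?sqr_ge0// sqrtr_sqr gtr0_norm.
rewrite -mulrDr [leRHS](_ : _ = A * (Num.sqrt 8 * Num.sqrt N0 + Num.sqrt (16 / d) * Num.sqrt N0)); last by ring.
rewrite ler_wpM2l ?(ltW A0)// -!sqrtrM ?divr_ge0 ?(ltW d0)//.
apply: lerD; apply: ler_wsqrtr; first by lra.
have -> : 16 / d * N0 = 8 / d * (2 * N0) by field; rewrite gt_eqF.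
by rewrite ler_wpM2l// divr_ge0// ltW.
Qed.
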